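(* Let $\Omega\subset\mathbb{R}^3$ be a bounded open set with Lipschitz boundary and let $N\ge1$. For every divergence free measure $\mu\in[\mathcal{M}(\Omega)]^{N\times3}$ there exists a sequence of polyhedral measures $\mu_k\in\mathcal{M}^1_{df}(\Omega;\mathcal{Q}\times\mathbb{S}^2)$ such that $\mu_k\overset{*}{\rightharpoonup}\mu$ weakly$*$ in $[\mathcal{M}(\Omega)]^{N\times 3}$.
   Context: $[\mathcal{M}(\Omega)]^{N\times 3}$ is the space of bounded Radon measures on $\Omega$ with values in $\mathbb{R}^{N\times 3}$. A measure $\mu=(\mu_{ij})$ is divergence free in $\Omega$ if $\int_\Omega\sum_{j=1}^3\partial_j\varphi\,d\mu_{ij}=0$ for all $\varphi\in C_c^\infty(\Omega)$ and all $i=1,\dots,N$. $\mathcal{Q}:=\{\lambda z:\lambda>0,\ z\in\mathbb{Z}^N\}\subset\mathbb{R}^N$. For $\mathcal{S}\subset\mathbb{R}^N$, $\mathcal{M}^1(\Omega;\mathcal{S}\times\mathbb{S}^{2})$ is the set of measures in $[\mathcal{M}(\Omega)]^{N\times 3}$ of the form $\theta\otimes\tau\,\mathcal{H}^1\llcorner\gamma$, where $\gamma\subset\Omega$ is 1-rectifiable with unit tangent vector $\tau$ (defined $\mathcal{H}^1$-a.e. on $\gamma$), and $\theta\in[L^1(\gamma,\mathcal{H}^1\llcorner\gamma)]^N$ satisfies $\theta(x)\in\mathcal{S}$ for $\mathcal{H}^1$-a.e. $x\in\gamma$. $\mathcal{M}^1_{df}(\Omega;\mathcal{S}\times\mathbb{S}^{2})$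 is the subset of those that are divergence free in $\Omega$. A measure in $\mathcal{M}^1(\Omega;\mathcal{S}\times\mathbb{S}^2)$ is polyhedral if its support is formed by a finite number of straight closed segments (intersected with $\Omega$). *)

(* Defs.v *)
From HB Require Import structures.
From mathcomp Require Import all_boot all_order all_algebra.
From mathcomp Require Import all_classical all_reals all_analysis.

Set Implicit Arguments.
Unset Strict Implicit.
Unset Printing Implicit Defensive.

Import Order.TTheory GRing.Theory Num.Theory.
Import numFieldNormedType.Exports.

Local Open Scope classical_set_scope.
Local Open Scope ring_scope.

(* The library norm on 'rV is the sup norm; lengths need the Euclidean one. *)
Definition enorm {R : realType} n (x : 'rV[R]_n) : R :=
  Num.sqrt (\sum_i x 0 i ^+ 2).

(* 0 is added so that the empty set has diameter 0 and not -oo. *)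
Definition diam {R : realType} (A : set 'rV[R]_3) : \bar R :=
  ereal_sup (0%E |` [set (enorm (p.1 - p.2))%:E | p in A `*` A]).

(* In dimension one the normalising constant of the Hausdorff measure is 1. *)
Definition hausdorff1_pre {R : realType} (delta : R) (A : set 'rV[R]_3) : \bar R :=
  ereal_inf [set (\sum_(k <oo) diam (F k))%E | F in
    [set F : (set 'rV[R]_3)^nat |
      (forall k, (diam (F k) <= delta%:E)%E) /\ A `<=` \bigcup_k F k]].

Definition hausdorff1 {R : realType} (A : set 'rV[R]_3) : \bar R :=
  ereal_sup [set hausdorff1_pre delta A | delta in [set d : R | 0 < d]].

Section hausdorff1_outer_measure.
Context {R : realType}.
Local Open Scope ereal_scope.
Implicit Types (A : set 'rV[R]_3) (delta : R).

Let diam_ge0 A : 0 <= diam A.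
Proof. by apply: ereal_sup_ubound; left. Qed.

Let diam0 : diam (@set0 'rV[R]_3) = 0.
Proof.
apply/eqP; rewrite eq_le diam_ge0 andbT; by apply: ge_ereal_sup => y [->//|[p [[]]]].
Qed.

Let gauge delta A : \bar R := if diam A <= delta%:E then diam A else +oo.

Let gauge_ge0 delta A : 0 <= gauge delta A.
Proof. by rewrite /gauge; case: ifP. Qed.

Let gauge0 delta : (0 < delta)%R -> gauge delta set0 = 0.
Proof. by move=> d0; rewrite /gauge diam0 lee_fin ltW. Qed.

Let disc := g_sigma_algebraType (@setT (set 'rV[R]_3)).

Let preE delta A :
  hausdorff1_pre delta A = @mu_ext _ disc _ (gauge delta) A.
Proof.
apply/eqP; rewrite eq_le; apply/andP; split; apply: le_ereal_inf_tmp.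
- move=> _ [F [_ AF] <-].
  have [Fd|] := pselect (forall k, diam (F k) <= delta%:E).
    apply: ereal_inf_lbound; exists F => //=.
    by apply: eq_eseriesr => k _; rewrite /gauge Fd.
  move/existsNP => [k /negP Fk].
  have Fkoo : gauge delta (F k) = +oo by rewrite /gauge (negbTE Fk).
  by rewrite (eseries_pinfty _ _ Fkoo) ?leey// => n _; rewrite -ltNye (lt_le_trans _ (gauge_ge0 _ _)).
- move=> _ [F [Fd AF] <-]; apply: ereal_inf_lbound; exists F => /=.
    by split=> // i; exact: sub_sigma_algebra.
  by apply: eq_eseriesr => k _; rewrite /gauge Fd.
Qed.

Let pre_le delta A : (0 < delta)%R -> hausdorff1_pre delta A <= hausdorff1 A.
Proof. by move=> d0; apply: ereal_sup_ubound; exists delta. Qed.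

Let hausdorff1_ge0 A : 0 <= hausdorff1 A.
Proof.
apply: le_trans (pre_le A ltr01).
by rewrite preE; exact: (@mu_ext_ge0 _ disc _ _ (gauge_ge0 1)).
Qed.

Let hausdorff1_0 : hausdorff1 (@set0 'rV[R]_3) = 0.
Proof.
apply/eqP; rewrite eq_le hausdorff1_ge0 andbT.
apply: ge_ereal_sup => _ [d d0 <-].
by rewrite preE (@mu_ext0 _ disc _ _ (gauge0 d0) (gauge_ge0 d)).
Qed.

Let le_hausdorff1 : {homo @hausdorff1 R : A B / A `<=` B >-> A <= B}.
Proof.
move=> A B AB; apply: ge_ereal_sup => _ [d d0 <-].
apply: le_trans (pre_le B d0).
by rewrite !preE; exact: (@le_mu_ext _ disc _ (gauge d)).
Qed.

Let hausdorff1_sigma_subadditive : sigma_subadditive (@hausdorff1 R).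
Proof.
move=> F; apply: ge_ereal_sup => _ [d d0 <-].
rewrite preE.
apply: le_trans (@mu_ext_sigma_subadditive _ disc _ _ (gauge_ge0 d) F) _.
apply: lee_nneseries => [k _|k _]; last by rewrite -preE pre_le.
by move=> ?; exact: (@mu_ext_ge0 _ disc _ _ (gauge_ge0 d)).
Qed.

HB.instance Definition _ := isOuterMeasure.Build R 'rV[R]_3 (@hausdorff1 R)
  hausdorff1_0 hausdorff1_ge0 le_hausdorff1 hausdorff1_sigma_subadditive.

End hausdorff1_outer_measure.

(* R^3 with the sigma-algebra of H^1-measurable sets, and with its Borel sets. *)
Notation hauR3 R := (caratheodory_type (@hausdorff1 R)).
Notation borelR3 R := (g_sigma_algebraType (@open 'rV[R]_3)).

Definition H1 {R : realType} : set (hauR3 R) -> \bar R := @hausdorff1 R.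

HB.instance Definition _ (R : realType) := isMeasure.Build _ _ _ (@H1 R)
  (caratheodory_measure0 (@hausdorff1 R))
  (caratheodory_measure_ge0 (mu := @hausdorff1 R))
  (@caratheodory_measure_sigma_additive _ _ (@hausdorff1 R)).

Definition lipschitz_boundary {R : realType} (Omega : set 'rV[R]_3) : Prop :=
  forall p, (closure Omega `\` interior Omega) p ->
  exists (U : 'M[R]_3) (g : 'rV[R]_2 -> R),
    [/\ U *m U^T = 1%:M, lipschitz g &
        \forall y \near p, let z : 'rV[R]_(2 + 1) := y *m U in
          Omega y <-> z 0 ord_max < g (lsubmx z)].

Definition unitv {R : realType} (j : 'I_3) : 'rV[R]_3 := delta_mx 0 j.

Definition partial {R : realType} (j : 'I_3) (f : 'rV[R]_3 -> R) : 'rV[R]_3 -> R :=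
  fun x => 'D_(unitv j) f x.

Definition smooth {R : realType} (f : 'rV[R]_3 -> R) : Prop :=
  forall s : seq 'I_3, let g := foldr partial f s in
    continuous g /\ forall x j, derivable g x (unitv j).

Definition fsupport {R : realType} (f : 'rV[R]_3 -> R) : set 'rV[R]_3 :=
  closure [set x | f x != 0].

(* C_c^oo(Omega): a test function is identified with its extension by zero. *)
Definition test_function {R : realType} (Omega : set 'rV[R]_3)
    (f : 'rV[R]_3 -> R) : Prop :=
  [/\ smooth f, compact (fsupport f) & fsupport f `<=` Omega].

(* C_0(Omega), again through extension by zero: it is the predual of M(Omega). *)
Definition C0 {R : realType} (Omega : set 'rV[R]_3) (f : 'rV[R]_3 -> R) : Prop :=
  [/\ continuous f, (forall x, ~ Omega x -> f x = 0) &
      forall e, 0 < e -> compact [set x | e <= `|f x|]].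

(* Integral of f with respect to the signed measure nu = nu^+ - nu^-; it does
   not depend on the chosen Hahn decomposition. *)
Definition charge_integral {R : realType} (nu : {charge set (borelR3 R) -> \bar R})
    (f : 'rV[R]_3 -> R) : R :=
  let P := cid (Hahn_decomposition nu) in
  let N := cid (projT2 P) in
  \int[jordan_pos (projT2 N)]_x f x - \int[jordan_neg (projT2 N)]_x f x.

(* Matrices of finite signed Borel measures; charges are finite by definition,
   and finite Borel measures on open subsets of R^3 are automatically Radon. *)
Definition mxcharge (R : realType) (N : nat) :=
  'I_N -> 'I_3 -> {charge set (borelR3 R) -> \bar R}.

(* [M(Omega)]^{N x 3}: a measure on Omega is identified with its extension by
   zero to R^3. *)
Definition radon {R : realType} (N : nat) (Omega : set 'rV[R]_3) : set (mxcharge R N) :=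
  [set mu | forall i j (A : set (borelR3 R)),
     measurable A -> A `&` Omega = set0 -> mu i j A = 0%E].

Definition divergence_free {R : realType} (N : nat) (Omega : set 'rV[R]_3)
    (mu : mxcharge R N) : Prop :=
  forall phi, test_function Omega phi ->
  forall i, \sum_(j < 3) charge_integral (mu i j) (partial j phi) = 0.

Definition weak_star_cvg {R : realType} (N : nat) (Omega : set 'rV[R]_3)
    (mu_ : nat -> mxcharge R N) (mu : mxcharge R N) : Prop :=
  forall phi, C0 Omega phi -> forall i j,
    charge_integral (mu_ k i j) phi @[k --> \oo] --> charge_integral (mu i j) phi.

Definition rectifiable1 {R : realType} (gamma : set 'rV[R]_3) : Prop :=
  [/\ measurable (gamma : set (hauR3 R)), (H1 gamma < +oo)%E &
      exists f : nat -> R -> 'rV[R]_3, (forall n, lipschitz (f n)) /\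
        H1 (gamma `\` \bigcup_n range (f n)) = 0%E].

(* t spans the approximate tangent line to gamma at x: the blow-ups
   H^1 restricted to (gamma - x) / rho converge weakly* to H^1 restricted to
   the line R t, as rho -> 0+. *)
Definition approx_tangent {R : realType} (gamma : set 'rV[R]_3) (x t : 'rV[R]_3) : Prop :=
  enorm t = 1 /\
  forall phi : 'rV[R]_3 -> R, continuous phi -> compact (fsupport phi) ->
    rho^-1 * (\int[H1]_(y in (gamma : set (hauR3 R))) phi (rho^-1 *: (y - x)))
      @[rho --> 0^'+] --> \int[lebesgue_measure]_s phi (s *: t).

(* tau is an H^1-measurable selection of the unit tangent. *)
Definition unit_tangent {R : realType} (gamma : set 'rV[R]_3)
    (tau : 'rV[R]_3 -> 'rV[R]_3) : Prop :=
  (forall j, measurable_fun (gamma : set (hauR3 R)) (fun x : hauR3 R => tau x 0 j)) /\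
  {ae H1, forall x, gamma x -> approx_tangent gamma x (tau x)}.

(* M^1(Omega; S x S^2) *)
Definition M1 {R : realType} (N : nat) (Omega : set 'rV[R]_3) (S : set 'rV[R]_N) :
    set (mxcharge R N) :=
  [set mu | radon Omega mu /\
    exists (gamma : set 'rV[R]_3) (tau : 'rV[R]_3 -> 'rV[R]_3)
           (theta : 'rV[R]_3 -> 'rV[R]_N),
    [/\ gamma `<=` Omega /\ rectifiable1 gamma,
        unit_tangent gamma tau,
        forall i, H1.-integrable (gamma : set (hauR3 R)) (fun x => (theta x 0 i)%:E),
        {ae H1, forall x, gamma x -> S (theta x)} &
        forall i j (A : set (borelR3 R)), measurable A ->
          mu i j A = (\int[H1]_(x in (A `&` gamma : set (hauR3 R)))
                        (theta x 0 i * tau x 0 j)%:E)%E]].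

Definition M1df {R : realType} (N : nat) (Omega : set 'rV[R]_3) (S : set 'rV[R]_N) :
    set (mxcharge R N) :=
  M1 Omega S `&` [set mu | divergence_free Omega mu].

Definition calQ {R : realType} {N : nat} : set 'rV[R]_N :=
  [set lambda *: map_mx intr z | lambda in [set l : R | 0 < l] & z in [set: 'rV[int]_N]].

(* Support in Omega: the points with no neighbourhood on which mu vanishes. *)
Definition msupport {R : realType} (N : nat) (Omega : set 'rV[R]_3)
    (mu : mxcharge R N) : set 'rV[R]_3 :=
  [set x | Omega x /\ forall V : set 'rV[R]_3, open V -> V x ->
     exists i j (A : set (borelR3 R)), [/\ measurable A, A `<=` V & mu i j A != 0%E]].

Definition closed_segment {R : realType} (a b : 'rV[R]_3) : set 'rV[R]_3 :=
  [set a + t *: (b - a) | t in `[0, 1]].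

Definition polyhedral {R : realType} (N : nat) (Omega : set 'rV[R]_3)
    (mu : mxcharge R N) : Prop :=
  exists s : seq ('rV[R]_3 * 'rV[R]_3), all (fun p => p.1 != p.2) s /\
    msupport Omega mu =
      Omega `&` \bigcup_(p in [set` s]) closed_segment p.1 p.2.

(* Main.v *)
From HB Require Import structures.
Require Import Defs.
From mathcomp Require Import all_boot all_order all_algebra.
From mathcomp Require Import all_classical all_reals all_analysis.
From mathcomp Require Import measurable_realfun ring lra zify.
Import Order.TTheory GRing.Theory Num.Theory.
Import numFieldNormedType.Exports.
Local Open Scope classical_set_scope.
Local Open Scope ring_scope.
Set Implicit Arguments.
Unset Strict Implicit.
Unset Printing Implicit Defensive.

(** The complement of the closure of Omega is called the exterior, ext. A polygonal chain with
    real edge weights that change only at vertices in ext, and that are 0 before the first and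
    after the last vertex, carries a measure that is divergence free in Omega: the gradient of a
    test function phi integrates to phi b - phi a along an edge ([edge_gradient]), phi vanishes
    on ext, and summation by parts leaves nothing ([abel_sum]). Since Q contains every real
    multiple of a coordinate vector ([calQ_lift]), each row of mu can be approximated separately
    by chains with real weights, and the chains superposed ([combine_chains]).

    That there are enough such chains is proved by duality ([scalar_approx]). Fix a row nu of mu
    and finitely many continuous fields, each parallel to a coordinate axis, with compact support
    in Omega. The vectors of their integrals along balanced chains of length at most M, where M
    is the mass of nu plus 1, form a bounded convex set; the claim is that its closure contains
    the vector of their integrals against nu. Otherwise these are separated by a linear
    functional ([separation]), that is, by a combination Phi of the fields such that the integral
    of Phi along any walk between exterior points is at most eps times its length, while the
    integral of Phi against nu exceeds eps M. Let u x be the infimum, over the walks from ext to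
    x, of eps times the length minus the integral of Phi ([potential]). Then
    u y - u x <= eps |y - x| - (the integral of Phi from x to y), which is a weak form of
    |grad u + Phi| <= eps, and u vanishes on ext. As Omega has a Lipschitz boundary, ext is dense
    in the complement of Omega ([lipschitz_ext_dense]), so u vanishes outside Omega. After
    truncation and smoothing, u becomes a test function ([potential_smoothing]); as nu is
    divergence free, the integral of Phi against nu equals that of grad u + Phi, and is at most
    eps times the mass of nu, up to arbitrarily small errors ([flux_bound]): a contradiction.

    To see the measure of a chain as theta (x) tau H^1 on a rectifiable set with an approximate
    tangent, the vertices are first moved slightly so that no three of them are aligned
    ([general_position]). Then two edges share at most one point, H^1-almost every point of the
    polyline belongs to a single edge, and near such a point the polyline is a line, so theta, tau
    and the blow-ups can be read off ([polyline_measure]). This rests on the measurability of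
    Borel sets for H^1 ([borel_caratheodory]) and on the identity of H^1 with arc length on lines
    ([H1_line], [integral_line]).

    Finally, at stage k the fields are the smooth bumps of a grid of mesh 1 / (k + 1), multiplied
    by the coordinate vectors. A function in C_0 is a uniform limit of combinations of these bumps
    ([grid_functions]), and the masses of the approximations stay bounded ([polyhedral_stage]),
    whence the weak* convergence. *)

(** * Smooth functions of one variable *)

Section smooth1.
Context {R : realType}.
Implicit Types (f g h : R -> R) (K : set (R -> R)).

(** [D n] is the [n]-th derivative. Carrying the whole sequence lets smooth functions be
added, multiplied and integrated without an iterated derivative operator. *)
Definition smooth1 f := exists D : nat -> R -> R,
  D 0%N = f /\ forall n (x : R), is_derive x 1 (D n) (D n.+1 x).

(** To prove smoothness it is enough to find a class of functions that is closed under
differentiation; for products and for [flat] functions the class is explicit. *)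
Lemma smooth1_class K f : K f ->
  (forall h, K h -> exists2 h', K h' & forall x : R, is_derive x 1 h (h' x)) -> smooth1 f.
Proof.
move=> Kf Kd.
have nx (h : {h | K h}) : {h' : {h | K h} | forall x : R, is_derive x 1 (sval h) (sval h' x)}.
  case: h => h Kh /=; case: (cid2 (Kd h Kh)) => h' Kh' hh'.
  by exists (exist _ h' Kh').
pose D := fun n => iter n (fun h : {h | K h} => sval (nx h)) (exist _ f Kf).
exists (fun n => sval (D n)); split => // n x.
by rewrite /D /=; case: (nx _) => h' /=; exact.
Qed.

Lemma smooth1_derive f : smooth1 f ->
  exists2 g, smooth1 g & forall x : R, is_derive x 1 f (g x).
Proof.
move=> [D [<- Dd]]; exists (D 1%N); last by move=> x; exact: Dd.
by exists (fun n => D n.+1).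
Qed.

Lemma smooth1_continuous f : smooth1 f -> continuous f.
Proof.
move=> /smooth1_derive[g _ fg] x.
by apply/differentiable_continuous/derivable1_diffP; have [] := fg x.
Qed.

Lemma smooth1_primitive f g : smooth1 g -> (forall x : R, is_derive x 1 f (g x)) -> smooth1 f.
Proof.
move=> [D [<- Dd]] fg; exists (fun n => if n is m.+1 then D m else f); split => //.
by case.
Qed.

Lemma smooth1D f g : smooth1 f -> smooth1 g -> smooth1 (f + g).
Proof.
move=> [D [<- Dd]] [E [<- Ed]].
by exists (fun n => D n + E n); split => // n x; apply: is_deriveD.
Qed.

Lemma smooth1N f : smooth1 f -> smooth1 (- f).
Proof.
move=> [D [<- Dd]].
by exists (fun n => - D n); split => // n x; apply: is_deriveN.
Qed.

Lemma smooth1_cst (c : R) : smooth1 (cst c).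
Proof.
apply: (@smooth1_class [set f | exists c, f = cst c]); first by exists c.
by move=> _ [d ->]; exists (cst 0) => [|x]; [exists 0|exact: is_derive_cst].
Qed.

Lemma is_derive_affine (a c x d : R) h : is_derive (a * x + c) 1 h d ->
  is_derive x 1 (fun t => h (a * t + c)) (a * d).
Proof.
move=> H.
have H1 : is_derive x 1 (fun t => a * t + c) a.
  have -> : (fun t => a * t + c) = (a \*: (@id R) + cst c)%R by [].
  have := is_deriveD (is_deriveZ a (is_derive_id x (1 : R))) (is_derive_cst c x (1 : R)).
  by rewrite addr0 /GRing.scale /= mulr1.
have := @is_derive1_comp R h (fun t => a * t + c) x d a H H1.
by rewrite mulrC.
Qed.

Lemma smooth1_affine f (a c : R) : smooth1 f -> smooth1 (fun t => f (a * t + c)).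
Proof.
move=> [D [<- Dd]].
exists (fun n t => a ^+ n * D n (a * t + c)); split.
  by apply/funext => t; rewrite mul1r.
move=> n x.
have := is_derive_affine (Dd n (a * x + c)) => H.
have := is_deriveZ (a ^+ n) H.
by rewrite /GRing.scale /= mulrA -exprSr.
Qed.

(** By the Leibniz rule, the finite sums of products of smooth functions are closed under
differentiation. *)
Lemma smooth1M f g : smooth1 f -> smooth1 g -> smooth1 (fun x => f x * g x).
Proof.
move=> sf sg.
pose Kp := [set p : (R -> R) * (R -> R) | smooth1 p.1 /\ smooth1 p.2].
pose F (s : seq ((R -> R) * (R -> R))) x := \sum_(p <- s) p.1 x * p.2 x.
apply: (@smooth1_class [set h | exists2 s, (forall p, p \in s -> Kp p) & h = F s]).
  exists [:: (f, g)]; last by apply/funext => x; rewrite /F big_seq1.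
  by move=> p; rewrite inE => /eqP ->.
move=> _ [s Ks ->].
elim: s Ks => [|[a b] s IH] Ks.
  exists (cst 0).
    by exists [::] => //; apply/funext => x; rewrite /F big_nil.
  move=> x; have -> : F [::] = cst 0 by apply/funext => y; rewrite /F big_nil.
  exact: is_derive_cst.
have [p ps|_ [s' Ks' ->] h'd] := IH; first by apply: Ks; rewrite inE ps orbT.
have [/= sa sb] := Ks (a, b) (mem_head _ _).
have [a' sa' aa'] := smooth1_derive sa.
have [b' sb' bb'] := smooth1_derive sb.
exists (F ((a', b) :: (a, b') :: s')).
  exists ((a', b) :: (a, b') :: s') => // p; rewrite !inE => /or3P[/eqP->|/eqP->|] //.
  exact: Ks'.
move=> x.
have -> : F ((a, b) :: s) = (a * b + F s)%R.
  by apply/funext => y; rewrite /F big_cons.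
have := is_deriveD (is_deriveM (aa' x) (bb' x)) (h'd x).
rewrite /GRing.scale /= => H; apply: is_derive_eq H _.
rewrite [RHS]/F !big_cons /= -/(F s' x) addrA; congr (_ + _).
by rewrite addrC (mulrC (b x)).
Qed.

(** The functions p(1/t) exp(-1/t), extended by zero to t <= 0. Letting the polynomial vary makes
them closed under differentiation, which one function exp(-1/t) alone is not. *)
Definition flat (p : {poly R}) (t : R) : R := if 0 < t then p.[t^-1] * expR (- t^-1) else 0.

Lemma poly_growth (p : {poly R}) : exists A n, 0 <= A /\
  forall s, 0 <= s -> `|p.[s]| <= A * (1 + s) ^+ n.
Proof.
elim/poly_ind: p => [|p c [A [n [A0 pA]]]].
  by exists 0, 0%N; split => // s _; rewrite horner0 normr0 mul0r.
exists (A + `|c|), n.+1; split => [|s s0]; first by rewrite addr_ge0.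
rewrite hornerMXaddC (le_trans (ler_normD _ _))// mulrDl lerD//.
  rewrite normrM (ger0_norm s0) exprSr mulrA ler_pM// ?pA//; lra.
by rewrite ler_peMr// exprn_ege1//; lra.
Qed.

(** exp s = exp(s / k)^k >= (1 + s / k)^k >= ((1 + s) / k)^k for k = n + 1. *)
Lemma expR_growth (s : R) n : 0 <= s -> ((1 + s) / n.+1%:R) ^+ n.+1 <= expR s.
Proof.
move=> s0.
have -> : expR s = expR (s / n.+1%:R) ^+ n.+1.
  by rewrite -expRM_natr divfK// pnatr_eq0.
apply: lerXn2r; rewrite ?nnegrE ?expR_ge0 ?divr_ge0 ?addr_ge0//.
apply: le_trans (expR_ge1Dx _).
rewrite mulrDl lerD2r mul1r invf_le1 ?ltr0n//.
by rewrite ler1n.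
Qed.

(** The exponential dominates every polynomial in 1/t. A bound by t^2, for every p, is what makes
[flat p] differentiable at 0 with derivative 0. *)
Lemma flat_quad p : exists C, 0 <= C /\ forall t, `|flat p t| <= C * t ^+ 2.
Proof.
have [A [n [A0 pA]]] := poly_growth p.
exists (A * n.+2%:R ^+ n.+2); split => [|t]; first by rewrite mulr_ge0// exprn_ge0.
rewrite /flat; case: ifPn => [t0|_]; last first.
  by rewrite normr0 mulr_ge0 ?sqr_ge0// mulr_ge0// exprn_ge0.
set s := t^-1; have s0 : 0 < s by rewrite invr_gt0.
rewrite normrM (ger0_norm (expR_ge0 _)) expRN.
rewrite ler_pdivrMr ?expR_gt0//.
have := @expR_growth s n.+1 (ltW s0); set E := expR s => hE.
apply: le_trans (pA _ (ltW s0)) _.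
have hE' : (1 + s) ^+ n.+2 <= n.+2%:R ^+ n.+2 * E.
  rewrite mulrC -ler_pdivrMr; last by rewrite exprn_gt0// ltr0n.
  by rewrite -expr_div_n.
have -> : A * n.+2%:R ^+ n.+2 * t ^+ 2 * E = A * (t ^+ 2 * (n.+2%:R ^+ n.+2 * E)) by ring.
apply: ler_wpM2l => //.
have -> : t = s^-1 by rewrite invrK.
have h2 : (1 + s) ^+ n <= s^-1 ^+ 2 * (1 + s) ^+ n.+2.
  have -> : (1 + s) ^+ n.+2 = (1 + s) ^+ n * (1 + s) ^+ 2 by rewrite -exprD addn2.
  rewrite mulrCA; apply: ler_peMr; first by apply: exprn_ge0; lra.
  rewrite -exprMn; apply: exprn_ege1.
  by rewrite mulrDr mulVf ?gt_eqF// mulr1 lerDr invr_ge0 ltW.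
apply: le_trans h2 _.
by apply: ler_wpM2l => //; rewrite sqr_ge0.
Qed.

Lemma flat_derive p (x : R) : is_derive x 1 (flat p) (flat ('X^2 * (p - p^`())) x).
Proof.
have [x0|x0|->] := ltgtP x 0.
- rewrite {2}/flat ltNge (ltW x0) /=.
  apply: (@near_eq_is_derive _ _ _ (cst 0)).
  near=> y; rewrite /flat ifF//; apply/negbTE; rewrite -leNgt ltW//.
  by near: y; apply: lt_nbhsl.
- rewrite {2}/flat x0 /=.
  have hV : is_derive x 1 (fun t : R => t^-1) (- x ^- 2).
    have := @is_deriveV R id x 1 1 (lt0r_neq0 x0) _.
    by rewrite /GRing.scale /= mulr1 => H; exact: H.
  have h1 := @is_derive1_comp R _ _ x _ _ (is_derive_poly p (x^-1)) hV.
  have h2 := @is_derive1_comp R expR (fun t => - t^-1) x _ _ (is_derive_expR _) (is_deriveN hV).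
  have := is_deriveM h1 h2; rewrite /GRing.scale /= => H.
  have {}H : is_derive x 1 (fun t => p.[t^-1] * expR (- t^-1))
      (('X^2 * (p - p^`())).[x^-1] * expR (- x^-1)).
    by apply: is_derive_eq H _; rewrite !hornerE /= exprVn; ring.
  apply: near_eq_is_derive H.
  by near=> y; rewrite /flat ifT//; near: y; exact: lt_nbhsr.
- have [C [C0 hC]] := flat_quad p.
  rewrite {2}/flat ltxx.
  have f0 : flat p 0 = 0 by rewrite /flat ltxx.
  have H : h^-1 *: (flat p (h *: 1 + 0) - flat p 0) @[h --> 0^'] --> 0.
    apply/cvgr0Pnorm_le => e e0.
    have C1 : 0 < C + 1 by rewrite ltr_wpDl.
    have Ce0 : 0 < (C + 1)^-1 * e by rewrite mulr_gt0 ?invr_gt0.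
    near=> h.
    have hn0 : h != 0 by near: h; exact: nbhs_dnbhs_neq.
    rewrite f0 subr0 addr0 /GRing.scale /= mulr1 normrM normfV.
    rewrite ler_pdivrMl ?normr_gt0//.
    apply: le_trans (hC h) _.
    rewrite -(real_normK (num_real h)) expr2 mulrCA ler_wpM2l//.
    have hs : `|h| <= (C + 1)^-1 * e by near: h; exact: dnbhs0_le.
    apply: (@le_trans _ _ ((C + 1) * `|h|)); first by rewrite ler_wpM2r// lerDl.
    by rewrite -ler_pdivlMl.
  apply: DeriveDef; first by apply/cvg_ex; exists 0.
  exact: cvg_lim H.
Unshelve. all: by end_near.
Qed.

Lemma flat_smooth p : smooth1 (flat p).
Proof.
apply: (@smooth1_class [set f | exists q, f = flat q]); first by exists p.
move=> _ [q ->]; exists (flat ('X^2 * (q - q^`()))) => [|x]; last exact: flat_derive.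
by eexists.
Qed.

End smooth1.

(** * A pair of partitions of unity *)

Section bumps.
Context {R : realType}.
Implicit Types (f g h : R -> R).

Lemma der_continuous f f' : (forall x : R, is_derive x 1 f (f' x)) -> continuous f.
Proof.
by move=> ff x; apply/differentiable_continuous/derivable1_diffP; have [] := ff x.
Qed.

Lemma der_mvt f f' (a b : R) : (forall x : R, is_derive x 1 f (f' x)) -> a < b ->
  exists2 c, a < c < b & f b - f a = f' c * (b - a).
Proof.
move=> ff ab.
have [|c cab E] := MVT ab (fun x _ => ff x).
  by apply: continuous_subspaceT => x; exact: (der_continuous ff).
by exists c => //; move: cab; rewrite in_itv.
Qed.

Lemma der_nd f f' : (forall x : R, is_derive x 1 f (f' x)) -> (forall x, 0 <= f' x) ->
  forall a b, a <= b -> f a <= f b.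
Proof.
move=> ff f0 a b; rewrite le_eqVlt => /predU1P[->//|ab].
have [c _ E] := der_mvt ff ab.
by rewrite -subr_ge0 E mulr_ge0// subr_ge0 ltW.
Qed.

Lemma der_cst f f' (a b : R) : (forall x : R, is_derive x 1 f (f' x)) -> a <= b ->
  (forall x, a < x < b -> f' x = 0) -> f a = f b.
Proof.
move=> ff; rewrite le_eqVlt => /predU1P[->//|ab] f0.
have [c /f0 E0 E] := der_mvt ff ab.
by apply/eqP; rewrite eq_sym -subr_eq0 E E0 mul0r.
Qed.

Lemma antiderivative g (c : R) : continuous g -> (forall t, t <= c -> g t = 0) ->
  exists2 G, (forall x : R, is_derive x 1 G (g x)) & forall t, t <= c -> G t = 0.
Proof.
move=> cg g0.
pose G x := (\int[lebesgue_measure]_(t in `[c - 1, x]) g t)%R.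
have G0 t : t <= c -> G t = 0.
  move=> tc; rewrite /G /Rintegral integral0_eq//= => x.
  by rewrite in_itv/= => /andP[_ xt]; rewrite g0// (le_trans xt).
exists G => // x.
have [xc|cx] := ltP x c.
  rewrite g0 ?ltW//; have := is_derive_cst (0 : R) x (1 : R).
  by apply: near_eq_is_derive; near=> y; rewrite G0// ltW//; near: y; exact: lt_nbhsl.
have [||||d e] := @continuous_FTC1_closed R g (c - 1) x (x + 1).
- by rewrite ltrDl.
- by apply: continuous_compact_integrable; [exact: segment_compact|exact: continuous_subspaceT].
- lra.
- exact: cg.
by split; [exact: d|rewrite -derive1E; exact: e].
Unshelve. all: by end_near.
Qed.

Lemma sum_shift_telescope f x m :
  \sum_(k < m) (f (x - k%:R + 1) - f (x - k%:R)) = f (x + 1) - f (x + 1 - m%:R).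
Proof.
elim: m => [|m IH]; first by rewrite big_ord0 subr0 subrr.
rewrite big_ord_recr /= IH -[m.+1]addn1 natrD.
have -> : x - m%:R + 1 = x + 1 - m%:R by ring.
have -> : x + 1 - (m%:R + 1) = x - m%:R by ring.
ring.
Qed.

(** The normalised primitive of the bump exp(-1/t) exp(-1/(1-t)). *)
Lemma smooth_step : exists S : R -> R, [/\ smooth1 S, (forall t, t <= 0 -> S t = 0),
  (forall t, 1 <= t -> S t = 1) & (forall a b, a <= b -> S a <= S b)].
Proof.
pose b t : R := flat 1 t * flat 1 (-1 * t + 1).
have sb : smooth1 b.
  by apply: smooth1M; [|apply: (smooth1_affine (-1) 1)]; exact: flat_smooth.
have b_ge0 t : 0 <= b t.
  by apply: mulr_ge0; rewrite /flat; case: ifP => // _; rewrite hornerC mul1r expR_ge0.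
have b0 t : t <= 0 -> b t = 0 by move=> t0; rewrite /b /flat ltNge t0 /= mul0r.
have b1 t : 1 <= t -> b t = 0.
  by move=> t0; rewrite /b [X in _ * X]/flat ifF ?mulr0//; apply/negbTE; rewrite -leNgt; lra.
have [G Gb G0] := antiderivative (smooth1_continuous sb) b0.
have G1 : 0 < G 1.
  have [c /andP[c0 c1]] := der_mvt Gb (@ltr01 R).
  rewrite (G0 0)// !subr0 mulr1 => ->.
  rewrite /b /flat c0 ifT; last by lra.
  by rewrite !hornerC !mul1r mulr_gt0 ?expR_gt0.
have sG : smooth1 G := smooth1_primitive sb Gb.
have sE : smooth1 (fun t => (G 1)^-1 * G t).
  by apply: (@smooth1M _ (cst (G 1)^-1)) => //; exact: smooth1_cst.
exists (fun t => (G 1)^-1 * G t); split => //.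
- by move=> t t0 /=; rewrite (G0 t t0) mulr0.
- move=> t t1 /=; rewrite -(der_cst Gb t1) ?mulVf ?gt_eqF// => x /andP[x1 _].
  by rewrite b1// ltW.
- move=> x y xy /=; apply: ler_wpM2l; first by rewrite invr_ge0 ltW.
  exact: (der_nd Gb b_ge0).
Qed.

(** Two bumps, each with integer translates adding up to 1, tied by
beta'(t) = alpha(t + 1) - alpha(t), as consecutive B-splines are. By this relation the
derivative of a beta-expansion is the alpha-expansion of the differences of its
coefficients, so gradients of interpolations are averages of difference quotients. *)
Record bump_pair := BumpPair {
  balpha : R -> R; bbeta : R -> R;
  balpha_smooth : smooth1 balpha; bbeta_smooth : smooth1 bbeta;
  balpha_ge0 : forall t, 0 <= balpha t; bbeta_ge0 : forall t, 0 <= bbeta t;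
  balpha_supp : forall t, 2 <= `|t| -> balpha t = 0;
  bbeta_supp : forall t, 2 <= `|t| -> bbeta t = 0;
  bbeta_derive : forall t : R, is_derive t 1 bbeta (balpha (t + 1) - balpha t);
  balpha_sum : forall (m : nat) x, 0 <= x -> x + 2 <= m%:R -> \sum_(k < m) balpha (x - k%:R) = 1;
  bbeta_sum : forall (m : nat) x, 0 <= x -> x + 2 <= m%:R -> \sum_(k < m) bbeta (x - k%:R) = 1;
  balpha_sum_le : forall (m : nat) x, \sum_(k < m) balpha (x - k%:R) <= 1;
  bbeta_sum_le : forall (m : nat) x, \sum_(k < m) bbeta (x - k%:R) <= 1 }.

(** For a smooth step S, the function alpha(t) = S(t + 1) - S(t) has translates that telescope
to 1. Its primitive E is again a step, and gives beta in the same way. *)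
Lemma bumps : $|bump_pair|.
Proof.
have [S [sS S0 S1 Sn]] := smooth_step.
have SE t : 0 <= S t <= 1.
  have lo : S (Num.min t 0) <= S t by apply: Sn; rewrite ge_min lexx.
  have hi : S t <= S (Num.max t 1) by apply: Sn; rewrite le_max lexx.
  by move: lo hi; rewrite (S0 (Num.min t 0)) ?ge_min ?lexx ?orbT// (S1 (Num.max t 1)) ?le_max ?lexx ?orbT// => -> ->.
have shift g (g' : R -> R) : (forall x : R, is_derive x 1 g (g' x)) ->
    forall x : R, is_derive x 1 (fun t => g (t + 1)) (g' (x + 1)).
  move=> gg x; have := @is_derive_affine R 1 1 x (g' (x + 1)) g.
  rewrite !mul1r => /(_ (gg _)).
  by under eq_fun do rewrite mul1r.
have sshift g : smooth1 g -> smooth1 (fun t => g (t + 1)).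
  by move=> /(smooth1_affine 1 1); under eq_fun do rewrite mul1r.
pose a t := S (t + 1) - S t.
have sa : smooth1 a by apply: smooth1D; [exact: sshift|exact: smooth1N].
have a_ge0 t : 0 <= a t by rewrite subr_ge0 Sn// lerDl.
have a0 t : t <= -1 -> a t = 0.
  by move=> t1; rewrite /a !S0 ?subrr//; lra.
have a1 t : 1 <= t -> a t = 0.
  by move=> t1; rewrite /a !S1 ?subrr//; lra.
have [E Ea E0] := antiderivative (smooth1_continuous sa) a0.
have En := der_nd Ea a_ge0.
(* On ]-1, 0[ the derivative of E + E(. + 1) is S(c + 2) - S(c) = 1 - 0, and this function
   grows there from E 0 to E 0 + E 1. *)
have E1 : E 1 = 1.
  pose H t := E t + E (t + 1).
  have Ha (x : R) : is_derive x 1 H (a x + a (x + 1)).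
    exact: (is_deriveD (Ea x) (shift _ _ Ea x)).
  have [|c /andP[c1 c0]] := der_mvt Ha (_ : -1 < 0); first by rewrite ltrN10.
  rewrite /H /a addNr !add0r (E0 (-1))// (S0 c) ?ltW// (S1 (c + 1 + 1)); last by lra.
  lra.
have E1' t : 1 <= t -> E t = 1.
  by move=> t1; rewrite -(der_cst Ea t1) ?E1// => x /andP[/ltW/a1].
have EE t : 0 <= E t <= 1.
  have lo : E (Num.min t (-1)) <= E t by apply: En; rewrite ge_min lexx.
  have hi : E t <= E (Num.max t 1) by apply: En; rewrite le_max lexx.
  by move: lo hi; rewrite (E0 (Num.min t (-1))) ?ge_min ?lexx ?orbT// (E1' (Num.max t 1)) ?le_max ?lexx ?orbT// => -> ->.
have sE : smooth1 E := smooth1_primitive sa Ea.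
apply/squash; apply: (@BumpPair a (fun t => E (t + 1) - E t)) => //.
- by apply: smooth1D; [exact: sshift|exact: smooth1N].
- by move=> t; rewrite subr_ge0 En// lerDl.
- by move=> t; rewrite ler_normr => /orP[] ?; [rewrite a1|rewrite a0] => //; lra.
- move=> t; rewrite ler_normr => /orP[] ?; first by rewrite !E1' ?subrr//; lra.
  by rewrite !E0 ?subrr//; lra.
- by move=> m x x0 xm; rewrite /a sum_shift_telescope S1 ?S0 ?subr0//; lra.
- by move=> m x x0 xm; rewrite sum_shift_telescope E1' ?E0 ?subr0//; lra.
- move=> m x; rewrite /a sum_shift_telescope.
  by have := SE (x + 1); have := SE (x + 1 - m%:R); lra.
- move=> m x; rewrite sum_shift_telescope.
  by have := EE (x + 1); have := EE (x + 1 - m%:R); lra.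
Qed.

End bumps.
Arguments bump_pair : clear implicits.

(** * Sums of products of functions of one coordinate *)

Lemma sum_continuous (R : realType) (I : Type) (s : seq I) (c : I -> R) (f : I -> 'rV[R]_3 -> R) :
  (forall i, continuous (f i)) -> continuous (fun x => \sum_(i <- s) c i * f i x).
Proof.
move=> cf; elim: s => [|i s IH].
  by under eq_fun do rewrite big_nil; exact: cst_continuous.
under eq_fun do rewrite big_cons.
by move=> x; exact: (cvgD (cvgM (cvg_cst (c i)) (cf i x)) (IH x)).
Qed.

Section rv_norm.
Context {R : realType} {n : nat}.
Implicit Types x y : 'rV[R]_n.

Lemma coord_le_norm x i : `|x 0 i| <= `|x|.
Proof. by rewrite [leRHS]mx_normrE; apply: (le_bigmax _ _ (0, i)). Qed.

Lemma norm_le_coord x (e : R) : 0 <= e -> (forall i, `|x 0 i| <= e) -> `|x| <= e.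
Proof.
by move=> e0 xe; rewrite [leLHS]mx_normrE; apply: bigmax_le => //= -[i j] _; rewrite (ord1 i).
Qed.

End rv_norm.

Section line_derive.
Context {R : realType}.
Implicit Types (f : 'rV[R]_3 -> R) (x v : 'rV[R]_3).

Lemma line_growth f x v :
  (fun h : R => h^-1 *: ((f \o shift x) (h *: v) - f x)) =
  (fun h : R => h^-1 *: (((fun h : R => f (h *: v + x)) \o shift 0) (h *: 1) - f (0 *: v + x))).
Proof. by apply/funext => h /=; rewrite addr0 scale0r add0r [_%:A]mulr1. Qed.

Lemma is_derive_line f x v (d : R) :
  is_derive (0 : R) (1 : R) (fun h : R => f (h *: v + x)) d -> is_derive x v f d.
Proof.
move=> [h1 h2]; split; first exact: (derivable1P f x v).2 h1.
by rewrite -h2 /derive line_growth.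
Qed.

Lemma line_is_derive f x v (d : R) :
  is_derive x v f d -> is_derive (0 : R) (1 : R) (fun h : R => f (h *: v + x)) d.
Proof.
move=> [h1 h2]; split; first exact: (derivable1P f x v).1 h1.
by rewrite -h2 /derive line_growth.
Qed.

Lemma unitvE j i : (unitv j : 'rV[R]_3) 0 i = (i == j)%:R.
Proof. by rewrite mxE eqxx. Qed.

Definition tens (g : 'I_3 -> R -> R) x : R := \prod_i g i (x 0 i).

Definition upd (g : 'I_3 -> R -> R) j h i := if i == j then h else g i.

Lemma tens_derive g j h x : is_derive (x 0 j) 1 (g j) (h (x 0 j)) ->
  is_derive x (unitv j) (tens g) (tens (upd g j h) x).
Proof.
move=> gh; apply: is_derive_line.
pose c := \prod_(i | i != j) g i (x 0 i).
have E1 : (fun k : R => tens g (k *: unitv j + x)) = (fun k => c * g j (1 * k + x 0 j)).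
  apply/funext => k; rewrite /tens (bigD1 j)//= mulrC; congr (_ * g j _).
    by apply: eq_bigr => i /negbTE ij; rewrite !mxE ij eqxx mulr0 add0r.
  by rewrite !mxE !eqxx mulr1 mul1r.
have -> : tens (upd g j h) x = c * h (x 0 j).
  rewrite /tens (bigD1 j)//= /upd eqxx mulrC; congr (_ * _).
  by apply: eq_bigr => i /negbTE ->.
rewrite E1.
have := @is_derive_affine R 1 (x 0 j) 0 (h (x 0 j)) (g j).
rewrite !mul1r add0r => /(_ gh) H.
exact: (is_deriveZ c H).
Qed.

Lemma tens_continuous g : (forall i, continuous (g i)) -> continuous (tens g).
Proof.
move=> cg; rewrite /tens.
have -> : (fun x : 'rV[R]_3 => \prod_i g i (x 0 i)) =
    (fun x => g 0 (x 0 0) * (g 1 (x 0 1) * g 2%:R (x 0 2%:R))).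
  apply/funext => x; rewrite !big_ord_recl big_ord0 mulr1; congr (_ * (g _ (x 0 _) * g _ (x 0 _))); exact/val_inj.
have cc i : continuous (fun x : 'rV[R]_3 => g i (x 0 i)).
  move=> x; apply: (@continuous_comp _ _ _ (fun x : 'rV[R]_3 => x 0 i) (g i)); last exact: cg.
  exact: coord_continuous.
by move=> x; exact: (cvgM (cc 0 x) (cvgM (cc 1 x) (cc 2%:R x))).
Qed.

Definition tens_comb (s : seq (R * ('I_3 -> R -> R))) x := \sum_(p <- s) p.1 * tens p.2 x.

(** Smoothness in three variables is only ever needed for these sums, and reduces for them to
one variable. The summands are functions, without decidable equality, hence [List.In]. *)
Definition tens_class : set ('rV[R]_3 -> R) := [set f | exists2 s,
  (forall p, List.In p s -> forall i, smooth1 (p.2 i)) & f = tens_comb s].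

Lemma tens_class_continuous f : tens_class f -> continuous f.
Proof.
move=> [s ss ->]; elim: s ss => [|p s IH] ss x.
  by rewrite /tens_comb; under eq_fun do rewrite big_nil; exact: cst_continuous.
rewrite /tens_comb; under eq_fun do rewrite big_cons.
apply: (cvgD (cvgM (cvg_cst p.1) _) (IH _ x)); last by move=> q qs; apply: ss; right.
by apply: tens_continuous => i; apply: smooth1_continuous; apply: ss; left.
Qed.

Lemma tens_class_derive f j : tens_class f ->
  exists2 g, tens_class g & forall x, is_derive x (unitv j) f (g x).
Proof.
move=> [s ss ->]; elim: s ss => [|p s IH] ss.
  exists (tens_comb [::]); first by exists [::].
  have -> : tens_comb [::] = cst 0 by apply/funext => x; rewrite /tens_comb big_nil.
  by move=> x; exact: is_derive_cst.
have [|_ [s' ss' ->] h] := IH; first by move=> q qs; apply: ss; right.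
have [|h' sh' hh'] := @smooth1_derive R (p.2 j); first by apply: ss; left.
exists (tens_comb ((p.1, upd p.2 j h') :: s')).
  exists ((p.1, upd p.2 j h') :: s') => // q [<- i|]; last exact: ss'.
  rewrite /= /upd; case: ifP => // _; apply: ss; left.
  by [].
move=> x.
have -> : tens_comb (p :: s) = (p.1 \*: tens p.2 + tens_comb s)%R.
  by apply/funext => y; rewrite /tens_comb big_cons.
have -> : tens_comb ((p.1, upd p.2 j h') :: s') x = p.1 * tens (upd p.2 j h') x + tens_comb s' x.
  by rewrite /tens_comb big_cons.
exact: (is_deriveD (is_deriveZ p.1 (tens_derive (hh' (x 0 j)))) (h x)).
Qed.

Lemma tens_class_smooth f : tens_class f -> smooth f.
Proof.
move=> Tf s /=.
suff Tg : tens_class (foldr partial f s).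
  split; first exact: tens_class_continuous.
  by move=> x j; have [g _ /(_ x)[]] := tens_class_derive j Tg.
elim: s => [//|j s IH] /=.
have [g Tg fg] := tens_class_derive j IH.
have -> : partial j (foldr partial f s) = g; last exact: Tg.
by apply/funext => x; rewrite /partial; have [_ ->] := fg x.
Qed.

End line_derive.

(** * Interpolation on a grid *)

(** The alternative on the weights covers the points off the grid: there the weights may add up
to less than 1, but the approximated value is 0. *)
Lemma convex_combination_near (R : realType) (T : finType) (w c : T -> R) (phi eta : R) :
  (forall z, 0 <= w z) -> \sum_z w z <= 1 -> \sum_z w z = 1 \/ phi = 0 -> 0 <= eta ->
  (forall z, w z != 0 -> `|c z - phi| <= eta) -> `|\sum_z w z * c z - phi| <= eta.
Proof.
move=> w0 w1 wphi eta0 H.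
have -> : \sum_z w z * c z - phi = \sum_z w z * (c z - phi).
  under [RHS]eq_bigr do rewrite mulrBr.
  rewrite sumrB -mulr_suml; case: wphi => ->; first by rewrite mul1r.
  by rewrite mulr0.
apply: (le_trans (ler_norm_sum _ _ _)).
apply: (@le_trans _ _ (\sum_z w z * eta)); last first.
  by rewrite -mulr_suml ler_piMl.
apply: ler_sum => z _; rewrite normrM ger0_norm//.
have [->|wz] := eqVneq (w z) 0; first by rewrite !mul0r.
by rewrite ler_wpM2l// H.
Qed.

Lemma is_derive_bigsum (R : realType) (I : Type) (s : seq I) (f : I -> 'rV[R]_3 -> R)
    (d : I -> R) (x v : 'rV[R]_3) :
  (forall i, is_derive x v (f i) (d i)) ->
  is_derive x v (fun y => \sum_(i <- s) f i y) (\sum_(i <- s) d i).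
Proof.
move=> fd; elim: s => [|i s IH].
  under eq_fun do rewrite big_nil.
  by rewrite big_nil; exact: is_derive_cst.
under eq_fun do rewrite big_cons.
by rewrite big_cons; exact: (is_deriveD (fd i) IH).
Qed.

Section grid.
Context {R : realType} (B : bump_pair R) (delta : R) (delta_gt0 : 0 < delta) (n : nat).
Notation m := (2 * n).+1.
Notation gidx := {ffun 'I_3 -> 'I_m}.
Implicit Types (z : gidx) (x : 'rV[R]_3).

(** The grid has 2n + 1 points in each direction, centred at the origin, so that it covers the
box of half-width n delta. *)
Definition grid_pt z : 'rV[R]_3 := \row_i (delta * ((z i)%:R - n%:R)).

Definition gshift (k : 'I_m) (t : R) := delta^-1 * t + (n%:R - k%:R).

Definition grid_bump z : 'rV[R]_3 -> R := tens (fun i t => bbeta B (gshift (z i) t)).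

(** The coefficient functions of the [j]-th partial derivative of an interpolation: alpha in
direction [j], beta in the two others. *)
Definition grid_weight j z : 'rV[R]_3 -> R :=
  tens (fun i t => (if i == j then balpha B else bbeta B) (gshift (z i) t)).

Lemma gshiftE k t : gshift k t = (delta^-1 * t + n%:R) - k%:R.
Proof. by rewrite /gshift addrA. Qed.

Lemma grid_bump_comb (s : seq gidx) (c : gidx -> R) :
  tens_class (fun x => \sum_(z <- s) c z * grid_bump z x).
Proof.
exists [seq (c z, fun i t => bbeta B (gshift (z i) t)) | z <- s].
  move=> p; elim: s => [[]|z s IH] /= [<- i|]; last exact: IH.
  by apply: smooth1_affine; exact: bbeta_smooth.
by apply/funext => x; rewrite /tens_comb big_map.
Qed.

Lemma gshift_supp (k : 'I_m) (t : R) : `|gshift k t| < 2 -> `|t - delta * (k%:R - n%:R)| <= 2 * delta.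
Proof.
move=> /ltW h.
have -> : t - delta * (k%:R - n%:R) = delta * gshift k t.
  by rewrite /gshift; field; rewrite gt_eqF.
by rewrite normrM gtr0_norm// mulrC ler_wpM2r// ltW.
Qed.

Lemma tens_supp (z : gidx) (g : 'I_3 -> R -> R) x :
  (forall i t, 2 <= `|t| -> g i t = 0) ->
  tens (fun i t => g i (gshift (z i) t)) x != 0 -> `|x - grid_pt z| <= 2 * delta.
Proof.
move=> gs /prodf_neq0 gz; apply: norm_le_coord; first by rewrite mulr_ge0// ltW.
move=> i; rewrite !mxE; apply: gshift_supp; rewrite ltNge; apply/negP => /gs.
by move=> gi; move: (gz i isT); rewrite gi eqxx.
Qed.

Lemma grid_bump_supp z x : grid_bump z x != 0 -> `|x - grid_pt z| <= 2 * delta.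
Proof. by apply: (@tens_supp _ (fun=> bbeta B)) => i t; exact: bbeta_supp. Qed.

Lemma grid_weight_supp j z x : grid_weight j z x != 0 -> `|x - grid_pt z| <= 2 * delta.
Proof.
apply: (@tens_supp _ (fun i => if i == j then balpha B else bbeta B)) => i t.
by case: ifP => _; [exact: balpha_supp|exact: bbeta_supp].
Qed.

Lemma grid_bump_ge0 z x : 0 <= grid_bump z x.
Proof. by apply: prodr_ge0 => i _; exact: bbeta_ge0. Qed.

Lemma grid_weight_ge0 j z x : 0 <= grid_weight j z x.
Proof. by apply: prodr_ge0 => i _; case: ifP => _; [exact: balpha_ge0|exact: bbeta_ge0]. Qed.

Lemma tens_sum (g : 'I_3 -> R -> R) x :
  \sum_(z : gidx) tens (fun i t => g i (gshift (z i) t)) x =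
  \prod_i \sum_(k < m) g i ((delta^-1 * x 0 i + n%:R) - k%:R).
Proof.
rewrite bigA_distr_bigA; apply: eq_bigr => z _; apply: eq_bigr => i _.
by rewrite gshiftE.
Qed.

Lemma gcoord (x : 'rV[R]_3) i : (`|x 0 i| <= (n%:R - 1) * delta) ->
  0 <= delta^-1 * x 0 i + n%:R /\ delta^-1 * x 0 i + n%:R + 2 <= m%:R.
Proof.
move=> xi.
have : `|delta^-1 * x 0 i| <= n%:R - 1.
  by rewrite normrM (gtr0_norm (_ : 0 < delta^-1)) ?invr_gt0// ler_pdivrMl// mulrC.
have -> : m%:R = 2 * n%:R + 1 :> R by rewrite -natr1 natrM.
rewrite ler_norml => /andP[]; lra.
Qed.

Lemma grid_bump_sum x : `|x| <= (n%:R - 1) * delta -> \sum_z grid_bump z x = 1.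
Proof.
move=> xn; rewrite (tens_sum (fun=> bbeta B)) big1// => i _.
have [a b] := @gcoord x i (le_trans (coord_le_norm x i) xn).
by rewrite bbeta_sum.
Qed.

Lemma grid_weight_sum j x : `|x| <= (n%:R - 1) * delta -> \sum_z grid_weight j z x = 1.
Proof.
move=> xn; rewrite (tens_sum (fun i => if i == j then balpha B else bbeta B)) big1// => i _.
have [a b] := @gcoord x i (le_trans (coord_le_norm x i) xn).
by case: ifP => _; rewrite ?bbeta_sum ?balpha_sum.
Qed.

Lemma grid_bump_sum_le x : \sum_z grid_bump z x <= 1.
Proof.
rewrite (tens_sum (fun=> bbeta B)); apply: prodr_ile1 => i _.
by rewrite bbeta_sum_le sumr_ge0// => k _; exact: bbeta_ge0.
Qed.

Lemma grid_weight_sum_le j x : \sum_z grid_weight j z x <= 1.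
Proof.
rewrite (tens_sum (fun i => if i == j then balpha B else bbeta B)); apply: prodr_ile1 => i _.
case: ifP => _; first by rewrite balpha_sum_le sumr_ge0// => k _; exact: balpha_ge0.
by rewrite bbeta_sum_le sumr_ge0// => k _; exact: bbeta_ge0.
Qed.

(** The sum is a convex combination of values of phi at points within 2 delta of x. Dropping the
grid points outside P is harmless if phi is small near them. *)
Lemma grid_bump_approx (phi : 'rV[R]_3 -> R) (P : pred gidx) (eta : R) x :
  0 <= eta -> `|x| <= (n%:R - 1) * delta \/ phi x = 0 ->
  (forall z, `|x - grid_pt z| <= 2 * delta -> `|(if P z then phi (grid_pt z) else 0) - phi x| <= eta) ->
  `|\sum_(z | P z) phi (grid_pt z) * grid_bump z x - phi x| <= eta.
Proof.
move=> eta0 xn H.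
have -> : \sum_(z | P z) phi (grid_pt z) * grid_bump z x =
    \sum_z grid_bump z x * (if P z then phi (grid_pt z) else 0).
  rewrite big_mkcond; apply: eq_bigr => z _; case: ifP => _; first by rewrite mulrC.
  by rewrite mulr0.
apply: convex_combination_near => //; [by move=> z; exact: grid_bump_ge0|exact: grid_bump_sum_le| |].
  by case: xn => ?; [left; exact: grid_bump_sum|right].
by move=> z /grid_bump_supp/H.
Qed.

Definition grid_interp (v : 'rV[R]_3 -> R) x := \sum_z v (grid_pt z) * grid_bump z x.

Lemma grid_interp_class v : tens_class (grid_interp v).
Proof. exact: (grid_bump_comb (index_enum _) (fun z => v (grid_pt z))). Qed.

(** The shift is cyclic so as to permute the grid; it wraps only where [v] vanishes. *)
Let gnext j z : gidx := [ffun i => if i == j then ordS (z i) else z i].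

Let gnext_inj j : injective (gnext j).
Proof.
move=> z z' /ffunP E; apply/ffunP => i; have := E i; rewrite !ffunE.
by case: ifP => // _; exact: ordS_inj.
Qed.

(** Summation by parts in direction [j]: the relation between the two bumps moves the difference
from the bump to the coefficients. *)
Lemma grid_interp_derive (v : 'rV[R]_3 -> R) j x :
  (forall y : 'rV[R]_3, n%:R * delta <= `|y 0 j| -> v y = 0) ->
  partial j (grid_interp v) x =
  \sum_z grid_weight j z x * (delta^-1 * (v (grid_pt z + delta *: unitv j) - v (grid_pt z))).
Proof.
move=> v0.
pose rest z := \prod_(i | i != j) bbeta B (gshift (z i) (x 0 i)).
have wE z : grid_weight j z x = balpha B (gshift (z j) (x 0 j)) * rest z.
  rewrite /grid_weight /tens (bigD1 j)//= eqxx; congr (_ * _).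
  by apply: eq_bigr => i /negbTE ->.
have dg z : is_derive x (unitv j) (grid_bump z)
    (delta^-1 * (balpha B (gshift (z j) (x 0 j) + 1) - balpha B (gshift (z j) (x 0 j))) * rest z).
  have H := @is_derive_affine R delta^-1 (n%:R - (z j)%:R) (x 0 j) _ _
    (bbeta_derive B (gshift (z j) (x 0 j))).
  have := @tens_derive R (fun i t => bbeta B (gshift (z i) t)) j
    (fun=> delta^-1 * (balpha B (gshift (z j) (x 0 j) + 1) - balpha B (gshift (z j) (x 0 j)))) x H.
  rewrite {2}/tens (bigD1 j)//= /upd eqxx.
  suff -> : \prod_(i < 3 | i != j) (if i == j then
      fun=> delta^-1 * (balpha B (gshift (z j) (x 0 j) + 1) - balpha B (gshift (z j) (x 0 j)))
      else fun t : R => bbeta B (gshift (z i) t)) (x 0 i) = rest z by [].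
  by apply: eq_bigr => i /negbTE ->.
have -> : partial j (grid_interp v) x = \sum_z v (grid_pt z) *
    (delta^-1 * (balpha B (gshift (z j) (x 0 j) + 1) - balpha B (gshift (z j) (x 0 j))) * rest z).
  have H : is_derive x (unitv j) (grid_interp v) (\sum_z v (grid_pt z) *
    (delta^-1 * (balpha B (gshift (z j) (x 0 j) + 1) - balpha B (gshift (z j) (x 0 j))) * rest z)).
    by apply: is_derive_bigsum => z; exact: (is_deriveZ (v (grid_pt z)) (dg z)).
  by rewrite /partial; case: H => _ ->.
have restE z : rest (gnext j z) = rest z.
  by apply: eq_bigr => i /negbTE ij; rewrite ffunE ij.
transitivity (\sum_z v (grid_pt z) * delta^-1 * balpha B (gshift (z j) (x 0 j) + 1) * rest z
   - \sum_z v (grid_pt z) * delta^-1 * grid_weight j z x).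
  by rewrite -sumrB; apply: eq_bigr => z _; rewrite wE; ring.
rewrite (reindex_inj (@gnext_inj j)) -sumrB; apply: eq_bigr => z _.
rewrite restE wE ffunE eqxx.
have [zj|zj] := ltnP (z j).+1 m.
  have ez : (ordS (z j) : nat) = (z j).+1 by rewrite /= modn_small.
  have -> : grid_pt (gnext j z) = grid_pt z + delta *: unitv j.
    apply/rowP => i; rewrite !mxE ffunE; case: eqVneq => [->|_].
      by rewrite ez -natr1 eqxx /=; ring.
    by rewrite mulr0 addr0.
  have -> : gshift (ordS (z j)) (x 0 j) + 1 = gshift (z j) (x 0 j).
    by rewrite /gshift ez -natr1; ring.
  ring.
have {}zj : (z j : nat) = (2 * n)%N.
  by apply/eqP; rewrite eqn_leq -ltnS ltn_ord /= -ltnS.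
have -> : v (grid_pt (gnext j z)) = 0.
  apply: v0; rewrite !mxE ffunE eqxx /= zj modnn sub0r normrM normrN normr_nat.
  by rewrite gtr0_norm// mulrC.
have -> : v (grid_pt z + delta *: unitv j) = 0.
  apply: v0; rewrite !mxE !eqxx /= zj natrM.
  rewrite (_ : _ + _ = (n%:R + 1) * delta); last by ring.
  by rewrite normrM (gtr0_norm delta_gt0) ler_pM2r// ger0_norm ?lerDl// addr_ge0.
ring.
Qed.

(** The partial derivative is an average of difference quotients of [v] near x, so that a bound on
those is inherited by it; [v] itself may be merely continuous. *)
Lemma grid_interp_grad (v : 'rV[R]_3 -> R) j phi (eta : R) x :
  (forall y : 'rV[R]_3, n%:R * delta <= `|y 0 j| -> v y = 0) ->
  0 <= eta -> `|x| <= (n%:R - 1) * delta \/ phi = 0 ->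
  (forall y, `|x - y| <= 2 * delta ->
    `|v (y + delta *: unitv j) - v y + delta * phi| <= eta * delta) ->
  `|partial j (grid_interp v) x + phi| <= eta.
Proof.
move=> v0 eta0 xn H; rewrite grid_interp_derive// -[phi]opprK.
apply: convex_combination_near => //; [by move=> z; exact: grid_weight_ge0|exact: grid_weight_sum_le| |].
  by case: xn => [|->]; [left; exact: grid_weight_sum|right; rewrite oppr0].
move=> z /grid_weight_supp/H h.
rewrite opprK -(ler_pM2r delta_gt0) -[X in _ * X <= _](gtr0_norm delta_gt0) -normrM.
by rewrite mulrDl mulrAC mulVf ?gt_eqF// mul1r (mulrC phi).
Qed.

End grid.

(** * Uniform continuity; integration against charges *)

Section uniform_continuity.
Context {R : realType}.
Implicit Types (f : 'rV[R]_3 -> R) (K : set 'rV[R]_3).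

(** Lebesgue number of the cover of K by the balls on which Q holds. *)
Lemma uniform_radius K (Q : 'rV[R]_3 -> 'rV[R]_3 -> Prop) : compact K ->
  (forall x, K x -> exists2 e : R, 0 < e &
     forall x' y, `|x - x'| < e -> `|x' - y| < e -> Q x' y) ->
  exists2 r : R, 0 < r & forall x y, K x -> `|x - y| < r -> Q x y.
Proof.
move=> /compact_near_coveringP cK H.
have {}H : \forall r \near (0 : R)^'+, K `<=` [set x | forall y, `|x - y| < r -> Q x y].
  apply: (cK R _ (fun r x => forall y, `|x - y| < r -> Q x y)) => x /H[e e0 He].
  exists (ball x e, [set r | r < e]) => /=.
    by split; [exact: nbhsx_ballx|exact: nbhs_right_lt].
  move=> [x' r] /= [xx' re] y x'y; apply: He; last exact: lt_trans re.
  by move: xx'; rewrite -ball_normE.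
near (0 : R)^'+ => r; exists r => // x y Kx.
by have : K `<=` [set x | forall y, `|x - y| < r -> Q x y]; [near: r|exact].
Unshelve. all: by end_near.
Qed.

Lemma compact_margin K (O : set 'rV[R]_3) : compact K -> open O -> K `<=` O ->
  exists2 r : R, 0 < r & forall x y, K x -> `|x - y| < r -> O y.
Proof.
move=> cK oO KO; apply: (@uniform_radius K (fun _ => O)) => // x Kx.
have /nbhs_ballP[e /= e0 He] := open_nbhs_nbhs (conj oO (KO _ Kx)).
exists (e / 2) => [|x' y h1 h2]; first by rewrite divr_gt0.
apply: He; rewrite -ball_normE /= [e]splitr -(subrK x' x) -addrA.
by apply: le_lt_trans (ler_normD _ _) _; exact: ltrD.
Qed.

(** Near the compact set where |f| >= e / 2 this is uniform continuity; if both points are off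
that set, the two values are too small to differ by more than e. *)
Lemma vanishing_unif f : continuous f -> (forall e, 0 < e -> compact [set x | e <= `|f x|]) ->
  forall e, 0 < e -> exists2 r : R, 0 < r & forall x y, `|x - y| < r -> `|f x - f y| <= e.
Proof.
move=> cf fc e e0.
have e20 : 0 < e / 2 by rewrite divr_gt0.
pose K := [set x | e / 2 <= `|f x|].
have [r r0 Kr] : exists2 r : R, 0 < r & forall x y, K x -> `|x - y| < r -> `|f x - f y| <= e.
  apply: (@uniform_radius K (fun x y => `|f x - f y| <= e)) => [|x Kx]; first exact: fc.
  have /cvgrPdist_le/(_ _ e20)/nbhs_ballP[d /= d0 Hd] := cf x.
  exists (d / 2) => [|x' y h1 h2]; first by rewrite divr_gt0.
  have {}Hd z : `|x - z| < d -> `|f x - f z| <= e / 2.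
    by move=> xz; apply: Hd; rewrite -ball_normE.
  have -> : f x' - f y = (f x - f y) - (f x - f x') by ring.
  rewrite [leRHS]splitr (le_trans (ler_normB _ _))// lerD//; apply: Hd.
    rewrite [d]splitr -(subrK x' x) -addrA.
    by apply: le_lt_trans (ler_normD _ _) _; exact: ltrD.
  by apply: lt_trans h1 _; rewrite ltr_pdivrMr// ltr_pMr// ltr1n.
exists r => // x y xy.
have [Kx|] := boolP (e / 2 <= `|f x|); first exact: Kr.
rewrite -ltNge => fx.
have [Ky|] := boolP (e / 2 <= `|f y|); first by rewrite distrC; apply: Kr => //; rewrite distrC.
rewrite -ltNge => fy.
by rewrite [leRHS]splitr (le_trans (ler_normB _ _))// lerD// ltW.
Qed.

Lemma subset_fsupport f x : f x != 0 -> fsupport f x.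
Proof. by move=> fx; apply: subset_closure. Qed.

Lemma supp_in_compact K f : compact K -> continuous f ->
  (forall x, f x != 0 -> K x) -> forall e, 0 < e -> compact [set x | e <= `|f x|].
Proof.
move=> cK cf fK e e0; apply: (subclosed_compact _ cK).
  rewrite (_ : mkset _ = (fun x => `|f x|) @^-1` [set y | e <= y])//.
  apply: closed_comp; last exact: closed_ge.
  by move=> x _; apply: continuous_comp; [exact: cf|exact: norm_continuous].
by move=> x /= ex; apply: fK; rewrite -normr_gt0 (lt_le_trans e0).
Qed.

Lemma compact_support_vanishing f : continuous f -> compact (fsupport f) ->
  forall e, 0 < e -> compact [set x | e <= `|f x|].
Proof. by move=> cf cs; apply: supp_in_compact cs cf _; exact: subset_fsupport. Qed.

Lemma vanishing_bounded f : continuous f -> (forall e, 0 < e -> compact [set x | e <= `|f x|]) ->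
  exists2 C : R, 0 < C & forall x, `|f x| <= C.
Proof.
move=> cf fc.
have cK := fc _ (@ltr01 R).
have cfn : continuous (fun x => `|f x|) by move=> x; apply: continuous_comp; [exact: cf|exact: norm_continuous].
have [K0|/set0P K0] := eqVneq [set x | 1 <= `|f x|] set0.
  exists 1 => // x; rewrite leNgt; apply/negP => /ltW fx.
  by have : [set x | 1 <= `|f x|] x by []; rewrite K0.
have [c _ Hc] := compact_EVT_max K0 cK (continuous_subspaceT cfn).
exists (Num.max 1 `|f c|) => [|x]; first by rewrite lt_max ltr01.
have [fx|] := boolP (1 <= `|f x|); first by rewrite le_max Hc ?orbT// inE.
by rewrite -ltNge => /ltW fx; rewrite le_max fx.
Qed.

End uniform_continuity.

Section charge_integral.
Context {R : realType}.
Local Notation T := (borelR3 R).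
Implicit Types (f g : 'rV[R]_3 -> R) (nu : {charge set T -> \bar R}).

Definition bounded_borel f := measurable_fun [set: T] (f : T -> R) /\ exists C : R, forall x, `|f x| <= C.

Lemma continuous_borel f : continuous f -> measurable_fun [set: T] (f : T -> R).
Proof.
move=> cf; apply: (measurability _ (RGenOpens.measurableE R)).
move=> /= _ [_ [a [b ->]] <-]; rewrite setTI; apply: sub_sigma_algebra.
by move/continuousP : cf; apply; exact: interval_open.
Qed.

Lemma bounded_borel_integrable (m : {finite_measure set T -> \bar R}) f : bounded_borel f ->
  m.-integrable setT (EFin \o f).
Proof.
move=> [mf [C fC]]; apply: measurable_bounded_integrable => //.
  by rewrite -ge0_fin_numE// fin_num_measure.
exists C; split; first exact: num_real.
by move=> M CM x _; exact: le_trans (fC x) (ltW CM).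
Qed.

Lemma bounded_borel_vanishing f : continuous f -> (forall e, 0 < e -> compact [set x | e <= `|f x|]) -> bounded_borel f.
Proof.
move=> cf fc; split; first exact: continuous_borel.
by have [C _ fC] := vanishing_bounded cf fc; exists C.
Qed.

Lemma bounded_borelD f g : bounded_borel f -> bounded_borel g -> bounded_borel (fun x => f x + g x).
Proof.
move=> [mf [C fC]] [mg [D gD]]; split; first exact: measurable_funD.
by exists (C + D) => x; rewrite (le_trans (ler_normD _ _))// lerD.
Qed.

Lemma bounded_borelZ c f : bounded_borel f -> bounded_borel (fun x => c * f x).
Proof.
move=> [mf [C fC]]; split; first exact: measurable_funM.
by exists (`|c| * C) => x; rewrite normrM ler_wpM2l.
Qed.

Lemma fin_num_swap (a b c d : \bar R) : a \is a fin_num -> b \is a fin_num ->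
  c \is a fin_num -> d \is a fin_num -> (a - b = c - d -> a + d = c + b)%E.
Proof.
by case: a b c d => [a| |] [b| |] [c| |] [d| |] // _ _ _ _ [h]; congr (_%:E); lra.
Qed.

(** Every decomposition of the charge computes its integral: m1 - m2 = p - q is the equality of
measures p + m2 = m1 + q. *)
Lemma charge_integralE nu (m1 m2 : {finite_measure set T -> \bar R}) f :
  (forall A, measurable A -> nu A = m1 A - m2 A)%E -> bounded_borel f ->
  charge_integral nu f = \int[m1]_x f x - \int[m2]_x f x.
Proof.
move=> num bf; rewrite /charge_integral.
set P := cid _; set N := cid _.
set p := jordan_pos _; set q := jordan_neg _.
have E A : measurable A -> (measure_add p m2 A = measure_add m1 q A)%E.
  move=> mA; rewrite !measure_addE.
  have pq : (nu A = p A - q A)%E.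
    by rewrite (jordan_decomp (projT2 N) mA) /cadd /= cscaleN1.
  have := num _ mA; rewrite pq.
  by apply: fin_num_swap; exact: fin_num_measure.
have ifp := bounded_borel_integrable p bf.
have ifq := bounded_borel_integrable q bf.
have if1 := bounded_borel_integrable m1 bf.
have if2 := bounded_borel_integrable m2 bf.
have : (\int[measure_add p m2]_x (f x)%:E = \int[measure_add m1 q]_x (f x)%:E)%E.
  by apply: eq_measure_integral => A mA _; exact: E.
rewrite !integral_measure_add// /Rintegral.
have := integrable_fin_num measurableT ifp.
have := integrable_fin_num measurableT ifq.
have := integrable_fin_num measurableT if1.
have := integrable_fin_num measurableT if2.
rewrite /comp.
case: (\int[p]_x _)%E => // a; case: (\int[q]_x _)%E => // b.
case: (\int[m1]_x _)%E => // c; case: (\int[m2]_x _)%E => // d _ _ _ _ /= -[h].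
lra.
Qed.

Lemma jordan_exists nu : exists m1 m2 : {finite_measure set T -> \bar R},
  forall A, measurable A -> (nu A = m1 A - m2 A)%E.
Proof.
have [P [N PN]] := Hahn_decomposition nu.
exists (jordan_pos PN), (jordan_neg PN) => A mA.
by rewrite (jordan_decomp PN mA) /cadd /= cscaleN1.
Qed.

Lemma charge_integralD nu f g : bounded_borel f -> bounded_borel g ->
  charge_integral nu (fun x => f x + g x) = charge_integral nu f + charge_integral nu g.
Proof.
move=> bf bg; have [m1 [m2 num]] := jordan_exists nu.
rewrite !(charge_integralE num)//; last exact: bounded_borelD.
by rewrite !RintegralD//; try exact: bounded_borel_integrable; ring.
Qed.

Lemma charge_integralZ nu c f : bounded_borel f ->
  charge_integral nu (fun x => c * f x) = c * charge_integral nu f.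
Proof.
move=> bf; have [m1 [m2 num]] := jordan_exists nu.
rewrite !(charge_integralE num)//; last exact: bounded_borelZ.
by rewrite !RintegralZl//; try exact: bounded_borel_integrable; ring.
Qed.

Lemma bounded_borel_sum (I : Type) (s : seq I) (f : I -> 'rV[R]_3 -> R) :
  (forall i, bounded_borel (f i)) -> bounded_borel (fun x => \sum_(i <- s) f i x).
Proof.
move=> bf; elim: s => [|i s IH].
  under eq_fun do rewrite big_nil.
  by split=> //; exists 0 => _; rewrite normr0.
under eq_fun do rewrite big_cons.
exact: bounded_borelD.
Qed.

Lemma charge_integral_sum nu (I : Type) (s : seq I) (f : I -> 'rV[R]_3 -> R) :
  (forall i, bounded_borel (f i)) ->
  charge_integral nu (fun x => \sum_(i <- s) f i x) = \sum_(i <- s) charge_integral nu (f i).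
Proof.
move=> bf; elim: s => [|i s IH].
  under eq_fun do rewrite big_nil.
  rewrite big_nil; have [m1 [m2 num]] := jordan_exists nu.
  rewrite (charge_integralE num).
    by rewrite /Rintegral !integral0_eq// subrr.
  by split=> //; exists 0 => _; rewrite normr0.
under eq_fun do rewrite big_cons.
by rewrite big_cons charge_integralD ?IH//; exact: bounded_borel_sum.
Qed.

(** M is the total mass of a Jordan decomposition. *)
Lemma charge_mass nu : exists2 M : R, 0 <= M & forall f C, bounded_borel f ->
  (forall x, `|f x| <= C) -> `|charge_integral nu f| <= C * M.
Proof.
have [m1 [m2 num]] := jordan_exists nu.
exists (fine (m1 setT) + fine (m2 setT)); first by rewrite addr_ge0 ?fine_ge0.
move=> f C bf fC; rewrite (charge_integralE num)//.
have H (m : {finite_measure set T -> \bar R}) : `|\int[m]_x f x| <= C * fine (m setT).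
  apply: (le_trans (le_normr_Rintegral measurableT (bounded_borel_integrable m bf))).
  rewrite -Rintegral_cst//; apply: le_Rintegral => //.
    by apply: integrable_norm; exact: bounded_borel_integrable.
  apply: (@bounded_borel_integrable m (cst C)); split => //.
  by exists `|C|.
by rewrite mulrDr (le_trans (ler_normB _ _))// lerD.
Qed.

End charge_integral.

(** * Shortest path potentials *)

Section potential.
Context {R : realType} {T : Type} (c : T -> T -> R) (ext : set T).

Fixpoint walk_cost (p : T) (s : seq T) : R :=
  if s is q :: s' then c p q + walk_cost q s' else 0.

Lemma walk_cost_rcons p s q : walk_cost p (rcons s q) = walk_cost p s + c (last p s) q.
Proof.
by elim: s p => [|x s IH] p /=; rewrite ?addr0 ?add0r// IH addrA.
Qed.

(** u x is the infimum of the costs of walks from ext to x. They are bounded below because a walk can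
be closed by a last step into ext, and walks between points of ext do not gain. *)
Lemma potential : ext !=set0 ->
  (forall p s, ext p -> ext (last p s) -> 0 <= walk_cost p s) ->
  exists2 u : T -> R, (forall x y, u y <= u x + c x y) & (forall x, ext x -> u x = 0).
Proof.
move=> [z ez] H.
pose A x := [set w | exists p s, [/\ ext p, last p s = x & w = walk_cost p s]].
have A0 x : A x !=set0 by exists (walk_cost z [:: x]); exists z, [:: x].
have Alb x : has_lbound (A x).
  exists (- c x z) => _ [p [s [ep <- ->]]].
  by rewrite lerNl -subr_ge0 opprK addrC -walk_cost_rcons H ?last_rcons.
exists (fun x => inf (A x)) => [x y|x ex].
  rewrite -lerBlDr; apply: lb_le_inf => // _ [p [s [ep <- ->]]].
  rewrite lerBlDr -walk_cost_rcons; apply: ge_inf => //.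
  by exists p, (rcons s y); rewrite last_rcons.
apply/eqP; rewrite eq_le; apply/andP; split.
  by apply: ge_inf => //; exists x, [::].
by apply: lb_le_inf => // _ [p [s [ep ls ->]]]; apply: H => //; rewrite ls.
Qed.

End potential.

(** * Separation of a point from a convex set *)

Section separation.
Context {R : realType} (m : nat).
Implicit Types (x y p : 'I_m -> R) (C : set ('I_m -> R)).

(** If p is at positive distance from the bounded convex set C, the vector from a point x of C to
p separates them as soon as x is close enough to being a nearest point; the nearest point
itself need not exist, as C need not be closed. *)
Lemma separation C p (B : R) : C !=set0 ->
  (forall x y t, C x -> C y -> 0 <= t <= 1 -> C (fun n => x n + t * (y n - x n))) ->
  (forall x n, C x -> `|x n| <= B) ->
  (forall eta, 0 < eta -> exists2 x, C x & forall n, `|x n - p n| <= eta) \/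
  exists a s, (forall x, C x -> \sum_n a n * x n <= s) /\ s < \sum_n a n * p n.
Proof.
move=> C0 Cconv CB.
pose D x := \sum_n (x n - p n) ^+ 2.
have D0 x : 0 <= D x by apply: sumr_ge0 => n _; exact: sqr_ge0.
pose A := [set D x | x in C].
have A0 : A !=set0 by case: C0 => x Cx; exists (D x); exists x.
have Alb : has_lbound A by exists 0 => _ [x _ <-].
have Dinf x : C x -> inf A <= D x by move=> Cx; apply: ge_inf => //; exists x.
have d0 : 0 <= inf A by apply: lb_le_inf => // _ [x _ <-].
have near_inf e : 0 < e -> exists2 x, C x & D x < inf A + e.
  by move=> e0; have [_ [x Cx <-] h] := inf_adherent e0 (conj A0 Alb); exists x.
have [dE|dn0] := eqVneq (inf A) 0.
  left=> eta eta0; have [|x Cx] := near_inf (eta ^+ 2); first by rewrite exprn_gt0.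
  rewrite dE add0r => h; exists x => // n.
  rewrite -(ler_pXn2r (_ : 0 < 2)%N)// ?nnegrE ?(ltW eta0)// real_normK ?num_real//.
  apply: le_trans (ltW h); rewrite /D (bigD1 n)//= lerDl.
  by apply: sumr_ge0 => k _; exact: sqr_ge0.
right; set d := inf A in d0 dn0 Dinf near_inf.
have {dn0}d_gt0 : 0 < d by rewrite lt_neqAle eq_sym dn0.
pose K := \sum_(n < m) (2 * `|B|) ^+ 2 + 1.
have K0 : 0 < K by rewrite ltr_wpDl// sumr_ge0// => n _; exact: sqr_ge0.
(* The first order condition at x is tested on a step of length t towards y. Its quadratic
   term is at most t d / 2, and x is chosen to be minimal up to t d / 2. *)
pose t := Num.min 1 (d / 2 / K).
have t0 : 0 < t by rewrite lt_min ltr01 !divr_gt0.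
have t1 : t <= 1 by rewrite ge_min lexx.
have tK : t * K <= d / 2 by rewrite -ler_pdivlMr// ge_min lexx orbT.
have [|x Cx Dx] := near_inf (t * (d / 2)); first by rewrite mulr_gt0// divr_gt0.
exists (fun n => p n - x n), (\sum_n (p n - x n) * x n + d / 2); split; last first.
  have -> : \sum_n (p n - x n) * p n = \sum_n (p n - x n) * x n + D x.
    by rewrite /D -big_split; apply: eq_bigr => n _ /=; ring.
  by rewrite ltrD2l (lt_le_trans _ (Dinf _ Cx))// ltr_pdivrMr// ltr_pMr// ltr1n.
move=> y Cy.
pose g := \sum_n (p n - x n) * (y n - x n).
have -> : \sum_n (p n - x n) * y n = \sum_n (p n - x n) * x n + g.
  by rewrite /g -big_split; apply: eq_bigr => n _ /=; ring.
rewrite lerD2l.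
pose q := \sum_n (y n - x n) ^+ 2.
have qK : q <= K.
  rewrite /q /K ler_wpDr//; apply: ler_sum => n _.
  rewrite -real_normK ?num_real// lerXn2r ?nnegrE ?mulr_ge0//.
  by rewrite (le_trans (ler_normB _ _))// mulr_natl mulr2n lerD// (le_trans (CB _ _ _))// ler_norm.
have Dt : D (fun n => x n + t * (y n - x n)) = D x - 2 * t * g + t ^+ 2 * q.
  rewrite /D /g /q !mulr_sumr -sumrB -big_split; apply: eq_bigr => n _ /=; ring.
have : d <= D (fun n => x n + t * (y n - x n)).
  by apply: Dinf; apply: Cconv => //; rewrite ltW.
rewrite Dt => h.
have h2 : t ^+ 2 * q <= t * (d / 2).
  rewrite expr2 -mulrA ler_wpM2l ?(ltW t0)//; apply: le_trans tK.
  by rewrite ler_wpM2l// ltW.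
have h3 : 2 * t * g <= 2 * t * (d / 2).
  have : 2 * t * g <= D x - d + t ^+ 2 * q by lra.
  move/le_trans; apply.
  have : 2 * t * (d / 2) = t * (d / 2) + t * (d / 2) by ring.
  lra.
by rewrite -(ler_pM2l (_ : 0 < 2 * t))// mulr_gt0.
Qed.

End separation.

(** * Weighted polygonal chains *)

Section chains.
Context {R : realType}.
Local Notation V := 'rV[R]_3.
Implicit Types (F : V -> V -> R) (ch : seq (V * R)) (ext : set V).

(** A chain is a list of vertices, each with the weight of the edge that leaves it. *)
Fixpoint chain_sum F ch : R :=
  if ch is e :: ch' then
    (if ch' is e' :: _ then e.2 * F e.1 e'.1 else 0) + chain_sum F ch' else 0.

Definition abs_chain ch : seq (V * R) := [seq (e.1, `|e.2|) | e <- ch].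
Definition scale_chain (r : R) ch : seq (V * R) := [seq (e.1, r * e.2) | e <- ch].
Definition chain_len ch := chain_sum (fun p q => `|q - p|) (abs_chain ch).

(** The discrete form of being divergence free in the complement of ext: the weight w that enters
a vertex is the one that leaves it, unless the vertex is in ext. *)
Fixpoint balanced ext (w : R) ch : Prop :=
  if ch is e :: ch' then (ext e.1 \/ w = e.2) /\ balanced ext e.2 ch' else w = 0.

(** A balanced chain ends with weight 0, so the edge that joins the two chains carries nothing. *)
Lemma chain_sum_cat F ext w ch1 ch2 : balanced ext w ch1 ->
  chain_sum F (ch1 ++ ch2) = chain_sum F ch1 + chain_sum F ch2.
Proof.
elim: ch1 w => [|e [|e' ch1] IH] w /=; rewrite ?add0r//.
  by clear IH => -[_ ->]; case: ch2 => [|e' ch2]; rewrite ?mul0r ?add0r.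
by move=> [_ /IH] /= ->; rewrite addrA.
Qed.

Lemma balanced_cat ext w ch1 ch2 : balanced ext w ch1 -> balanced ext 0 ch2 -> balanced ext w (ch1 ++ ch2).
Proof. by elim: ch1 w => [|e ch1 IH] w /= => [->//|[h /IH{}IH] /IH]. Qed.

Lemma chain_sum_scale F r ch : chain_sum F (scale_chain r ch) = r * chain_sum F ch.
Proof.
elim: ch => [|e [|e' ch] IH] /=; first by rewrite mulr0.
  by rewrite addr0 mulr0.
by rewrite /= in IH; rewrite IH; ring.
Qed.

Lemma balanced_scale ext w r ch : balanced ext w ch -> balanced ext (r * w) (scale_chain r ch).
Proof.
elim: ch w => [|e ch IH] w /= => [->|[h /IH{}IH]]; first by rewrite mulr0.
by split => //; case: h => [|->]; [left|right].
Qed.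

Lemma chain_len_scale r ch : chain_len (scale_chain r ch) = `|r| * chain_len ch.
Proof.
rewrite /chain_len -chain_sum_scale; congr chain_sum; rewrite /abs_chain /scale_chain -!map_comp.
by apply: eq_map => e /=; rewrite normrM.
Qed.

Lemma balanced_abs_chain ext w ch : balanced ext w ch -> balanced ext `|w| (abs_chain ch).
Proof.
elim: ch w => [|e ch IH] w /= => [->|[h /IH{}IH]]; first by rewrite normr0.
by split => //; case: h => [|->]; [left|right].
Qed.

Lemma chain_len_cat ext w ch1 ch2 : balanced ext w ch1 ->
  chain_len (ch1 ++ ch2) = chain_len ch1 + chain_len ch2.
Proof. by move=> /balanced_abs_chain h; rewrite /chain_len /abs_chain map_cat (chain_sum_cat _ _ h). Qed.

Lemma le_chain_sum F G ch : (forall p q, `|F p q| <= G p q) ->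
  `|chain_sum F ch| <= chain_sum G (abs_chain ch).
Proof.
move=> FG; elim: ch => [|e [|e' ch] IH] /=; first by rewrite normr0.
  by rewrite addr0 normr0.
by rewrite (le_trans (ler_normD _ _))// lerD// normrM ler_wpM2l.
Qed.

Lemma chain_sum_lin (I : finType) (F : I -> V -> V -> R) (a : I -> R) ch :
  \sum_i a i * chain_sum (F i) ch = chain_sum (fun p q => \sum_i a i * F i p q) ch.
Proof.
elim: ch => [|e [|e' ch] IH] /=.
- by rewrite big1// => i _; rewrite mulr0.
- by rewrite addr0 big1// => i _; rewrite ?addr0 mulr0.
rewrite /= in IH; rewrite -IH mulr_sumr -big_split; apply: eq_bigr => i _ /=; ring.
Qed.

(** Turns walks into chains, so that a bound on all chains bounds the costs of walks. *)
Fixpoint unit_chain (p : V) (s : seq V) : seq (V * R) :=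
  if s is q :: s' then (p, 1) :: unit_chain q s' else [:: (p, 0)].

Lemma unit_chain_ok ext p s w : (ext p \/ w = (s != [::])%:R) -> ext (last p s) -> balanced ext w (unit_chain p s).
Proof.
elim: s p w => [|q s IH] p w /= [h|->] l.
- by split => //; left.
- by split=> //; left.
- by split; [left|apply: IH => //; case: s l => [|q' s] l; [left|right]].
- by split; [right|apply: IH => //; case: s l => [|q' s] l; [left|right]].
Qed.

Lemma unit_chain_hd p s : exists w l, unit_chain p s = (p, w) :: l.
Proof. by case: s => [|q s] /=; eexists; eexists. Qed.

Lemma unit_chain_sum F p s : chain_sum F (unit_chain p s) = walk_cost F p s.
Proof.
elim: s p => [|q s IH] p /=; first by rewrite addr0.
have [w [l E]] := unit_chain_hd q s.
by rewrite -IH E /= mul1r.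
Qed.

Lemma unit_chain_len p s : chain_len (unit_chain p s) = walk_cost (fun p q => `|q - p|) p s.
Proof.
rewrite -unit_chain_sum /chain_len; congr chain_sum.
elim: s p => [|q s IH] p /=; first by rewrite normr0.
by rewrite /abs_chain /= normr1; congr cons; exact: IH.
Qed.

End chains.

(** * Integration along segments *)

Section path_integral.
Context {R : realType}.
Local Notation V := 'rV[R]_3.
Implicit Types (f g : V -> R) (a b : V).

Definition seg a b (t : R) : V := a + t *: (b - a).

Definition seg_mean f a b : R := \int[lebesgue_measure]_(t in `[0, 1]) f (seg a b t).

Lemma seg_continuous a b : continuous (seg a b).
Proof.
move=> t; apply: cvgD; first exact: cvg_cst.
by apply: cvgZr_tmp; exact: cvg_id.
Qed.

Lemma seg_integrable f a b : continuous f ->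
  lebesgue_measure.-integrable `[0, 1] (EFin \o (f \o seg a b)).
Proof.
move=> cf; apply: continuous_compact_integrable; first exact: segment_compact.
apply: continuous_subspaceT => t; apply: continuous_comp; first exact: seg_continuous.
exact: cf.
Qed.

Lemma seg_mean_dist f g a b a' b' (eta : R) : continuous f -> continuous g ->
  (forall t, 0 <= t <= 1 -> `|f (seg a b t) - g (seg a' b' t)| <= eta) ->
  `|seg_mean f a b - seg_mean g a' b'| <= eta.
Proof.
move=> cf cg H.
have i1 := seg_integrable a b cf; have i2 := seg_integrable a' b' cg.
rewrite /seg_mean -RintegralB//.
have i3 : lebesgue_measure.-integrable `[0, 1]
    (EFin \o (fun t => f (seg a b t) - g (seg a' b' t))) by apply: (integrableB _ i1 i2).
apply: (le_trans (le_normr_Rintegral _ i3)) => //.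
have -> : eta = \int[lebesgue_measure]_(t in `[0%R, 1%R]) (cst eta t).
  by rewrite Rintegral_cst//= lebesgue_measure_itv/= lte01 oppr0 adde0 mulr1.
apply: le_Rintegral => //.
- exact: integrable_norm.
- by apply: continuous_compact_integrable; [exact: segment_compact|apply: continuous_subspaceT; exact: cst_continuous].
Qed.

Lemma seg_mean_cst c a b : seg_mean (cst c) a b = c.
Proof.
by rewrite /seg_mean Rintegral_cst//= lebesgue_measure_itv/= lte01 oppr0 adde0 mulr1.
Qed.

Lemma seg_mean_near f a b c (eta : R) : continuous f ->
  (forall t, 0 <= t <= 1 -> `|f (seg a b t) - c| <= eta) -> `|seg_mean f a b - c| <= eta.
Proof.
move=> cf H; rewrite -{1}(seg_mean_cst c a b); apply: seg_mean_dist => //.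
exact: cst_continuous.
Qed.

Lemma seg_mean_le f a b (C : R) : continuous f -> (forall x, `|f x| <= C) -> `|seg_mean f a b| <= C.
Proof. by move=> cf fC; rewrite -[seg_mean _ _ _]subr0; apply: seg_mean_near => // t _; rewrite subr0. Qed.

Lemma seg_mean_sum (I : Type) (s : seq I) (c : I -> R) (f : I -> V -> R) a b :
  (forall i, continuous (f i)) ->
  seg_mean (fun x => \sum_(i <- s) c i * f i x) a b = \sum_(i <- s) c i * seg_mean (f i) a b.
Proof.
move=> cf; elim: s => [|i s IH].
  by under eq_fun do rewrite big_nil; rewrite big_nil seg_mean_cst.
under eq_fun do rewrite big_cons; rewrite big_cons -IH /seg_mean -RintegralZl//; last first.
  exact: (seg_integrable a b (cf i)).
have cs := @sum_continuous R I s c f cf.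
rewrite -RintegralD//; last exact: (seg_integrable a b cs).
apply: (@seg_integrable (fun x => c i * f i x)) => x.
exact: (cvgM (cvg_cst (c i)) (cf i x)).
Qed.

Lemma seg_dist a b t : 0 <= t <= 1 -> `|seg a b t - a| <= `|b - a|.
Proof.
by move=> /andP[t0 t1]; rewrite /seg addrC addKr normrZ ger0_norm// ler_piMl.
Qed.

End path_integral.

Section dist.
Context {R : realType} (K : set 'rV[R]_3) (K0 : K !=set0).
Local Notation V := 'rV[R]_3.

Definition dist (x : V) : R := inf [set `|x - y| | y in K].

Lemma dist_has_inf x : has_inf [set `|x - y| | y in K].
Proof.
split; first by case: K0 => y Ky; exists `|x - y|; exists y.
by exists 0 => _ [y _ <-].
Qed.

Lemma dist_lip x y : dist x <= dist y + `|x - y|.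
Proof.
rewrite -lerBlDr; apply: lb_le_inf; first by case: (dist_has_inf y).
move=> _ [z Kz <-]; rewrite lerBlDr; apply: (@le_trans _ _ `|x - z|).
  by apply: ge_inf; [case: (dist_has_inf x)|exists z].
have -> : x - z = (y - z) + (x - y) by rewrite [RHS]addrC addrA subrK.
exact: ler_normD.
Qed.

Lemma dist_lip_abs x y : `|dist x - dist y| <= `|x - y|.
Proof.
have := dist_lip x y; have := dist_lip y x; rewrite (distrC y x) ler_norml => h1 h2.
apply/andP; split; lra.
Qed.

Lemma dist_le x : K x -> dist x <= 0.
Proof.
by move=> Kx; apply: ge_inf; [case: (dist_has_inf x)|exists x => //; rewrite subrr normr0].
Qed.

Lemma dist_ge x r : (forall y, K y -> r <= `|x - y|) -> r <= dist x.
Proof.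
by move=> H; apply: lb_le_inf; [case: (dist_has_inf x)|move=> _ [y Ky <-]; exact: H].
Qed.

End dist.

Section soft.
Context {R : realType}.
Implicit Types u h : R.

(** Soft thresholding of u at height h: 0 for |u| <= h, and u moved towards 0 by h otherwise.
Unlike a cut-off by multiplication it is 1-Lipschitz in each argument, whatever the size
of u. *)
Definition soft u h := Num.max (u - h) (Num.min (u + h) 0).

Lemma soft0 u : soft u 0 = u.
Proof. by rewrite /soft subr0 addr0 max_l// ge_min lexx. Qed.

Lemma soft_neq0 u h : 0 <= h -> soft u h != 0 -> h < `|u|.
Proof.
move=> h0; rewrite /soft ltNge ler_norml; apply: contra => /andP[a b].
by rewrite min_r ?max_r//; lra.
Qed.

Lemma soft_lip u h u' h' a b : `|u - u'| <= a -> `|h - h'| <= b ->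
  `|soft u h - soft u' h'| <= a + b.
Proof.
rewrite !ler_norml => /andP[a1 a2] /andP[b1 b2]; rewrite /soft.
case: (lerP (u + h) 0) => c1; case: (lerP (u' + h') 0) => c2;
  rewrite ?(min_l c1) ?(min_r c1) ?(min_l c2) ?(min_r c2).
all: repeat (match goal with |- context [Num.max ?x ?y] => case: (lerP x y) => ? end).
all: apply/andP; split; lra.
Qed.

End soft.

(** * Smoothing a potential *)

Lemma fin_pos_min (R : realType) (I : finType) (P : I -> R -> Prop) :
  (forall i r r', r' <= r -> P i r -> P i r') ->
  (forall i, exists2 r : R, 0 < r & P i r) -> exists2 r : R, 0 < r & forall i, P i r.
Proof.
move=> mono H.
have /choice[r Hr] : forall i, exists r, 0 < r /\ P i r.
  by move=> i; have [r r0 Pr] := H i; exists r.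
exists (\big[Num.min/1]_i r i); first by apply: lt_bigmin => // i _; have [] := Hr i.
move=> i; have [_] := Hr i; apply: mono.
exact: bigmin_le_cond.
Qed.

Lemma lip_continuous (R : realType) (f : 'rV[R]_3 -> R) (L : R) : 0 < L ->
  (forall x y, `|f x - f y| <= L * `|x - y|) -> continuous f.
Proof.
move=> L0 fL x.
apply/(@cvgrPdist_le _ R^o _ (nbhs x) (nbhs_filter x) f (f x)) => e e0; apply/nbhs_ballP.
exists (e / L) => [|y]; first by rewrite /= divr_gt0.
rewrite -ball_normE /= => xy; apply: (le_trans (fL x y)).
by rewrite mulrC -ler_pdivlMr// ltW.
Qed.

Section smoothing.
Context {R : realType}.
Local Notation V := 'rV[R]_3.
Context (Omega : set V) (Omega_open : open Omega) (Omega_bounded : bounded_set Omega).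
Hypothesis ext_dense : forall x, ~ Omega x -> forall e : R, 0 < e ->
  exists2 y, ~ closure Omega y & `|x - y| < e.

Lemma bounded_setP : exists2 rho : R, 0 < rho & forall x, Omega x -> `|x| <= rho.
Proof.
have [M [_ H]] := Omega_bounded.
exists (`|M| + 1) => [|x Ox]; first by rewrite ltr_wpDl.
by apply: H Ox; rewrite ltr_pwDr// ler_norm.
Qed.

Context (Phi : 'I_3 -> V -> R) (cPhi : forall j, continuous (Phi j)).
Context (K : set V) (cK : compact K) (KO : K `<=` Omega) (PhiK : forall j x, Phi j x != 0 -> K x).

(** The line integral of the field Phi along the segment from a to b. *)
Definition field_int (a b : V) : R := \sum_j (b - a) 0 j * seg_mean (Phi j) a b.

Let Phi_vanish j := supp_in_compact cK (@cPhi j) (@PhiK j).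

Lemma field_int_le : exists2 C, 0 <= C & forall a b, `|field_int a b| <= C * `|b - a|.
Proof.
have /choice[C HC] : forall j, exists C, 0 <= C /\ forall x, `|Phi j x| <= C.
  by move=> j; have [C /ltW C0 H] := vanishing_bounded (@cPhi j) (@Phi_vanish j); exists C.
exists (\sum_j C j) => [|a b]; first by apply: sumr_ge0 => j _; have [] := HC j.
rewrite /field_int (le_trans (ler_norm_sum _ _ _))// mulr_suml ler_sum// => j _.
rewrite normrM mulrC ler_pM//; first by apply: seg_mean_le => //; have [] := HC j.
exact: coord_le_norm.
Qed.

Lemma field_int_axis a j (d : R) : field_int a (a + d *: unitv j) = d * seg_mean (Phi j) a (a + d *: unitv j).
Proof.
rewrite /field_int (bigD1 j)//= big1 ?addr0 => [|i /negbTE ij].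
  by rewrite addrC addKr !mxE !eqxx mulr1.
by rewrite addrC addKr !mxE ij andbF mulr0 mul0r.
Qed.

Lemma field_int_axisN a j (d : R) : field_int (a + d *: unitv j) a = - d * seg_mean (Phi j) (a + d *: unitv j) a.
Proof.
rewrite /field_int (bigD1 j)//= big1 ?addr0 => [|i /negbTE ij].
  by rewrite opprD addNKr !mxE !eqxx mulr1.
by rewrite opprD addNKr !mxE ij andbF mulr0 oppr0 mul0r.
Qed.

Context (eps : R) (eps_ge0 : 0 <= eps) (u : V -> R).
Hypothesis u_le : forall x y, u y <= u x + (eps * `|y - x| - field_int x y).
Hypothesis u_ext : forall x, ~ closure Omega x -> u x = 0.

Let u_lip : exists2 L, 0 < L & forall x y, `|u x - u y| <= L * `|x - y|.
Proof.
have [C C0 HC] := field_int_le.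
exists (eps + C + 1) => [|x y]; first by rewrite ltr_wpDl// addr_ge0.
have h1 := u_le x y; have h2 := u_le y x.
have /andP[a1 a2] : - (C * `|x - y|) <= field_int x y <= C * `|x - y|.
  by rewrite -ler_norml (distrC x y) HC.
have /andP[b1 b2] : - (C * `|x - y|) <= field_int y x <= C * `|x - y|.
  by rewrite -ler_norml HC.
rewrite (distrC y x) in h1; have n0 := normr_ge0 (x - y).
rewrite ler_norml 2!mulrDl mul1r.
set n := `|x - y| in h1 h2 a1 a2 b1 b2 n0 *.
set e' := eps * n in h1 h2 *; set c' := C * n in a1 a2 b1 b2 *.
clearbody n e' c'.
by apply/andP; split; lra.
Qed.

Let u_out x : ~ Omega x -> u x = 0.
Proof.
have [L L0 uL] := u_lip.
move=> Ox; apply/eqP; rewrite -normr_le0; apply/ler_addgt0Pr => e e0; rewrite add0r.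
have [y ey xy] := ext_dense Ox (divr_gt0 e0 L0).
have := uL x y; rewrite (u_ext ey) subr0 => /le_trans; apply.
by rewrite mulrC -ler_pdivlMr// ltW.
Qed.

(** The hypothesis on u says |grad u + Phi| <= eps in a weak sense, and u vanishes outside Omega
because the exterior points are dense there. It remains to make u compactly supported and
smooth. The threshold h vanishes near K and is positive outside Omega, which confines the
support of v = soft u h to a compact subset of Omega; where v differs from u the field
vanishes, and thresholding costs only the Lipschitz constant kappa of h. The grid
interpolation of v is smooth, and its gradient is controlled through difference quotients of
v along the axes; the second kappa bounds the oscillation of Phi at the scale of the grid. *)
Lemma potential_smoothing kappa : 0 < kappa -> K !=set0 ->
  exists2 phi, test_function Omega phi &
    forall x j, `|partial j phi x + Phi j x| <= eps + kappa + kappa.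
Proof.
move=> k0 K0.
have [rho rho0 Orho] := bounded_setP.
have [L L0 uL] := u_lip.
have [r r0 Kr] := compact_margin cK Omega_open KO.
pose s := r / 2.
have s0 : 0 < s by rewrite divr_gt0.
pose h x := kappa * Num.max 0 (dist K x - s).
have h0 x : 0 <= h x by apply: mulr_ge0; [exact: ltW|rewrite le_max lexx].
have hlip x y : `|h x - h y| <= kappa * `|x - y|.
  rewrite /h -mulrBr normrM gtr0_norm// ler_wpM2l ?(ltW k0)//.
  have := dist_lip_abs K0 x y; rewrite !ler_norml => /andP[? ?].
  by case: (lerP 0 (dist K x - s)) => ?; case: (lerP 0 (dist K y - s)) => ?; apply/andP; split; lra.
have h_out x : ~ Omega x -> 0 < h x.
  move=> Ox; rewrite /h mulr_gt0// lt_max ltxx /= subr_gt0.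
  apply: (@lt_le_trans _ _ r); first by rewrite /s ltr_pdivrMr// ltr_pMr// ltr1n.
  apply: dist_ge => // y Ky; rewrite leNgt distrC; apply/negP => xy.
  by apply: Ox; exact: Kr xy.
pose v x := soft (u x) (h x).
pose Z := [set x | h x <= `|u x|].
have vZ x : v x != 0 -> Z x by move=> /(soft_neq0 (h0 x))/ltW.
have ZO : Z `<=` Omega.
  move=> x Zx; apply: contrapT => Ox; have := h_out _ Ox.
  by move: Zx; rewrite /Z /= (u_out Ox) normr0 ltNge => ->.
have cu : continuous u := lip_continuous L0 uL.
have ch : continuous h := lip_continuous k0 hlip.
have cZ : compact Z.
  apply: bounded_closed_compact.
    exists rho; split; first exact: num_real.
    by move=> M rM x /ZO/Orho xr; exact: le_trans xr (ltW rM).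
  rewrite (_ : Z = (fun x => `|u x| - h x) @^-1` [set y | 0 <= y]); last first.
    by apply/seteqP; split => x /=; rewrite subr_ge0.
  apply: closed_comp; last exact: closed_ge.
  move=> x _; exact: (cvgB (cvg_norm (cu x)) (ch x)).
have [r2 r20 Zr2] := compact_margin cZ Omega_open ZO.
have [w w0 Pw] : exists2 w : R, 0 < w & forall j x y, `|x - y| < w -> `|Phi j x - Phi j y| <= kappa.
  apply: (@fin_pos_min R _ (fun j w => forall x y, `|x - y| < w -> `|Phi j x - Phi j y| <= kappa)).
    by move=> j a b ba H x y xy; apply: H; exact: lt_le_trans ba.
  by move=> j; exact: (vanishing_unif (@cPhi j) (@Phi_vanish j)).
(* All the points compared below are within 4 d of each other. *)
pose d := Num.min s (Num.min r2 w) / 8.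
have d0 : 0 < d by rewrite divr_gt0// !lt_min s0 r20 w0.
have [ds dr2 dw] : [/\ 8 * d <= s, 8 * d <= r2 & 8 * d <= w].
  by rewrite /d mulrC divfK ?pnatr_eq0// !ge_min !lexx ?orbT.
have [n nrho] : exists n : nat, rho < (n%:R - 1) * d.
  exists (Num.bound (rho / d)).+1.
  by rewrite -natr1 addrK -ltr_pdivrMr// archi_boundP// divr_ge0// ltW.
have [B] := @bumps R.
pose phi := grid_interp B d n v.
have phi_supp y : fsupport phi y -> Omega y.
  move=> /(_ (ball y d) (nbhsx_ballx _ _ d0)) [x [/= px yx]].
  have [z /andP[vz gz]] : exists z : {ffun 'I_3 -> 'I_(2 * n).+1}, (v (grid_pt d z) != 0) && (grid_bump B d z x != 0).
    apply/existsP; apply: contraR px => /existsPn H.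
    rewrite /phi /grid_interp big1// => z _; move: (H z); rewrite negb_and !negbK.
    by case/orP => /eqP ->; rewrite ?mul0r ?mulr0.
  have := grid_bump_supp d0 gz => xz.
  apply: (Zr2 (grid_pt d z)); first exact: vZ.
  apply: (@lt_le_trans _ _ (8 * d)) => //.
  have -> : grid_pt d z - y = (x - y) - (x - grid_pt d z) by rewrite opprB [RHS]addrC subrKA.
  apply: (le_lt_trans (ler_normB _ _)).
  move: yx; rewrite -ball_normE /= distrC => yx.
  lra.
exists phi.
  split => //; first exact: tens_class_smooth (grid_interp_class _ _ _ _).
  apply: bounded_closed_compact; last exact: closed_closure.
  exists rho; split; first exact: num_real.
  by move=> M rM x /phi_supp/Orho xr; exact: le_trans xr (ltW rM).
move=> x j; refine (@grid_interp_grad R B d d0 n v j (Phi j x) (eps + kappa + kappa) x _ _ _ _).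
- move=> y yj; apply/eqP; apply: contraTT yj => /vZ/ZO/Orho yr.
  rewrite -ltNge; apply: (le_lt_trans (coord_le_norm _ _)); apply: (le_lt_trans yr).
  apply: (lt_trans nrho); rewrite ltr_pM2r// gtrBl//.
- by rewrite !addr_ge0// ltW.
- have [->|/PhiK/KO/Orho xr] := eqVneq (Phi j x) 0; [by right|left].
  by rewrite (le_trans xr)// ltW.
move=> y xy.
set y' := y + d *: unitv j.
have yy' : `|y' - y| = d.
  rewrite /y' addrC addKr normrZ gtr0_norm//.
  suff -> : `|unitv j : V| = 1 by rewrite mulr1.
  apply/eqP; rewrite eq_le; apply/andP; split.
    apply: norm_le_coord => // i; rewrite unitvE; case: eqP => _; rewrite ?normr1 ?normr0//.
  by apply: le_trans (coord_le_norm (unitv j) j); rewrite unitvE eqxx normr1.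
have pseg t : 0 <= t <= 1 -> `|seg y y' t - y| <= d /\ `|seg y' y t - y| <= d + d.
  move=> t01; split; first by rewrite -yy' seg_dist.
  rewrite (_ : _ - y = (seg y' y t - y') + (y' - y)); last by rewrite subrKA.
  apply: (le_trans (ler_normD _ _)); rewrite yy' lerD2r -yy' (distrC y' y).
  exact: seg_dist.
have near3 t : 0 <= t <= 1 -> `|seg y y' t - x| <= 4 * d /\ `|seg y' y t - x| <= 4 * d.
  move=> /pseg[h1 h2]; split.
    rewrite (_ : _ - x = (seg y y' t - y) - (x - y)); last by rewrite opprB subrKA.
    by apply: (le_trans (ler_normB _ _)); lra.
  rewrite (_ : _ - x = (seg y' y t - y) - (x - y)); last by rewrite opprB subrKA.
  by apply: (le_trans (ler_normB _ _)); lra.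
(* Either v = u at both ends, and the difference quotient of u is compared with the mean of Phi
   over the segment, or the segment is away from K and Phi vanishes on it. *)
have [/andP[/eqP hy /eqP hy']|hne] := boolP ((h y == 0) && (h y' == 0)).
  rewrite /v hy hy' !soft0.
  have p1 : `|seg_mean (Phi j) y y' - Phi j x| <= kappa.
    by apply: seg_mean_near => // t /near3[h1 _]; apply: Pw; lra.
  have p2 : `|seg_mean (Phi j) y' y - Phi j x| <= kappa.
    by apply: seg_mean_near => // t /near3[_ h1]; apply: Pw; lra.
  have u1 := u_le y y'; have u2 := u_le y' y.
  rewrite distrC yy' in u2; rewrite yy' in u1.
  rewrite /y' field_int_axisN -/y' in u2; rewrite /y' field_int_axis -/y' in u1.
  set P1 := seg_mean _ _ _ in p1 u1; set P2 := seg_mean _ _ _ in p2 u2.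
  have q1 : `|d * (P1 - Phi j x)| <= kappa * d by rewrite normrM gtr0_norm// mulrC ler_wpM2r// ltW.
  have q2 : `|d * (P2 - Phi j x)| <= kappa * d by rewrite normrM gtr0_norm// mulrC ler_wpM2r// ltW.
  have kd : 0 < kappa * d by rewrite mulr_gt0.
  move: q1 q2; rewrite !ler_norml !mulrBr => /andP[? ?] /andP[? ?].
  by apply/andP; split; lra.
have far q : `|q - y| <= 2 * d -> Phi j q = 0.
  move=> qy; apply/eqP; apply: contraNT hne => /PhiK Kq.
  have dq := dist_le K0 Kq.
  have dy := dist_lip K0 y q.
  have dy' := dist_lip K0 y' y.
  rewrite (distrC y q) in dy; rewrite yy' in dy'.
  rewrite /h !max_l ?mulr0 ?eqxx//; lra.
have -> : Phi j x = 0 by apply: far.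
have p1 : seg_mean (Phi j) y y' = 0.
  apply/eqP; rewrite -normr_le0; rewrite -[seg_mean _ _ _]subr0; apply: seg_mean_near => // t /pseg[h1 _].
  by rewrite far ?subrr ?normr0//; lra.
have p2 : seg_mean (Phi j) y' y = 0.
  apply/eqP; rewrite -normr_le0; rewrite -[seg_mean _ _ _]subr0; apply: seg_mean_near => // t /pseg[_ h1].
  by rewrite far ?subrr ?normr0//; lra.
have u1 := u_le y y'; have u2 := u_le y' y.
rewrite distrC yy' in u2; rewrite yy' in u1.
rewrite /y' field_int_axisN -/y' p2 in u2; rewrite /y' field_int_axis -/y' p1 in u1.
rewrite mulr0 addr0.
have kd : 0 < kappa * d by rewrite mulr_gt0.
apply: (@le_trans _ _ (eps * d + kappa * d)); last by lra.
apply: soft_lip; last by rewrite -yy' hlip.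
by rewrite ler_norml; apply/andP; split; lra.
Qed.

End smoothing.

(** * Approximating finitely many integrals by chains *)

Section duality.
Context {R : realType}.
Local Notation V := 'rV[R]_3.
Context (Omega : set V) (Omega_open : open Omega) (Omega_bounded : bounded_set Omega).
Hypothesis ext_dense : forall x, ~ Omega x -> forall e : R, 0 < e ->
  exists2 y, ~ closure Omega y & `|x - y| < e.
Context (nu : 'I_3 -> {charge set (borelR3 R) -> \bar R}).
Hypothesis nu_df : forall phi, test_function Omega phi ->
  \sum_(j < 3) charge_integral (nu j) (partial j phi) = 0.

(** A smoothed potential phi is a test function, so Phi may be replaced by Phi + grad phi in the
integral; this field is bounded by eps up to an arbitrarily small error. *)
Lemma flux_bound (Phi : 'I_3 -> V -> R) (K : set V) (eps : R) (u : V -> R) (M : 'I_3 -> R) :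
  (forall j, continuous (Phi j)) -> compact K -> K `<=` Omega ->
  (forall j x, Phi j x != 0 -> K x) -> 0 <= eps ->
  (forall x y, u y <= u x + (eps * `|y - x| - field_int Phi x y)) ->
  (forall x, ~ closure Omega x -> u x = 0) ->
  (forall j, 0 <= M j) ->
  (forall j f C, bounded_borel f -> (forall x, `|f x| <= C) -> `|charge_integral (nu j) f| <= C * M j) ->
  `|\sum_j charge_integral (nu j) (Phi j)| <= eps * \sum_j M j.
Proof.
move=> cPhi cK KO PhiK eps0 u_le u_ext M0 HM.
have bPhi j : bounded_borel (Phi j).
  by apply: bounded_borel_vanishing (@cPhi j) _; exact: supp_in_compact cK (@cPhi j) (PhiK j).
have [KE|/set0P Kn0] := eqVneq K set0.
  have Phi0 j x : `|Phi j x| <= 0.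
    by rewrite normr_le0; apply: contraT => /PhiK; rewrite KE.
  rewrite big1; first by rewrite normr0 mulr_ge0// sumr_ge0.
  move=> j _; apply/eqP; rewrite -normr_le0.
  by have := HM j _ _ (bPhi j) (Phi0 j); rewrite mul0r.
apply/ler_addgt0Pr => e e0.
pose S := \sum_j M j.
have S0 : 0 <= S by apply: sumr_ge0.
pose kappa := e / (2 * (S + 1)).
have S1 : 0 < S + 1 by rewrite ltr_wpDl.
have k0 : 0 < kappa by rewrite divr_gt0// mulr_gt0.
have [phi tphi Hphi] := potential_smoothing Omega_open Omega_bounded ext_dense cPhi cK KO PhiK
  eps0 u_le u_ext k0 Kn0.
have bphi j : bounded_borel (partial j phi).
  split.
    by apply: continuous_borel; have [sphi _ _] := tphi; have [] := sphi [:: j].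
  have [_ [C PC]] := bPhi j.
  exists (eps + kappa + kappa + C) => x.
  have -> : partial j phi x = (partial j phi x + Phi j x) - Phi j x by rewrite addrK.
  by rewrite (le_trans (ler_normB _ _))// lerD.
have -> : \sum_j charge_integral (nu j) (Phi j) =
    \sum_j charge_integral (nu j) (fun x => partial j phi x + Phi j x).
  by rewrite -[LHS]add0r -[X in X + _](nu_df tphi) -big_split; apply: eq_bigr => j _ /=; rewrite charge_integralD.
apply: (le_trans (ler_norm_sum _ _ _)).
apply: (@le_trans _ _ (\sum_j (eps + kappa + kappa) * M j)).
  by apply: ler_sum => j _; apply: HM => //; exact: bounded_borelD.
rewrite -mulr_sumr -/S.
have -> : (eps + kappa + kappa) * S = eps * S + 2 * kappa * S by ring.
rewrite lerD2l.
have -> : e = 2 * kappa * (S + 1) by rewrite /kappa; field; rewrite gt_eqF.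
apply: ler_wpM2l; last by rewrite lerDl.
by rewrite mulr_ge0// ltW.
Qed.

Lemma chain_sumZ F (c : R) (ch : seq (V * R)) :
  chain_sum (fun p q => c * F p q) ch = c * chain_sum F ch.
Proof.
elim: ch => [|e [|e' ch] IH] /=; rewrite ?addr0 ?mulr0//.
by rewrite /= in IH; rewrite IH; ring.
Qed.

Definition edge_int (f : V -> R) (j : 'I_3) (p q : V) : R := (q - p) 0 j * seg_mean f p q.

Lemma edge_int_le f j C p q : continuous f -> (forall x, `|f x| <= C) ->
  `|edge_int f j p q| <= C * `|q - p|.
Proof.
move=> cf fC; rewrite /edge_int normrM mulrC ler_pM//; first exact: seg_mean_le.
exact: coord_le_norm.
Qed.

Lemma chain_sum_edge_int_le f j C ch : continuous f -> (forall x, `|f x| <= C) ->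
  `|chain_sum (edge_int f j) ch| <= C * chain_len ch.
Proof.
move=> cf fC; rewrite /chain_len -chain_sumZ; apply: le_chain_sum => p q; exact: edge_int_le.
Qed.

Lemma chain_len_ge0 (ch : seq (V * R)) : 0 <= chain_len ch.
Proof.
by rewrite /chain_len; elim: ch => [|e [|e' ch] IH]//=; rewrite ?addr0// addr_ge0// mulr_ge0.
Qed.

(** The vectors of integrals along balanced chains of length at most M form a bounded convex set C.
Were the vector of integrals against nu at positive distance from C, a separating functional
would be a field Phi, a combination of the f n, whose integral along every balanced chain of
length at most M is at most s, while its integral against nu exceeds s. Walks between exterior
points then cost at least 0 for the cost eps |y - x| - field_int Phi x y with eps = s / M. This gives
a potential, and [flux_bound] bounds the integral against nu by s times the mass over M. *)
Lemma scalar_approx : exists2 M, 0 <= M &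
  forall m (f : 'I_m -> V -> R) (jn : 'I_m -> 'I_3),
    (forall n, continuous (f n)) -> (forall n, compact (fsupport (f n))) ->
    (forall n, fsupport (f n) `<=` Omega) ->
  forall eta, 0 < eta -> exists ch, [/\ balanced [set x | ~ closure Omega x] 0 ch, chain_len ch <= M &
    forall n, `|chain_sum (edge_int (f n) (jn n)) ch - charge_integral (nu (jn n)) (f n)| <= eta].
Proof.
have /choice[Mj HMj] : forall j, exists M, 0 <= M /\
    forall f C, bounded_borel f -> (forall x, `|f x| <= C) -> `|charge_integral (nu j) f| <= C * M.
  by move=> j; have [M M0 H] := charge_mass (nu j); exists M.
have Mj0 j : 0 <= Mj j by have [] := HMj j.
(* The 1 keeps M positive when nu is zero. *)
pose M := \sum_j Mj j + 1.
have M_gt0 : 0 < M by rewrite ltr_wpDl// sumr_ge0.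
exists M; first exact: ltW.
move=> m f jn cf fc fO.
pose ext := [set x | ~ closure Omega x].
have bf n : bounded_borel (f n).
  by apply: bounded_borel_vanishing => //; exact: compact_support_vanishing.
have /choice[Cf HCf] : forall n, exists C, 0 <= C /\ forall x, `|f n x| <= C.
  move=> n; have [C C0 fC] := vanishing_bounded (@cf n) (compact_support_vanishing (@cf n) (@fc n)).
  by exists C; rewrite (ltW C0).
pose F n := edge_int (f n) (jn n).
pose C := [set y : 'I_m -> R | exists ch, [/\ balanced ext 0 ch, chain_len ch <= M & y = fun n => chain_sum (F n) ch]].
have C0 : C !=set0 by exists (fun n => 0), [::]; split => //; rewrite /chain_len /= ltW.
pose p n := charge_integral (nu (jn n)) (f n).
have Cconv x y t : C x -> C y -> 0 <= t <= 1 -> C (fun n => x n + t * (y n - x n)).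
  move=> [c1 [ k1 l1 ->]] [c2 [ k2 l2 ->]] /andP[t0 t1].
  have o1' := balanced_scale (1 - t) k1; rewrite mulr0 in o1'.
  have o2' := balanced_scale t k2; rewrite mulr0 in o2'.
  exists (scale_chain (1 - t) c1 ++ scale_chain t c2); split.
  - exact: balanced_cat.
  - rewrite (chain_len_cat _ o1') !chain_len_scale !ger0_norm ?subr_ge0//.
    have -> : M = (1 - t) * M + t * M by ring.
    by rewrite lerD// ler_wpM2l ?subr_ge0.
  - apply/funext => n; rewrite (chain_sum_cat _ _ o1') !chain_sum_scale; ring.
have CB x n : C x -> `|x n| <= \sum_n Cf n * M.
  move=> [ch [_ lch ->]]; have [Cn0 fC] := HCf n.
  apply: (le_trans (chain_sum_edge_int_le _ _ (@cf n) fC)).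
  apply: (@le_trans _ _ (Cf n * M)); first by rewrite ler_wpM2l.
  rewrite (bigD1 n)//= lerDl; apply: sumr_ge0 => i _.
  by rewrite mulr_ge0 ?(ltW M_gt0)//; have [] := HCf i.
have [H|[a [s [Ha sp]]]] := separation p C0 Cconv CB; first move=> eta eta0.
  have [y [ch [ ? ? ->]] Hy] := H _ eta0.
  by exists ch.
exfalso.
pose c j n := if jn n == j then a n else 0.
pose Phi j x := \sum_n c j n * f n x.
pose K := \big[setU/set0]_(n < m) fsupport (f n).
have cK : compact K by apply: bigsetU_compact.
have KO : K `<=` Omega by move=> x; rewrite /K -bigcup_seq => -[n _]; exact: fO.
have PhiK j x : Phi j x != 0 -> K x.
  move=> Px; rewrite /K -bigcup_seq; apply: contrapT => H.
  move/eqP: Px; apply; rewrite /Phi big1// => n _.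
  have [->|fn] := eqVneq (f n x) 0; first by rewrite mulr0.
  by exfalso; apply: H; exists n; [rewrite /= mem_index_enum|exact: subset_fsupport].
have cPhi j : continuous (Phi j).
  exact: sum_continuous.
have field_intE q r : field_int Phi q r = \sum_n a n * F n q r.
  rewrite /field_int /Phi.
  transitivity (\sum_j \sum_n (r - q) 0 j * (c j n * seg_mean (f n) q r)).
    by apply: eq_bigr => j _; rewrite seg_mean_sum// mulr_sumr.
  rewrite exchange_big; apply: eq_bigr => n _ /=.
  rewrite (bigD1 (jn n))//= big1 ?addr0 => [|j jnj].
    by rewrite /c eqxx /F /edge_int; ring.
  by rewrite /c eq_sym (negbTE jnj) mul0r mulr0.
have s0 : 0 <= s.
  have := Ha (fun=> 0); rewrite big1 => [|n _]; last by rewrite mulr0.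
  by apply; exists [::]; split => //; rewrite /chain_len /= ltW.
pose eps := s / M.
have eps0 : 0 <= eps by rewrite divr_ge0// ltW.
have walk x0 l : ext x0 -> ext (last x0 l) ->
    0 <= walk_cost (fun q r => eps * `|r - q| - field_int Phi q r) x0 l.
  move=> e0 e1.
  have -> : walk_cost (fun q r => eps * `|r - q| - field_int Phi q r) x0 l =
     eps * walk_cost (fun q r => `|r - q|) x0 l - walk_cost (field_int Phi) x0 l.
    by elim: l x0 {e0 e1} => [|y l IH] x0 /=; rewrite ?mulr0 ?subr0// IH; ring.
  rewrite -unit_chain_len -!unit_chain_sum subr_ge0.
  set ch := unit_chain x0 l; set w := chain_sum _ ch.
  have och : balanced ext 0 ch by apply: unit_chain_ok => //; left.
  have H t : 0 <= t -> t * chain_len ch <= M -> t * w <= s.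
    move=> t0 tl; have o' := balanced_scale t och; rewrite mulr0 in o'.
    have /Ha : C (fun n => chain_sum (F n) (scale_chain t ch)).
      by exists (scale_chain t ch); split => //; rewrite chain_len_scale ger0_norm.
    rewrite (chain_sum_lin F a) chain_sum_scale.
    by under [X in chain_sum X]eq_fun2 do rewrite -field_intE.
  (* The chain is rescaled to length M; its own length may be 0, hence the extra term in the
     denominator below. *)
  apply/ler_addgt0Pr => e e00.
  have L0 := chain_len_ge0 ch.
  have e1' : 0 < e / (eps + 1) by rewrite divr_gt0// ltr_wpDl.
  set L := chain_len ch in L0 H *.
  have L1 : 0 < L + e / (eps + 1) by rewrite ltr_wpDl.
  have := H (M / (L + e / (eps + 1))).
  rewrite divr_ge0 ?(ltW M_gt0) ?(ltW L1)// => /(_ isT).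
  rewrite mulrAC ler_pdivrMr// ler_wpM2l ?(ltW M_gt0) ?lerDl ?(ltW e1')// => /(_ isT).
  rewrite mulrAC ler_pdivrMr// mulrC -ler_pdivlMr// => h; apply: (le_trans h).
  have -> : s * (L + e / (eps + 1)) / M = eps * L + eps * (e / (eps + 1)) by rewrite /eps; ring.
  rewrite lerD2l mulrCA ler_piMr ?(ltW e00)//.
  by rewrite ler_pdivrMr ?ltr_wpDl// mul1r lerDl.
have [z ez] : ext !=set0.
  have [rho rho0 Orho] := bounded_setP Omega_bounded.
  pose x0 : V := const_mx (rho + 1).
  have : ~ Omega x0.
    move=> /Orho; apply/negP; rewrite -ltNge; apply: (@lt_le_trans _ _ `|x0 0 0|).
      by rewrite mxE ger0_norm ?addr_ge0 ?ltrDl// ltW.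
    exact: coord_le_norm.
  by move=> /ext_dense/(_ _ ltr01)[y ey _]; exists y.
have [u u_le u_ext] := potential (ex_intro _ z ez) walk.
have := flux_bound cPhi cK KO PhiK eps0 u_le u_ext Mj0 (fun j => (HMj j).2).
apply/negP; rewrite -ltNge.
have -> : \sum_j charge_integral (nu j) (Phi j) = \sum_n a n * p n.
  transitivity (\sum_j \sum_n c j n * charge_integral (nu j) (f n)).
    apply: eq_bigr => j _; rewrite /Phi charge_integral_sum.
      by apply: eq_bigr => n _; rewrite charge_integralZ.
    by move=> n; exact: bounded_borelZ.
  rewrite exchange_big; apply: eq_bigr => n _ /=.
  rewrite (bigD1 (jn n))//= big1 ?addr0 => [|j jnj]; first by rewrite /c eqxx.
  by rewrite /c eq_sym (negbTE jnj) mul0r.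
apply: (@le_lt_trans _ _ s); last by rewrite (lt_le_trans sp)// ler_norm.
rewrite /eps -mulrA ler_piMr// ler_pdivrMl// mulr1 /M lerDl//.
Qed.

End duality.

(** * Exterior points of Lipschitz domains *)

Section lipschitz_exterior.
Context {R : realType}.
Local Notation V := 'rV[R]_3.

(** In the coordinates of the graph, a boundary point x lies on or above it. A point y at height t
above x is at distance comparable to t from the graph, so a small ball around y misses
Omega. *)
Lemma lipschitz_ext_dense (Omega : set V) : open Omega -> lipschitz_boundary Omega ->
  forall x, ~ Omega x -> forall e : R, 0 < e -> exists2 y, ~ closure Omega y & `|x - y| < e.
Proof.
move=> oO lO x Ox e e0.
have [cx|] := pselect (closure Omega x); last by exists x => //; rewrite subrr normr0.
have [|U [g [UU lg]]] := lO x.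
  by split=> //; move: Ox; rewrite {1}(interior_id _).1.
have [k k0 gk] : exists2 k : R, 0 < k & forall a b, `|g a - g b| <= k * `|a - b|.
  move: lg => /pinfty_ex_gt0[k k0 H]; exists k => // a b.
  by have /= := H (a, b); apply.
move=> /nbhs_ballP[r /= r0 Hr].
pose z (y : V) : 'rV[R]_(2 + 1) := y *m U.
(* A crude Lipschitz constant of the rotation for the sup norm. *)
pose c := \sum_i \sum_j `|U i j| + 1.
have c0 : 0 < c by rewrite ltr_wpDl// sumr_ge0// => i _; exact: sumr_ge0.
have zlip (a b : V) j : `|z a 0 j - z b 0 j| <= c * `|a - b|.
  have -> : z a 0 j - z b 0 j = \sum_i (a - b) 0 i * U i j.
    rewrite !mxE -sumrB; apply: eq_bigr => i _; by rewrite !mxE mulrBl.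
  apply: (le_trans (ler_norm_sum _ _ _)).
  apply: (@le_trans _ _ (\sum_i `|a - b| * `|U i j|)).
    by apply: ler_sum => i _; rewrite normrM ler_wpM2r// coord_le_norm.
  rewrite -mulr_sumr mulrC ler_wpM2r// /c ler_wpDr//; apply: ler_sum => i _.
  by rewrite (bigD1 j)//= lerDl sumr_ge0.
pose w : V := (delta_mx 0 ord_max : 'rV[R]_3) *m U^T.
have wU : w *m U = delta_mx 0 ord_max.
  by rewrite /w -mulmxA (mulmx1C UU) mulmx1.
have w1 : 0 < `|w| + 1 by rewrite ltr_wpDl.
pose t := Num.min e r / 2 / (`|w| + 1).
have t0 : 0 < t by rewrite !divr_gt0// lt_min e0 r0.
have tw : t * `|w| < Num.min e r / 2.
  rewrite /t -mulrA gtr_pMr ?divr_gt0 ?lt_min ?e0 ?r0//.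
  by rewrite mulrC ltr_pdivrMr// mul1r ltrDl.
have mn : Num.min e r / 2 < Num.min e r by rewrite ltr_pdivrMr// ltr_pMr ?ltr1n// lt_min e0 r0.
pose y := x + t *: w.
have xy : `|x - y| < Num.min e r / 2.
  by rewrite /y opprD addNKr normrN normrZ gtr0_norm.
exists y; last first.
  by apply: (lt_trans xy); apply: (lt_le_trans mn); rewrite ge_min lexx.
have zy j : z y 0 j = z x 0 j + t * (j == ord_max)%:R.
  by rewrite /z /y mulmxDl -scalemxAl wU !mxE eqxx.
have gx : g (lsubmx (z x)) <= z x 0 ord_max.
  by rewrite leNgt; apply/negP => /(Hr x (ballxx _ r0)).
have gy : g (lsubmx (z y)) + t <= z y 0 ord_max.
  rewrite zy eqxx mulr1 lerD2r; suff -> : lsubmx (z y) = lsubmx (z x) by [].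
  apply/rowP => i; rewrite mxE [RHS]mxE zy; case: eqP => [E|_]; last by rewrite mulr0 addr0.
  by have := ltn_ord i; move/(congr1 val): E => /= ->.
pose rho := Num.min (r / 2) (t / (2 * (k * c + c))).
have kc0 : 0 < k * c + c by rewrite addr_gt0// mulr_gt0.
have rho0 : 0 < rho by rewrite lt_min; apply/andP; split; apply: divr_gt0 => //; rewrite mulr_gt0.
move=> /(_ (ball y rho) (nbhsx_ballx _ _ rho0)) [q [Oq]]; rewrite -ball_normE /= => yq.
have xq : ball x r q.
  rewrite -ball_normE /= [r]splitr.
  have -> : x - q = (x - y) + (y - q) by rewrite addrA subrK.
  apply: (le_lt_trans (ler_normD _ _)); apply: ltrD.
    by apply: (lt_le_trans xy); rewrite ler_pM2r ?invr_gt0// ge_min lexx orbT.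
  by apply: (lt_le_trans yq); rewrite ge_min lexx.
have /= := (Hr q xq).1 Oq.
apply/negP; rewrite -leNgt -/(z q).
have h1 := zlip q y ord_max.
have h2 : `|g (lsubmx (z q)) - g (lsubmx (z y))| <= k * (c * `|q - y|).
  apply: (le_trans (gk _ _)); rewrite ler_wpM2l ?(ltW k0)//.
  apply: norm_le_coord; first by rewrite mulr_ge0 ?(ltW c0).
  by move=> i; have := zlip q y (lshift 1 i); rewrite !mxE.
have h3 : (k * c + c) * `|q - y| <= t / 2.
  rewrite mulrC -ler_pdivlMr// distrC (le_trans (ltW yq))//.
  by rewrite /rho ge_min -mulrA -invfM lexx orbT.
rewrite mulrDl -mulrA in h3.
set A := k * (c * _) in h2 h3; set B := c * _ in h1 h3.
move: h1 h2; rewrite !ler_norml => /andP[h1 _] /andP[_ h2].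
clearbody A B; lra.
Qed.

End lipschitz_exterior.

(** * General position *)

Section general_position.
Context {R : realType}.
Local Notation V := 'rV[R]_3.
Implicit Types (a b c : V).

(** Twice the signed area of the triangle projected to the first two coordinates. That it is not
zero is a polynomial condition that excludes three points on a line. *)
Definition det2 a b c : R :=
  (b - a) 0 0 * (c - a) 0 1 - (c - a) 0 0 * (b - a) 0 1.

Lemma poly_nonroot (p : {poly R}) (r : R) : p != 0 -> 0 < r -> exists2 s, 0 < s < r & p.[s] != 0.
Proof.
move=> p0 r0.
pose rs := [seq r / k.+2%:R | k <- iota 0 (size p)].
have urs : uniq rs.
  rewrite map_inj_uniq ?iota_uniq// => i j /(mulfI (lt0r_neq0 r0)) /invr_inj /eqP.
  by rewrite eqr_nat => /eqP[].
have /allPn[s] : ~~ all (root p) rs.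
  apply/negP => h; have := max_poly_roots p0 h urs.
  by rewrite size_map size_iota ltnn.
move=> /mapP[k _ ->] ns; exists (r / k.+2%:R) => //.
rewrite divr_gt0//= ltr_pdivrMr// ltr_pMr// ltr1n//.
Qed.

(** Vertex k moves by s (k, k^2, 0). For three distinct indices the determinant is a polynomial in
s whose coefficient of degree 2 is a Vandermonde determinant, so only finitely many s
fail. *)
Lemma general_position (m : nat) (P : nat -> V) (r : R) : 0 < r ->
  exists2 Q : nat -> V, (forall k, (k < m)%N -> `|Q k - P k| < r) &
    forall i j k, (i < m)%N -> (j < m)%N -> (k < m)%N -> i != j -> i != k -> j != k ->
      det2 (Q i) (Q j) (Q k) != 0.
Proof.
move=> r0.
pose dir (k : nat) : V := \row_i (if i == 0 then k%:R else if i == 1 then k%:R ^+ 2 else 0).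
pose Q (s : R) k := P k + s *: dir k.
pose px k : {poly R} := (P k 0 0)%:P + (k%:R)%:P * 'X.
pose py k : {poly R} := (P k 0 1)%:P + (k%:R ^+ 2)%:P * 'X.
pose D i j k : {poly R} := (px j - px i) * (py k - py i) - (px k - px i) * (py j - py i).
have DE s i j k : (D i j k).[s] = det2 (Q s i) (Q s j) (Q s k).
  rewrite /D /det2 /Q /px /py !hornerE !mxE /=; ring.
have D0 i j k : i != j -> i != k -> j != k -> D i j k != 0.
  move=> ij ik jk.
  have -> : D i j k =
     ((P j 0 0 - P i 0 0) * (P k 0 1 - P i 0 1) - (P k 0 0 - P i 0 0) * (P j 0 1 - P i 0 1))%:P
     + ((P j 0 0 - P i 0 0) * (k%:R ^+ 2 - i%:R ^+ 2) + (j%:R - i%:R) * (P k 0 1 - P i 0 1)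
       - (P k 0 0 - P i 0 0) * (j%:R ^+ 2 - i%:R ^+ 2) - (k%:R - i%:R) * (P j 0 1 - P i 0 1))%:P * 'X
     + ((j%:R - i%:R) * (k%:R - i%:R) * (k%:R - j%:R))%:P * 'X^2.
    rewrite /D /px /py !(polyCB, polyCM, polyCD, rmorphXn) /=; ring.
  apply/eqP => /(congr1 (fun p : {poly R} => p`_2)); rewrite coef0 !coefD coefC coefCM coefX coefCM coefXn /=.
  rewrite mulr0 mulr1 !add0r => /eqP; apply/negP.
  by rewrite !mulf_neq0// subr_eq0 eqr_nat eq_sym.
pose p := \prod_(i < m) \prod_(j < m | i != j :> nat) \prod_(k < m | (i != k :> nat) && (j != k :> nat)) D i j k.
have p0 : p != 0.
  apply/prodf_neq0 => i _; apply/prodf_neq0 => j ij; apply/prodf_neq0 => k /andP[ik jk].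
  exact: D0.
have mm0 : 0 < m%:R + m%:R ^+ 2 + 1 :> R by rewrite ltr_wpDl// addr_ge0// sqr_ge0.
have [s /andP[s0 sr] ps] := poly_nonroot p0 (divr_gt0 r0 mm0).
exists (Q s) => [k km|i j k im jm km ij ik jk].
  rewrite /Q addrC addKr normrZ gtr0_norm//.
  apply: (@le_lt_trans _ _ (s * (m%:R + m%:R ^+ 2 + 1))); last by rewrite -ltr_pdivlMr.
  rewrite ler_wpM2l ?(ltW s0)//; apply: norm_le_coord; first exact: ltW.
  have kmR : k%:R <= m%:R :> R by rewrite ler_nat ltnW.
  have km2 : k%:R ^+ 2 <= m%:R ^+ 2 :> R by rewrite lerXn2r// nnegrE.
  have m2 : 0 <= m%:R ^+ 2 :> R by exact: sqr_ge0.
  have m1 : 0 <= m%:R :> R by [].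
  move=> i; rewrite mxE; case: ifP => _; [|case: ifP => _]; rewrite ger0_norm ?sqr_ge0//; lra.
rewrite -DE; move: ps; rewrite /p !horner_prod => /prodf_neq0/(_ (Ordinal im) isT).
rewrite horner_prod => /prodf_neq0/(_ (Ordinal jm) ij).
rewrite horner_prod => /prodf_neq0/(_ (Ordinal km)); apply.
by rewrite /= ik.
Qed.

End general_position.

(** * Borel sets are measurable for the Hausdorff measure *)

Section shells.
Context {R : realType} {T : Type} (mu : {outer_measure set T -> \bar R}).
Context (f : T -> R).
Local Open Scope ereal_scope.
Hypothesis sep : forall (A B : set T) (eta : R), (0 < eta)%R ->
  (forall a b, A a -> B b -> (f b + eta <= f a)%R) -> mu A + mu B <= mu (A `|` B).

Let t (n : nat) : R := n.+1%:R^-1.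
Let shell (X : set T) k := X `&` [set x | (t k.+1 <= f x)%R /\ (f x < t k)%R].

Let parity_sum X (p m : nat) :
  \sum_(k < m) mu (shell X (2 * k + p)) <= mu (\big[setU/set0]_(k < m) shell X (2 * k + p)).
Proof.
elim: m => [|m IH]; first by rewrite !big_ord0 outer_measure0.
rewrite !big_ord_recr /=; apply: le_trans (sep (eta := (2 * m + p)%N.+1%:R^-1 ^+ 2) _ _).
- by rewrite leeD2r.
- by rewrite exprn_gt0 ?invr_gt0.
(* 1/n - 1/(n + 1) = 1/(n (n + 1)) exceeds the square of 1/(n + 1): this is the gap between the
   shell n and the shells of index at most n - 2. *)
move=> a b; rewrite -(bigcup_mkord m (fun k => shell X (2 * k + p))) => -[k /= km [Xa [fa _]]] [_ [_ fb]].
set n := (2 * m + p)%N in fb *.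
have n0 : (0 < n)%N by rewrite /n; lia.
have nR : (0 < n%:R :> R)%R by rewrite ltr0n.
have h1 : (n%:R^-1 <= f a)%R.
  apply: le_trans fa; rewrite /t lef_pV2 ?posrE ?ltr0n// ler_nat /n; lia.
apply: (le_trans _ h1); apply: (@le_trans _ _ (n.+1%:R^-1 + n.+1%:R^-1 ^+ 2)%R).
  by rewrite lerD2r ltW.
rewrite -natr1; set N := n%:R in nR *.
have -> : ((N + 1)^-1 + (N + 1)^-1 ^+ 2 = (N + 2) / (N + 1) ^+ 2 :> R)%R.
  by field; rewrite gt_eqF// addr_gt0.
rewrite ler_pdivrMr ?exprn_gt0 ?addr_gt0// mulrC ler_pdivlMr//.
by lra.
Qed.

Let parity_le X (p m : nat) : \sum_(k < m) mu (shell X (2 * k + p)) <= mu X.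
Proof.
apply: (le_trans (parity_sum X p m)); apply: le_outer_measure.
by rewrite -(bigcup_mkord m (fun k => shell X (2 * k + p))) => x [k _ []].
Qed.

(** Caratheodory's criterion. The shells between consecutive levels t (k + 1) and t k of f that have
indices of the same parity are at positive distance from each other, so that mu is additive
on them and the series of the masses of all shells converges. Hence the part of X where
0 < f < t N has small mass, and the rest of it is separated from the set where f <= 0. *)
Lemma shell_caratheodory : mu.-caratheodory [set x | (0 < f x)%R].
Proof.
apply: le_caratheodory_measurable => X.
set A := [set x | _].
have [|Xoo] := leP +oo (mu X); first by rewrite leye_eq => /eqP ->; rewrite leey.
have Xfin : mu X \is a fin_num by rewrite ge0_fin_numE// outer_measure_ge0.
pose r k := mu (shell X k).
have r0 k : 0 <= r k by exact: outer_measure_ge0.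
have sum_le m : \sum_(0 <= k < m) r k <= mu X + mu X.
  apply: (@le_trans _ _ (\sum_(0 <= k < m.*2) r k)).
    rewrite [leRHS](@big_cat_nat _ _ _ m) ?leeDl//= -?addnn ?leq_addr//.
    by apply: sume_ge0.
  have -> : \sum_(0 <= k < m.*2) r k =
      \sum_(k < m) r (2 * k + 0)%N + \sum_(k < m) r (2 * k + 1)%N.
    elim: m => [|m IH]; first by rewrite !big_ord0 big_geq// adde0.
    rewrite doubleS !big_nat_recr//= IH !big_ord_recr /= !addeA; congr (_ + _); last first.
      by congr r; lia.
    rewrite -!addeA; congr (_ + _); rewrite addeC; congr (r _ + _); lia.
  by apply: leeD; exact: parity_le.
have tail : \sum_(N <= k <oo) r k @[N --> \oo] --> 0.
  apply: nneseries_tail_cvg => //.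
  apply: (@le_lt_trans _ _ (mu X + mu X)); last by rewrite lte_add_pinfty.
  apply: lime_le; first exact: is_cvg_nneseries.
  by near=> m; exact: sum_le.
apply/lee_addgt0Pr => e e0.
have [N _ /(_ N (leqnn N)) HN] : \forall N \near \oo, \sum_(N <= k <oo) r k <= e%:E.
  move/fine_cvgP: tail => [fin /cvgrPdist_le/(_ _ e0) H].
  near=> N; have NF : (\sum_(N <= k <oo) r k)%E \is a fin_num by near: N.
  have : (`|0 - fine (\sum_(N <= k <oo) r k)| <= e)%R by near: N.
  rewrite sub0r normrN ger0_norm ?fine_ge0 ?nneseries_ge0// -lee_fin fineK//.
pose XN := X `&` [set x | (t N <= f x)%R].
have XA : mu (X `&` A) <= mu XN + e%:E.
  apply: (@le_trans _ _ (mu (XN `|` \bigcup_k shell X (k + N)))).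
    apply: le_outer_measure => x [Xx fx].
    have [tx|tx] := leP (t N) (f x); first by left.
    right.
    have ex : exists k, (t k <= f x)%R.
      exists (Num.bound (f x)^-1); rewrite /t invf_ple ?posrE//.
      apply: (le_trans (ltW (archi_boundP _))); first by rewrite invr_ge0 ltW.
      by rewrite ler_nat.
    have k0 := ex_minnP ex; case: k0 => k tk kmin.
    have Nk : (N < k)%N.
      rewrite ltnNge; apply/negP => kN.
      have : (t N <= t k)%R by rewrite /t lef_pV2 ?posrE ?ltr0n// ler_nat ltnS.
      by move=> /le_trans/(_ tk); rewrite leNgt tx.
    exists (k.-1 - N)%N => //; split => //=.
    have kE : ((k.-1 - N + N)%N = k.-1)%N by lia.
    rewrite kE prednK; last by lia.
    split => //; rewrite ltNge; apply/negP => /kmin; lia.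
  apply: (le_trans (outer_measureU2 _ _ _)); apply: leeD => //.
  apply: (le_trans (outer_measure_sigma_subadditive mu _)).
  by rewrite (nneseries_addn N (f := r)).
have XS : mu XN + mu (X `&` ~` A) <= mu X.
  apply: le_trans (sep (eta := t N) _ _) _; first by rewrite /t invr_gt0.
    move=> a b [_ /= ta] [_ /negP]; rewrite -leNgt => fb.
    by rewrite -[leRHS]add0r lerD.
  by apply: le_outer_measure => x [[]|[]].
apply: (le_trans (leeD XA (lexx _))).
rewrite addeAC leeD2r//.
Unshelve. all: by end_near.
Qed.

End shells.

Section hausdorff_open.
Context {R : realType}.
Local Notation V := 'rV[R]_3.
Implicit Types (A B : set V).
Local Open Scope ereal_scope.

Lemma le_diam A B : A `<=` B -> diam A <= diam B.
Proof.
move=> AB; apply: le_ereal_sup => x [->|[p [Ap Aq] <-]]; first by left.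
by right; exists p => //; split; exact: AB.
Qed.

Lemma diam_ge0 A : 0 <= diam A.
Proof. by apply: ereal_sup_ubound; left. Qed.

Lemma diam_set0 : diam (@set0 V) = 0.
Proof.
apply/eqP; rewrite eq_le diam_ge0 andbT; apply: ge_ereal_sup => y [->//|[p [[]]]].
Qed.

Lemma enorm_diam A x y : A x -> A y -> (enorm (x - y))%:E <= diam A.
Proof. by move=> Ax Ay; apply: ereal_sup_ubound; right; exists (x, y). Qed.

Lemma norm_le_enorm (x : V) : (`|x| <= enorm x)%R.
Proof.
apply: norm_le_coord; first exact: sqrtr_ge0.
move=> i; rewrite -sqrtr_sqr /enorm ler_sqrt ?sumr_ge0//; last by move=> *; exact: sqr_ge0.
by rewrite (bigD1 i)//= lerDl sumr_ge0// => *; exact: sqr_ge0.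
Qed.

Lemma hausdorff1_pre_ge0 d A : 0 <= hausdorff1_pre d A.
Proof.
by apply: le_ereal_inf_tmp => _ [F _ <-]; apply: nneseries_ge0 => k _ _; exact: diam_ge0.
Qed.

Lemma hausdorff1_pre_le d A : (0 < d)%R -> hausdorff1_pre d A <= hausdorff1 A.
Proof. by move=> d0; apply: ereal_sup_ubound; exists d. Qed.

Lemma ereal_supD_le (S1 S2 : set (\bar R)) (x : \bar R) : S1 !=set0 -> S2 !=set0 ->
  (forall u, S1 u -> 0 <= u) -> (forall u, S2 u -> 0 <= u) ->
  (forall u v, S1 u -> S2 v -> u + v <= x) -> ereal_sup S1 + ereal_sup S2 <= x.
Proof.
move=> [u0 Su0] [v0 Sv0] p1 p2 H.
have x0 : 0 <= x.
  by apply: le_trans (H _ _ Su0 Sv0); apply: adde_ge0; [exact: p1|exact: p2].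
have [|xoo] := leP +oo x; first by rewrite leye_eq => /eqP ->; rewrite leey.
have xfin : x \is a fin_num by rewrite ge0_fin_numE.
have f2 v : S2 v -> v \is a fin_num.
  move=> Sv; rewrite ge0_fin_numE ?p2//; apply: le_lt_trans xoo.
  by apply: le_trans (H _ _ Su0 Sv); rewrite leeDr ?p1.
have h1 v : S2 v -> ereal_sup S1 <= x - v.
  by move=> Sv; apply: ge_ereal_sup => u Su; rewrite leeBrDr ?f2// H.
have s1fin : ereal_sup S1 \is a fin_num.
  rewrite ge0_fin_numE; last by apply: (le_trans (p1 _ Su0)); exact: ereal_sup_ubound.
  apply: le_lt_trans (h1 _ Sv0) _; rewrite -ge0_fin_numE.
    by rewrite fin_numB xfin f2.
  by apply: le_trans (h1 _ Sv0); apply: (le_trans (p1 _ Su0)); exact: ereal_sup_ubound.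
rewrite addeC -leeBrDr//; apply: ge_ereal_sup => v Sv.
by rewrite leeBrDr// addeC -leeBrDr ?f2// h1.
Qed.

(** Sets of diameter less than eta cannot meet both A and B, so a fine cover of the union splits
into a cover of A and a cover of B. *)
Lemma hausdorff1_sep A B (eta : R) : (0 < eta)%R ->
  (forall a b, A a -> B b -> (eta <= enorm (a - b))%R) ->
  hausdorff1 A + hausdorff1 B <= hausdorff1 (A `|` B).
Proof.
move=> eta0 H.
apply: ereal_supD_le.
- by exists (hausdorff1_pre 1 A), 1%R => /=.
- by exists (hausdorff1_pre 1 B), 1%R => /=.
- by move=> _ [d _ <-]; exact: hausdorff1_pre_ge0.
- by move=> _ [d _ <-]; exact: hausdorff1_pre_ge0.
move=> _ _ [d1 /= d10 <-] [d2 /= d20 <-].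
pose d := Num.min (Num.min d1 d2) (eta / 2)%R.
have d0 : (0 < d)%R by rewrite !lt_min d10 d20 divr_gt0.
apply: le_trans (hausdorff1_pre_le _ d0).
apply: le_ereal_inf_tmp => _ [F [Fd AF] <-].
have dd1 : (d <= d1)%R by rewrite !ge_min lexx.
have dd2 : (d <= d2)%R by rewrite !ge_min lexx orbT.
have cov (d' : R) C : (d <= d')%R -> C `<=` A `|` B ->
    hausdorff1_pre d' C <= \sum_(k <oo) diam (F k `&` C).
  move=> dd' CAB; apply: ereal_inf_lbound; exists (fun k => F k `&` C) => //=; split.
    move=> k; apply: (@le_trans _ _ (diam (F k))); first by apply: le_diam => x [].
    by apply: (le_trans (Fd k)); rewrite lee_fin.
  by move=> x Cx; have [k _ Fx] := AF _ (CAB _ Cx); exists k.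
apply: (le_trans (leeD (cov d1 A dd1 _) (cov d2 B dd2 _))); [by left|by right|].
rewrite -nneseriesD; [|by move=> *; exact: diam_ge0|by move=> *; exact: diam_ge0].
apply: lee_nneseries => [k _ _|k _]; first by rewrite adde_ge0 ?diam_ge0.
have [[a [Fa Aa]]|nA] := pselect ((F k `&` A) !=set0); last first.
  have -> : F k `&` A = set0 by apply/seteqP; split => // x h; apply: nA; exists x.
  by rewrite diam_set0 add0e le_diam// => x [].
have -> : F k `&` B = set0.
  apply/seteqP; split => // b [Fb Bb] /=.
  have := le_trans (enorm_diam Fa Fb) (Fd k); rewrite lee_fin => h.
  have := le_trans (H _ _ Aa Bb) h; apply/negP; rewrite -ltNge.
  apply: (@le_lt_trans _ _ (eta / 2)%R); first by rewrite /d ge_min lexx orbT.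
  by rewrite ltr_pdivrMr// ltr_pMr// ltr1n.
by rewrite diam_set0 adde0 le_diam// => x [].
Qed.

(** The criterion applies to the distance from the complement, which is 1-Lipschitz. *)
Lemma open_caratheodory (O : set V) : open O -> (@hausdorff1 R).-caratheodory O.
Proof.
move=> oO.
have [E|/set0P K0] := eqVneq (~` O) set0.
  have -> : O = setT by rewrite -(setCK O) E setC0.
  by rewrite -setC0; apply: caratheodory_measurable_setC; exact: caratheodory_measurable_set0.
have -> : O = [set x | (0 < dist (~` O) x)%R].
  apply/seteqP; split => x /=.
    move=> Ox; have /nbhs_ballP[e /= e0 He] := open_nbhs_nbhs (conj oO Ox).
    apply: (lt_le_trans e0); apply: dist_ge => // y nOy; rewrite leNgt; apply/negP => xy.
    by apply: nOy; apply: He; rewrite -ball_normE.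
  by move=> h; apply: contrapT => /(dist_le K0); rewrite leNgt h.
apply: shell_caratheodory => A B eta eta0 H.
apply: (hausdorff1_sep eta0) => a b Aa Bb.
have := H a b Aa Bb; have := dist_lip K0 a b; have := norm_le_enorm (a - b); lra.
Qed.

Lemma borel_caratheodory (A : set (borelR3 R)) : measurable A ->
  measurable (A : set (hauR3 R)).
Proof.
apply: (@smallest_sub _ (sigma_algebra setT) (@open V) (@measurable _ (hauR3 R))).
  exact: sigma_algebra_measurable.
by move=> O oO; exact: open_caratheodory.
Qed.

End hausdorff_open.

(** * Hausdorff measure on a line *)

Section line_geometry.
Context {R : realType}.
Local Notation V := 'rV[R]_3.
Implicit Types (x y d : V).

Definition dotp x y : R := \sum_i x 0 i * y 0 i.

Lemma dotpBl x y d : dotp (x - y) d = dotp x d - dotp y d.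
Proof. by rewrite /dotp -sumrB; apply: eq_bigr => i _; rewrite !mxE mulrBl. Qed.

Lemma dotpZl (s : R) x d : dotp (s *: x) d = s * dotp x d.
Proof. by rewrite /dotp mulr_sumr; apply: eq_bigr => i _; rewrite !mxE mulrA. Qed.

Lemma enorm_sq x : enorm x ^+ 2 = dotp x x.
Proof. by rewrite /enorm sqr_sqrtr ?sumr_ge0// => i _; exact: sqr_ge0. Qed.

Lemma enorm_ge0 x : 0 <= enorm x.
Proof. exact: sqrtr_ge0. Qed.

Lemma enormZ (s : R) x : enorm (s *: x) = `|s| * enorm x.
Proof.
rewrite /enorm -sqrtr_sqr -sqrtrM ?sqr_ge0// mulr_sumr; congr Num.sqrt.
by apply: eq_bigr => i _; rewrite !mxE exprMn.
Qed.

Lemma enorm_gt0 x : x != 0 -> 0 < enorm x.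
Proof. by move=> x0; apply: lt_le_trans (norm_le_enorm x); rewrite normr_gt0. Qed.

Lemma dotp_le x y : `|dotp x y| <= enorm x * enorm y.
Proof.
rewrite -(ler_pXn2r (_ : 0 < 2)%N)// ?nnegrE ?mulr_ge0 ?enorm_ge0//.
rewrite real_normK ?num_real// exprMn !enorm_sq /dotp !big_ord_recl !big_ord0 !addr0.
set a := x 0 _; set b := x 0 _; set c := x 0 _.
set u := y 0 _; set v := y 0 _; set w := y 0 _.
rewrite -subr_ge0.
have -> : (a * a + (b * b + c * c)) * (u * u + (v * v + w * w)) - (a * u + (b * v + c * w)) ^+ 2
  = (a * v - b * u) ^+ 2 + (a * w - c * u) ^+ 2 + (b * w - c * v) ^+ 2 by ring.
by rewrite !addr_ge0 ?sqr_ge0.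
Qed.

End line_geometry.

Section hausdorff_line.
Context {R : realType} (a d : 'rV[R]_3) (d_neq0 : d != 0).
Local Notation V := 'rV[R]_3.

Definition line (s : R) : V := a + s *: d.
Definition lproj (x : V) : R := dotp (x - a) d / enorm d ^+ 2.

Let en_gt0 : 0 < enorm d := enorm_gt0 d_neq0.

Lemma lproj_line s : lproj (line s) = s.
Proof.
rewrite /lproj /line addrC addKr dotpZl -enorm_sq mulfK//.
by rewrite expf_neq0// gt_eqF.
Qed.

Lemma lproj_lip x y : `|lproj x - lproj y| * enorm d <= enorm (x - y).
Proof.
rewrite /lproj -mulrBl -dotpBl opprB addrA subrK normrM normfV (ger0_norm (sqr_ge0 _)).
rewrite -mulrA; have -> : (enorm d ^+ 2)^-1 * enorm d = (enorm d)^-1 by field; rewrite gt_eqF.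
rewrite ler_pdivrMr//; exact: dotp_le.
Qed.

Lemma line_continuous : continuous line.
Proof.
move=> t; apply: cvgD; first exact: cvg_cst.
by apply: cvgZr_tmp; exact: cvg_id.
Qed.

Lemma lproj_sup_lip x y : `|lproj x - lproj y| <= 2 / enorm d * `|x - y|.
Proof.
rewrite mulrAC ler_pdivlMr//; apply: (le_trans (lproj_lip x y)).
rewrite /enorm.
have -> : 2 * `|x - y| = Num.sqrt ((2 * `|x - y|) ^+ 2).
  by rewrite sqrtr_sqr ger0_norm// mulr_ge0.
rewrite ler_sqrt ?sqr_ge0// !big_ord_recl big_ord0 addr0.
have H i : (x - y) 0 i ^+ 2 <= `|x - y| ^+ 2.
  by rewrite -real_normK ?num_real// lerXn2r ?nnegrE// coord_le_norm.
have := sqr_ge0 `|x - y|; have := H ord0.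
have := H (lift ord0 ord0); have := H (lift ord0 (lift ord0 ord0)).
by rewrite exprMn; lra.
Qed.

Lemma lproj_continuous : continuous lproj.
Proof.
by apply: (@lip_continuous R _ (2 / enorm d)); [rewrite divr_gt0|exact: lproj_sup_lip].
Qed.

Lemma range_lineE : range line = [set x | line (lproj x) = x].
Proof.
apply/seteqP; split => [_ [s _ <-]|x /= <-]; first by rewrite /= lproj_line.
by exists (lproj x).
Qed.

Lemma closed_line : closed (range line).
Proof.
rewrite range_lineE (_ : mkset _ = (fun x => `|line (lproj x) - x|) @^-1` [set y | y = 0]).
  apply: closed_comp; last exact: closed_eq.
  move=> x _; apply: (@lip_continuous R _ (2 / enorm d * `|d| + 1)).
    by rewrite ltr_wpDl// mulr_ge0// divr_ge0// ltW.
  move=> p q; apply: (le_trans (ler_dist_dist _ _)).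
  have -> : line (lproj p) - p - (line (lproj q) - q) = (lproj p - lproj q) *: d - (p - q).
    by apply/rowP => i; rewrite !mxE; ring.
  apply: (le_trans (ler_normB _ _)); rewrite mulrDl mul1r lerD2r normrZ mulrAC.
  by rewrite ler_wpM2r// lproj_sup_lip.
by apply/seteqP; split => x /= => [->|/eqP]; rewrite ?subrr ?normr0// normr_eq0 subr_eq0 => /eqP.
Qed.

Lemma closed_borel (A : set V) : closed A -> measurable (A : set (borelR3 R)).
Proof.
move=> cA; rewrite -(setCK A); apply: measurableC; apply: sub_sigma_algebra.
exact: closed_openC.
Qed.

Local Open Scope ereal_scope.

(** Each set of a cover projects into an interval of the parameter line, no longer than its
diameter divided by |d|; these intervals cover ]x, y]. *)
Lemma hausdorff1_itv_ge (x y : R) : (x < y)%R ->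
  (enorm d * (y - x))%:E <= hausdorff1 (line @` `]x, y]).
Proof.
move=> xy; apply: le_trans (hausdorff1_pre_le _ ltr01).
apply: le_ereal_inf_tmp => _ [F [_ AF] <-].
pose S k := lproj @` F k.
have Sd k : diam (F k) < +oo -> forall u v, S k u -> S k v ->
    (u - v <= fine (diam (F k)) / enorm d)%R.
  move=> Foo u v [p Fp <-] [q Fq <-].
  rewrite ler_pdivlMr// -lee_fin fineK; last by rewrite ge0_fin_numE ?diam_ge0.
  apply: le_trans (enorm_diam Fp Fq); rewrite lee_fin; apply: le_trans (lproj_lip p q).
  by apply: ler_wpM2r; [exact: ltW|exact: ler_norm].
pose G k : set R := if diam (F k) == +oo then setT else
  if `[< F k !=set0 >] then `[inf (S k), sup (S k)]%classic else set0.
have mG k : measurable (G k).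
  by rewrite /G; case: ifP => // _; case: ifP.
have GF k : lebesgue_measure (G k) <= (enorm d)^-1%:E * diam (F k).
  rewrite /G; case: ifPn => [/eqP ->|Fn].
    by rewrite gt0_muley ?leey// lte_fin invr_gt0.
  have Foo : diam (F k) < +oo by rewrite ltey.
  case: asboolP => [F0|_]; last first.
    by rewrite measure0 mule_ge0 ?diam_ge0// lee_fin invr_ge0 ltW.
  rewrite lebesgue_measure_itv /= lte_fin; case: ifPn => _; last first.
    by rewrite mule_ge0 ?diam_ge0// lee_fin invr_ge0 ltW.
  rewrite -(@fineK _ (diam (F k))) ?ge0_fin_numE ?diam_ge0// -EFinB -EFinM lee_fin mulrC.
  have S0 : S k !=set0 by case: F0 => p Fp; exists (lproj p); exists p.
  rewrite lerBlDr; apply: ge_sup => // u Su; rewrite -lerBlDl; apply: lb_le_inf => // v Sv.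
  by rewrite lerBlDr addrC -lerBlDr Sd.
have FG : `]x, y]%classic `<=` \bigcup_k G k.
  move=> s sxy; have [k _ Fk] := AF (line s) (ex_intro2 _ _ s sxy erefl).
  exists k => //; rewrite /G; case: ifPn => // Fn.
  case: asboolP => [F0|]; last by case; exists (line s).
  have Ss : S k s by exists (line s) => //; exact: lproj_line.
  have Foo : diam (F k) < +oo by rewrite ltey.
  rewrite /= in_itv /=; apply/andP; split.
    apply: ge_inf => //; exists (s - fine (diam (F k)) / enorm d)%R => v Sv.
    by rewrite lerBlDr -lerBlDl Sd.
  apply: ub_le_sup => //; exists (s + fine (diam (F k)) / enorm d)%R => v Sv.
  by rewrite -lerBlDl Sd.
have : lebesgue_measure (`]x, y]%classic : set R) <= \sum_(k <oo) lebesgue_measure (G k).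
  exact: measure_sigma_subadditive.
rewrite lebesgue_measure_itv /= lte_fin xy => h.
have -> : (enorm d * (y - x))%:E = (enorm d)%:E * (y%:E - x%:E) by rewrite -EFinB EFinM.
apply: (@le_trans _ _ ((enorm d)%:E * \sum_(k <oo) ((enorm d)^-1%:E * diam (F k)))).
  rewrite lee_wpmul2l ?lee_fin ?(ltW en_gt0)//; apply: (le_trans h).
  by apply: lee_nneseries.
rewrite nneseriesZl; last by move=> k _; exact: diam_ge0.
by rewrite muleA -EFinM mulfV ?gt_eqF// mul1e.
Qed.

(** Cover the image by n consecutive pieces of equal length, below delta. *)
Lemma hausdorff1_itv_le (x y : R) : (x < y)%R ->
  hausdorff1 (line @` `]x, y]) <= (enorm d * (y - x))%:E.
Proof.
move=> xy; apply: ge_ereal_sup => _ [delta /= d0 <-].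
have c0 : (0 < enorm d * (y - x))%R by rewrite mulr_gt0// subr_gt0.
pose n := (Num.bound (enorm d * (y - x) / delta)).+1.
pose h := ((y - x) / n%:R)%R.
have n0 : (0 < n%:R :> R)%R by rewrite ltr0n.
have h0 : (0 < h)%R by rewrite divr_gt0// subr_gt0.
have hd : (enorm d * h <= delta)%R.
  rewrite /h mulrA ler_pdivrMr// [leRHS]mulrC -ler_pdivrMr// /n -natr1.
  have q0 : (0 <= enorm d * (y - x) / delta)%R by apply: divr_ge0; exact: ltW.
  by apply: (le_trans (ltW (archi_boundP q0))); rewrite lerDl.
pose F k : set V := if (k < n)%N then line @` [set` `]x + k%:R * h, x + k.+1%:R * h]%R] else set0.
have dF k : diam (F k) <= if (k < n)%N then (enorm d * h)%:E else 0.
  rewrite /F; case: ifP => _; last by rewrite diam_set0.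
  apply: ge_ereal_sup => _ [->|[[_ _] [/= [s + <-] [t + <-]] <-]].
    by rewrite lee_fin mulr_ge0 ?ltW.
  rewrite !in_itv /= => /andP[s1 s2] /andP[t1 t2].
  rewrite lee_fin /line opprD addrACA subrr add0r -scalerBl enormZ mulrC.
  apply: ler_wpM2l; first exact: ltW.
  rewrite -natr1 mulrDl mul1r addrA in s2 t2.
  by rewrite ler_norml; apply/andP; split; lra.
apply: (@le_trans _ _ (\sum_(k <oo) diam (F k))).
  apply: ereal_inf_lbound; exists F => //=; split.
    move=> k; apply: (le_trans (dF k)); case: ifP => _; rewrite lee_fin//.
    exact: ltW.
  move=> _ [s + <-]; rewrite /= in_itv /= => /andP[xs sy].
  have ex : exists k, (s <= x + k.+1%:R * h)%R.
    by exists n.-1; rewrite prednK// /h mulrC divfK ?gt_eqF// addrC subrK.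
  have [k sk kmin] := ex_minnP ex.
  have kn : (k < n)%N.
    by rewrite /n ltnS; apply: kmin; rewrite -/n /h mulrC divfK ?gt_eqF// addrC subrK.
  exists k => //; rewrite /F kn; exists s => //; rewrite /= in_itv /= sk andbT.
  case: k {kn} sk kmin => [|k] sk kmin; first by rewrite mul0r addr0.
  by rewrite ltNge; apply/negP => /kmin; rewrite ltnn.
apply: (@le_trans _ _ (\sum_(k <oo) if (k < n)%N then (enorm d * h)%:E else 0)).
  by apply: lee_nneseries => // k _ _; exact: diam_ge0.
rewrite (nneseries_split 0 n) => [|k _]; last by case: ifP => // _; rewrite lee_fin mulr_ge0 ?ltW.
rewrite add0n eseries0 ?adde0 => [|k nk _]; last by rewrite ltnNge nk.
rewrite big_mkord; under eq_bigr do rewrite ltn_ord.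
rewrite sumEFin lee_fin sumr_const card_ord -mulr_natl /h.
by rewrite mulrCA (mulrC n%:R) divfK ?gt_eqF.
Qed.

End hausdorff_line.

(** * Integration on a line *)

Lemma posreal_muleBr (R : realType) (c : R) (u v : \bar R) : (0 < c)%R ->
  (c%:E * (u - v) = c%:E * u - c%:E * v)%E.
Proof.
by move=> c0; case: u v => [u| |] [v| |] //=;
  rewrite ?(gt0_muley, gt0_muleNy) ?lte_fin// -?EFinM -?EFinB -?EFinM ?mulrBr//.
Qed.

Section line_integral.
Context {R : realType} (a d : 'rV[R]_3) (d_neq0 : d != 0).
Local Notation V := 'rV[R]_3.
Local Notation line := (line a d).
Local Notation lproj := (lproj a d).
Local Open Scope ereal_scope.

Let en_gt0 : (0 < enorm d)%R := enorm_gt0 d_neq0.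

Lemma measurable_range_line : measurable (range line : set (hauR3 R)).
Proof. by apply: borel_caratheodory; apply: closed_borel; exact: closed_line. Qed.

Lemma continuous_hau (f : V -> R) : continuous f ->
  measurable_fun [set: hauR3 R] (f : hauR3 R -> measurableTypeR R).
Proof.
move=> /continuous_borel mf _ A mA; rewrite setTI; apply: borel_caratheodory.
by rewrite -[X in measurable X]setTI; exact: mf.
Qed.

Let mproj : measurable_fun [set: hauR3 R] (lproj : hauR3 R -> measurableTypeR R).
Proof. by apply: continuous_hau; exact: lproj_continuous. Qed.

Lemma line_measurable : measurable_fun [set: measurableTypeR R] (line : measurableTypeR R -> borelR3 R).
Proof.
apply: (measurability (@open V : set (set (borelR3 R))) erefl) => _ [U oU <-].
rewrite setTI; apply: open_measurable.
by move/continuousP : (@line_continuous R a d); exact.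
Qed.

Let c_ge0 : (0 <= (enorm d)^-1)%R. Proof. by rewrite invr_ge0 ltW. Qed.

(** The right-hand side is the image of H^1 on the line under the projection, up to a factor: a
measure on R that gives half-open intervals their length. *)
Lemma line_lebesgue (B : set R) : measurable B ->
  lebesgue_measure B =
  ((enorm d)^-1)%:E * H1 ((lproj @^-1` B `&` range line) : set (hauR3 R)).
Proof.
move=> mB.
pose m0 : {measure set (hauR3 R) -> \bar R} := mrestr (@H1 R) measurable_range_line.
pose m1 : {measure set (measurableTypeR R) -> \bar R} :=
  measure_function_pushforward__canonical__measure_function_Measure m0 mproj.
transitivity (mscale (NngNum c_ge0) m1 B); last by [].
apply: lebesgue_measure_unique => //.
move=> _ [[x y] _ <-] /=.
rewrite /mscale /pushforward /mrestr /=.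
rewrite [X in _ * X](_ : _ = H1 (line @` `]x, y] : set (hauR3 R))); last first.
  congr (@H1 R _); apply/seteqP; split => [z [/= h [s _ sz]]|_ [s sxy <-]].
    by move: h; rewrite -sz (lproj_line a d_neq0) => h; exists s.
  by split; [rewrite /= (lproj_line a d_neq0)|exists s].
rewrite lebesgue_measure_itv /= lte_fin; case: ltP => xy.
  have -> : H1 (line @` `]x, y] : set (hauR3 R)) = (enorm d * (y - x))%:E.
    apply/eqP; rewrite eq_le; apply/andP; split.
      exact: hausdorff1_itv_le.
    exact: hausdorff1_itv_ge.
  by rewrite -EFinM mulrA mulVf ?gt_eqF// mul1r.
have -> : `]x, y]%classic = set0.
  by apply: set_itv_ge; rewrite bnd_simp -leNgt.
by rewrite image_set0 measure0 mule0.
Qed.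

Lemma H1_line (A : set (borelR3 R)) : measurable A ->
  H1 ((A `&` range line) : set (hauR3 R)) =
  (enorm d)%:E * lebesgue_measure (line @^-1` A : set R).
Proof.
move=> mA.
have mlA : measurable (line @^-1` A : set R).
  by rewrite -[X in measurable X]setTI; apply: line_measurable.
rewrite line_lebesgue// muleA -EFinM mulfV ?gt_eqF// mul1e.
congr H1; apply/seteqP; split => [z [/= h [s _ sz]]|z [/= h [s _ sz]]].
  by rewrite -sz in h *; split; [rewrite /= (lproj_line a d_neq0)|exists s].
by move: h; rewrite -sz (lproj_line a d_neq0) => h; split; [|exists s].
Qed.

(** By [H1_line] the image of Lebesgue measure under the parametrisation and H^1 on the line agree
on Borel sets. H^1 lives on a larger sigma-algebra; the identity map carries it to the Borel
one, where the two measures can be compared. *)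
Lemma integral_line (D : set (borelR3 R)) (f : V -> \bar R) : measurable D ->
  measurable_fun [set: borelR3 R] f ->
  \int[H1]_(x in (D `&` range line : set (hauR3 R))) f x =
  (enorm d)%:E * \int[lebesgue_measure]_(s in line @^-1` D) f (line s).
Proof.
move=> mD mf.
suff H (g : V -> \bar R) : measurable_fun [set: borelR3 R] g -> (forall x, 0 <= g x) ->
    \int[H1]_(x in (D `&` range line : set (hauR3 R))) g x =
    (enorm d)%:E * \int[lebesgue_measure]_(s in line @^-1` D) g (line s).
  rewrite [LHS]integralE [X in _ * X]integralE.
  rewrite !H//; [|exact: measurable_funeneg|exact: measurable_funepos].
  rewrite (posreal_muleBr (\int[lebesgue_measure]_(s in line @^-1` D) _) _ en_gt0).
  by congr (_ * _ - _ * _)%E; apply: eq_integral => s _;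
    rewrite ?funeposE ?funenegE.
move=> mg g0.
have mid : measurable_fun [set: hauR3 R] (idfun : hauR3 R -> borelR3 R).
  by move=> _ A mA; rewrite setTI; exact: borel_caratheodory.
pose m1 : {measure set (borelR3 R) -> \bar R} :=
  measure_function_pushforward__canonical__measure_function_Measure (@H1 R) mid.
pose m2 : {measure set (borelR3 R) -> \bar R} :=
  measure_function_pushforward__canonical__measure_function_Measure
    (@lebesgue_measure R) line_measurable.
pose E : set (borelR3 R) := D `&` range line.
have mE : measurable E by apply: measurableI => //; apply: closed_borel; exact: closed_line.
have c0 : (0 <= enorm d)%R by exact: ltW.
transitivity (\int[m1]_(x in E) g x).
  rewrite (@ge0_integral_pushforward _ _ _ _ _ _ mid (@H1 R) E g)//.
  exact: measurable_funTS.
transitivity (\int[mscale (NngNum c0) m2]_(x in E) g x).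
  apply: eq_measure_integral => A mA AE.
  rewrite /mscale /= /m1 /m2 /= /pushforward /=.
  have AE' : A = A `&` range line by apply/seteqP; split => [x Ax|x []//]; split => //; have [] := AE _ Ax.
  by rewrite {1}AE'; exact: H1_line.
rewrite ge0_integral_mscale//; last exact: measurable_funTS.
congr (_ * _).
rewrite (@ge0_integral_pushforward _ _ _ _ _ _ line_measurable (@lebesgue_measure R) E g)//; last first.
  exact: measurable_funTS.
suff -> : line @^-1` E = line @^-1` D by [].
by apply/seteqP; split => s /=; [case|move=> h; split => //; exists s].
Qed.
End line_integral.

(** * Linear combinations of measures on segments *)

Lemma max_subE (R : realType) (c : R) : Num.max c 0 - Num.max (- c) 0 = c.
Proof. by case: (lerP c 0) => h; case: (lerP (- c) 0) => h'; lra. Qed.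

Section linear_charge.
Context {R : realType}.
Local Notation T := (borelR3 R).
Local Notation V := 'rV[R]_3.
Local Open Scope ereal_scope.

(** A copy of m to which the proof of finiteness can be attached as a structure. *)
Definition fmeas (m : {measure set T -> \bar R}) (moo : m setT < +oo) : set T -> \bar R := m.

Section fmeas.
Variables (m : {measure set T -> \bar R}) (moo : m setT < +oo).

HB.instance Definition _ := Measure.copy (fmeas moo) m.

Let fmeas_fin : fin_num_fun (fmeas moo).
Proof.
move=> A mA; rewrite /fmeas ge0_fin_numE//; apply: le_lt_trans moo.
by apply: le_measure; rewrite ?inE.
Qed.

HB.instance Definition _ := Measure_isFinite.Build _ _ _ (fmeas moo) fmeas_fin.

End fmeas.

Lemma fin_measure (m : {measure set T -> \bar R}) : m setT < +oo ->
  exists m' : {finite_measure set T -> \bar R}, forall A, m' A = m A.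
Proof. by move=> moo; exists (fmeas moo). Qed.

Lemma fin_lin (c c1 c2 : R) (a b e : \bar R) : a \is a fin_num -> b \is a fin_num ->
  e \is a fin_num -> (c1 - c2 = c)%R ->
  (a + c1%:E * e) - (b + c2%:E * e) = c%:E * e + (a - b).
Proof.
move: a b e => [a| |] [b| |] [e| |] // _ _ _ <-.
by rewrite -!(EFinM, EFinD, EFinB); congr (_%:E); ring.
Qed.

(** A Jordan pair of nu is kept through the construction: the positive and the negative part of c
put a multiple of m into one of its two members, and [charge_integralE] evaluates integrals
with the resulting pair. *)
Lemma lin_charge_step (nu : {charge set T -> \bar R}) (c : R) (m : {finite_measure set T -> \bar R}) :
  exists nu' : {charge set T -> \bar R},
    (forall A, measurable A -> nu' A = c%:E * m A + nu A) /\
    forall f, bounded_borel f -> charge_integral nu' f = (c * \int[m]_x f x + charge_integral nu f)%R.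
Proof.
have [p [q num]] := jordan_exists nu.
have c1 : (0 <= Num.max c 0)%R by rewrite le_max lexx orbT.
have c2 : (0 <= Num.max (- c) 0)%R by rewrite le_max lexx orbT.
have mkoo (p' : {finite_measure set T -> \bar R}) (c' : {nonneg R}) :
    (measure_add p' (mscale c' m) : {measure set T -> \bar R}) setT < +oo.
  rewrite [X in X < _]measure_addE /mscale /= lte_add_pinfty//.
    by rewrite -ge0_fin_numE// fin_num_measure.
  by rewrite lte_mul_pinfty// -ge0_fin_numE// fin_num_measure.
have [p' Ep] := fin_measure (mkoo p (NngNum c1)).
have [q' Eq] := fin_measure (mkoo q (NngNum c2)).
pose nu' : {charge set T -> \bar R} := cadd (charge_of_finite_measure p') (cscale (-1) (charge_of_finite_measure q')).
have nuE A : measurable A -> nu' A = p' A - q' A.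
  move=> mA; change (p' A + (-1)%:E * q' A = p' A - q' A).
  by rewrite EFinN mulN1e.
exists nu'; split => [A mA|f bf].
  rewrite nuE// num// Ep Eq [X in X - _ = _]measure_addE [X in _ - X = _]measure_addE /mscale /=.
  apply: fin_lin; [exact: fin_num_measure..|].
  exact: max_subE.
rewrite (charge_integralE nuE)// (charge_integralE num)//.
have ifm (m' : {finite_measure set T -> \bar R}) := bounded_borel_integrable m' bf.
have H (p0 p1 : {finite_measure set T -> \bar R}) (c' : {nonneg R}) :
    (forall A, p1 A = (measure_add p0 (mscale c' m) : {measure set T -> \bar R}) A) ->
    (\int[p1]_x f x = \int[p0]_x f x + c'%:num * \int[m]_x f x)%R.
  move=> E; rewrite /Rintegral.
  have -> : \int[p1]_x (f x)%:E = \int[measure_add p0 (mscale c' m)]_x (f x)%:E.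
    by apply: eq_measure_integral => A _ _; exact: E.
  have ims : (mscale c' m : {measure set T -> \bar R}).-integrable setT (EFin \o f).
    have [//|ms' Ems] := @fin_measure (mscale c' m).
      by rewrite /mscale /= lte_mul_pinfty// -ge0_fin_numE// fin_num_measure.
    have /integrableP[mf foo] := bounded_borel_integrable ms' bf.
    apply/integrableP; split => //; apply: le_lt_trans foo.
    by rewrite (@eq_measure_integral _ _ _ _ ms')// => A _ _; exact/esym/Ems.
  rewrite integral_measure_add//; last exact: ifm.
  have -> : \int[mscale c' m]_x (f x)%:E = c'%:num%:E * \int[m]_x (f x)%:E.
    rewrite integralE [X in _ * X]integralE.
    have [mf _] := bf.
    rewrite !ge0_integral_mscale//.
    - have := integrable_fin_num measurableT (integrable_funepos measurableT (ifm m)).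
      have := integrable_fin_num measurableT (integrable_funeneg measurableT (ifm m)).
      move: (\int[m]_x _) (\int[m]_x _) => [u| |] [v| |] // _ _.
      by rewrite -?(EFinM, EFinB) mulrBr.
    - by apply: measurable_funeneg; exact/measurable_EFinP.
    - by apply: measurable_funepos; exact/measurable_EFinP.
  have := integrable_fin_num measurableT (ifm p0).
  have := integrable_fin_num measurableT (ifm m).
  rewrite /comp; by move: (\int[p0]_x _) (\int[m]_x _) => [u| |] [v| |].
rewrite (H p p' (NngNum c1))// (H q q' (NngNum c2))//=.
rewrite -[X in _ = (X * _ + _)%R]max_subE; ring.
Qed.

Lemma lin_charge (I : Type) (s : seq I) (c : I -> R) (m : I -> {finite_measure set T -> \bar R}) :
  exists nu : {charge set T -> \bar R},
    (forall A, measurable A -> nu A = \sum_(k <- s) (c k)%:E * m k A) /\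
    forall f, bounded_borel f -> charge_integral nu f = (\sum_(k <- s) c k * \int[m k]_x f x)%R.
Proof.
elim: s => [|k s [nu [IH1 IH2]]].
  exists (@czero _ T R); split => [A mA|f bf]; first by rewrite big_nil.
  rewrite (@charge_integralE _ _ mzero mzero)//.
    by rewrite big_nil subrr.
  by move=> A mA; rewrite /mzero /= subee.
have [nu' [E1 E2]] := lin_charge_step nu (c k) (m k).
exists nu'; split => [A mA|f bf]; first by rewrite E1// IH1// big_cons.
by rewrite E2// IH2// big_cons.
Qed.

End linear_charge.

Section edge_measure.
Context {R : realType}.
Local Notation T := (borelR3 R).
Local Notation V := 'rV[R]_3.
Context (Omega : set V) (Omega_open : open Omega) (a b : V).
Local Open Scope ereal_scope.

Definition inner_par : set R := `[0%R, 1%R]%classic `&` seg a b @^-1` Omega.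

Lemma measurable_inner_par : measurable inner_par.
Proof.
apply: measurableI => //; apply: open_measurable.
by move/continuousP : (@seg_continuous R a b); exact.
Qed.

(** The mass is measured by the parameter and not by arc length: the factor b - a will be part of
the coefficients, one for each column. *)
Lemma edge_measure : exists m : {finite_measure set T -> \bar R},
  (forall A, m A = lebesgue_measure (inner_par `&` seg a b @^-1` A)) /\
  (forall f, bounded_borel f -> (forall x, ~ Omega x -> f x = 0%R) -> (\int[m]_x f x = seg_mean f a b)%R).
Proof.
have ms : measurable_fun [set: measurableTypeR R] (seg a b : measurableTypeR R -> T).
  exact: (@line_measurable R a (b - a)).
pose m0 : {measure set (measurableTypeR R) -> \bar R} := mrestr (@lebesgue_measure R) measurable_inner_par.
pose m1 : {measure set T -> \bar R} :=
  measure_function_pushforward__canonical__measure_function_Measure m0 ms.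
have m1E A : m1 A = lebesgue_measure (inner_par `&` seg a b @^-1` A).
  by rewrite /m1 /m0 /= /pushforward /mrestr /= setIC.
have [|m Em] := @fin_measure R m1.
  rewrite m1E; apply: (@le_lt_trans _ _ (lebesgue_measure (`[0%R, 1%R]%classic : set R))).
    apply: le_measure; rewrite ?inE//.
      by rewrite preimage_setT setIT; exact: measurable_inner_par.
    by move=> t [[]].
  by rewrite lebesgue_measure_itv /= lte01 oppr0 adde0 ltry.
exists m; split => [A|f bf f0]; first by rewrite Em m1E.
rewrite /seg_mean /Rintegral; congr fine.
transitivity (\int[m1]_x (f x)%:E).
  by apply: eq_measure_integral => A _ _; exact: Em.
have [mf _] := bf.
have if1 : m1.-integrable setT (EFin \o f).
  have /integrableP[mf' foo] := bounded_borel_integrable m bf.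
  apply/integrableP; split => //; apply: le_lt_trans foo.
  by rewrite (@eq_measure_integral _ _ _ _ m)// => A _ _; exact/esym/Em.
have H (g : V -> \bar R) : measurable_fun [set: T] g -> (forall x, 0 <= g x) ->
    (forall x, ~ Omega x -> g x = 0) ->
    \int[m1]_x g x = \int[lebesgue_measure]_(t in `[0%R, 1%R]) g (seg a b t).
  move=> mg g0 gO.
  rewrite (@ge0_integral_pushforward _ _ _ _ _ _ ms m0 setT g)// preimage_setT.
  have mgs : measurable_fun [set: measurableTypeR R] (g \o seg a b).
    exact: (measurableT_comp mg ms).
  have mN : measurable (~` inner_par : set (measurableTypeR R)).
    by apply: measurableC; exact: measurable_inner_par.
  transitivity (\int[m0]_(t in inner_par) g (seg a b t)).
    rewrite (@ge0_negligible_integral _ _ _ m0 setT (~` inner_par) _ mN measurableT)//.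
    - by rewrite setTD setCK.
    - by move=> t _; exact: g0.
    - change (lebesgue_measure (~` inner_par `&` inner_par) = 0); by rewrite setICl measure0.
  transitivity (\int[lebesgue_measure]_(t in inner_par) g (seg a b t)).
    apply: eq_measure_integral => A mA AE; rewrite /m0 /= /mrestr; congr lebesgue_measure.
    by apply/seteqP; split => [t []//|t At]; split => //; exact: AE.
  rewrite integral_mkcond [RHS]integral_mkcond; apply: eq_integral => t _.
  rewrite /patch; case: ifPn => [/set_mem[t01 _]|/negP h]; first by rewrite ifT// inE.
  case: ifPn => // /set_mem t01.
  by rewrite gO// => Ot; apply: h; rewrite inE.
rewrite [LHS]integralE [RHS]integralE.
rewrite !H//; [|exact/measurable_funeneg/measurable_EFinP| |exact/measurable_funepos/measurable_EFinP|].
- congr (_ - _); apply: eq_integral => t _; by rewrite ?funeposE ?funenegE.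
- by move=> x Ox; rewrite funenegE f0// oppe0 maxxx.
- by move=> x Ox; rewrite funeposE f0// maxxx.
Qed.

End edge_measure.

(** * Polylines in general position *)

Section polyline.
Context {R : realType} {N : nat}.
Local Notation V := 'rV[R]_3.
Context (Omega : set V) (Omega_open : open Omega).
Context (m : nat) (P : nat -> V) (th : nat -> 'rV[R]_N).
(* There are m edges; the bound m + 3 provides a third point k + 2 for every edge. *)
Hypothesis gen : forall i j k, (i < m.+3)%N -> (j < m.+3)%N -> (k < m.+3)%N ->
  i != j -> i != k -> j != k -> det2 (P i) (P j) (P k) != 0.

Definition edge_dir k : V := P k.+1 - P k.
Definition edge_line k : R -> V := line (P k) (edge_dir k).
(** Edges of weight zero carry no mass and must not be counted in the support. *)
Definition active_edge k : set V := [set x | th k != 0 /\ closed_segment (P k) (P k.+1) x].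
Definition poly_set : set V := Omega `&` \bigcup_(k in `I_m) active_edge k.

Lemma edge_dirE k : P k + edge_dir k = P k.+1.
Proof. by rewrite /edge_dir addrC subrK. Qed.

Lemma det2_line (a d : V) s t r : det2 (line a d s) (line a d t) (line a d r) = 0.
Proof. rewrite /det2 /line !mxE; ring. Qed.

Lemma gen_eq i j k : (i < m.+3)%N -> (j < m.+3)%N -> (k < m.+3)%N ->
  i != j -> det2 (P i) (P j) (P k) = 0 -> k = i \/ k = j.
Proof.
move=> im jm km ij h.
have [->|ki] := eqVneq k i; first by left.
have [->|kj] := eqVneq k j; first by right.
have := gen im jm km ij; rewrite eq_sym ki eq_sym kj h eqxx => H.
by have := H isT isT.
Qed.

Lemma edge_dir_neq0 k : (k < m)%N -> edge_dir k != 0.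
Proof.
move=> km; apply/eqP => h.
have := @gen k k.+1 k.+2.
have -> : (k < m.+3)%N by lia.
have -> : (k.+1 < m.+3)%N by lia.
have -> : (k.+2 < m.+3)%N by lia.
move=> /(_ isT isT isT); have -> : k != k.+1 by lia.
have -> : k != k.+2 by lia.
have -> : P k.+1 = P k by apply/eqP; rewrite -subr_eq0 -/(edge_dir k) h.
by rewrite /det2 subrr !mxE mul0r mulr0 subrr eqxx => /(_ isT isT isT).
Qed.

(** If the lines of two edges shared two points they would coincide, and an end of one edge would be
aligned with both ends of the other. *)
Lemma lines_meet k l s t s' t' : (k < m)%N -> (l < m)%N -> k != l ->
  edge_line k s = edge_line l s' -> edge_line k t = edge_line l t' -> s = t.
Proof.
move=> km lm kl e1 e2; apply/eqP; apply: contraNT kl => st.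
have D1 : (t - s) *: edge_dir k = (t' - s') *: edge_dir l.
  rewrite !scalerBl; apply/(addrI (P k + s *: edge_dir k)).
  have -> : P k + s *: edge_dir k + (t *: edge_dir k - s *: edge_dir k) = edge_line k t.
    by rewrite /edge_line /line; apply/rowP => i; rewrite !mxE; ring.
  rewrite e2 -[P k + _]/(edge_line k s) e1 /edge_line /line.
  by apply/rowP => i; rewrite !mxE; ring.
have st' : t' - s' != 0.
  apply/eqP => h; move: D1; rewrite h scale0r => /eqP; rewrite scaler_eq0.
  by rewrite (negbTE (edge_dir_neq0 km)) orbF subr_eq0 eq_sym (negbTE st).
pose r := (t - s) / (t' - s').
have Dl : edge_dir l = r *: edge_dir k.
  by rewrite /r mulrC -scalerA D1 scalerA mulVf// scale1r.
have Pl : P l = edge_line k (s - s' * r).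
  have : P l + s' *: edge_dir l = edge_line k s by rewrite e1.
  rewrite Dl => /(congr1 (fun v => v - s' *: (r *: edge_dir k))); rewrite addrK => ->.
  by rewrite /edge_line /line; apply/rowP => i; rewrite !mxE; ring.
have Pl1 : P l.+1 = edge_line k (s - s' * r + r).
  have -> : P l.+1 = P l + edge_dir l by rewrite /edge_dir addrC subrK.
  by rewrite Dl Pl /edge_line /line; apply/rowP => i; rewrite !mxE; ring.
have Pk : P k = edge_line k 0 by rewrite /edge_line /line scale0r addr0.
have Pk1 : P k.+1 = edge_line k 1 by rewrite /edge_line /line scale1r /edge_dir addrC subrK.
have kk : k != k.+1 by lia.
have h1 : det2 (P k) (P k.+1) (P l) = 0 by rewrite Pl Pk1 {1}Pk det2_line.
have h2 : det2 (P k) (P k.+1) (P l.+1) = 0 by rewrite Pl1 Pk1 {1}Pk det2_line.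
have H1 : l = k \/ l = k.+1 by apply: (gen_eq _ _ _ kk h1); lia.
have H2 : l.+1 = k \/ l.+1 = k.+1 by apply: (gen_eq _ _ _ kk h2); lia.
by apply/eqP; lia.
Qed.

Lemma active_edge_pt k x : active_edge k x -> exists2 s, 0 <= s <= 1 & x = edge_line k s.
Proof. by move=> [_ [s + <-]]; rewrite /= in_itv /= => s01; exists s. Qed.

Lemma closed_active_edge k : closed (active_edge k).
Proof.
have [E0|thk] := eqVneq (th k) 0.
  have -> : active_edge k = set0; last exact: closed0.
  by apply/seteqP; split => // x [/eqP].
have -> : active_edge k = edge_line k @` `[0, 1].
  by apply/seteqP; split => [x [_]//|x h]; split.
apply: compact_closed; first exact: norm_hausdorff.
apply: continuous_compact; last exact: segment_compact.
by apply: continuous_subspaceT; exact: line_continuous.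
Qed.

Lemma borel_active_edge k : measurable (active_edge k : set (borelR3 R)).
Proof. by apply: closed_borel; exact: closed_active_edge. Qed.

Lemma borel_poly_set : measurable (poly_set : set (borelR3 R)).
Proof.
apply: measurableI; first exact: sub_sigma_algebra.
by apply: fin_bigcup_measurable => // k _; exact: borel_active_edge.
Qed.

Local Open Scope ereal_scope.

Lemma closed_point (x : V) : closed [set x].
Proof. by apply: compact_closed; [exact: norm_hausdorff|exact: compact_set1]. Qed.

Lemma lebesgue_sub1 (A : set R) : (forall s t, A s -> A t -> s = t) -> lebesgue_measure A = 0.
Proof.
move=> H; have [->|/set0P[s As]] := eqVneq A set0; first by rewrite measure0.
have -> : A = [set s]; last by rewrite lebesgue_measure_set1.
by apply/seteqP; split => [t At|t ->//]; exact: H.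
Qed.

Lemma H1_point (x : V) : H1 ([set x] : set (hauR3 R)) = 0.
Proof.
have d0 : (const_mx 1%R : V) != 0%R.
  by apply/eqP => /rowP/(_ ord0); rewrite !mxE => /eqP; rewrite oner_eq0.
have := @H1_line R x (const_mx 1%R) d0 [set x] (closed_borel (@closed_point x)).
have -> : [set x] `&` range (line x (const_mx 1%R)) = [set x].
  by apply/seteqP; split => [y []//|y ->]; split => //; exists 0%R; rewrite // /line scale0r addr0.
move=> ->; rewrite lebesgue_sub1 ?mule0// => s t /=.
rewrite /line => /eqP; rewrite addrC -subr_eq0 addrK scaler_eq0 (negbTE d0) orbF => /eqP ->.
by move=> /eqP; rewrite addrC -subr_eq0 addrK scaler_eq0 (negbTE d0) orbF => /eqP ->.
Qed.

(** At these points at most one edge passes, and it passes in its interior. They have full H^1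
measure because the vertices and the crossings form a finite set. *)
Definition generic_pt (x : V) := (forall k, (k <= m)%N -> x <> P k) /\
  forall k l, (k < m)%N -> (l < m)%N -> k != l -> range (edge_line k) x -> ~ range (edge_line l) x.

Lemma ae_generic_pt : {ae (@H1 R), forall x : hauR3 R, generic_pt x}.
Proof.
have nP k : (@H1 R).-negligible ([set P k] : set (hauR3 R)).
  apply/negligibleP; last exact: H1_point.
  by apply: borel_caratheodory; apply: closed_borel; exact: closed_point.
have nX k l : (@H1 R).-negligible
    ([set x | [/\ (k < m)%N, (l < m)%N, k != l, range (edge_line k) x & range (edge_line l) x]] : set (hauR3 R)).
  have [h|h] := boolP [&& (k < m)%N, (l < m)%N & k != l]; last first.
    apply: negligibleS (negligible_set0 _) => x [a b c _ _].
    by move: h; rewrite a b c.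
  have /and3P[km lm kl] := h.
  suff : (@H1 R).-negligible (range (edge_line l) `&` range (edge_line k) : set (hauR3 R)).
    by apply: negligibleS => x [].
  have ml : measurable (range (edge_line l) : set (borelR3 R)).
    by apply: closed_borel; apply: closed_line; exact: edge_dir_neq0.
  apply/negligibleP.
    apply: borel_caratheodory; apply: measurableI => //.
    by apply: closed_borel; apply: closed_line; exact: edge_dir_neq0.
  apply: (eq_trans (@H1_line R (P k) (edge_dir k) (edge_dir_neq0 km) _ ml)).
  rewrite lebesgue_sub1 ?mule0// => s t [s' _ e1] [t' _ e2].
  by apply: (lines_meet km lm kl); [exact/esym/e1|exact/esym/e2].
have := negligibleU (negligible_bigcup nP)
   (negligible_bigcup (fun k => negligible_bigcup (nX k))).
apply: negligibleS => x /= ng; apply: contrapT => h; apply: ng; split.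
  by move=> k km xP; apply: h; left; exists k.
by move=> k l km lm kl rk rl; apply: h; right; exists k => //; exists l.
Qed.

(** A function equal to c k on the edge k, up to the crossings; being a finite sum of indicators it
is measurable and easy to integrate. *)
Definition edge_comb (c : nat -> R) (x : V) : R := (\sum_(k < m) c k * \1_(active_edge k) x)%R.

Lemma edge_comb_generic_pt c x k : generic_pt x -> (k < m)%N -> active_edge k x -> edge_comb c x = c k.
Proof.
move=> [_ gx] km Ex; rewrite /edge_comb (bigD1 (Ordinal km))//= indicE mem_set// mulr1.
rewrite big1 ?addr0// => l lk; rewrite indicE memNset ?mulr0// => El.
have [s _ xs] := active_edge_pt Ex; have [t _ xt] := active_edge_pt El.
apply: (gx k l km (ltn_ord l)); first by rewrite eq_sym.
  by exists s.
by exists t.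
Qed.

Lemma measurable_edge_comb (D : set (hauR3 R)) c : measurable_fun D (edge_comb c : hauR3 R -> R).
Proof.
apply: measurable_sum => k; apply: measurable_funM => //; apply: measurable_indic.
exact: borel_caratheodory (borel_active_edge k).
Qed.

Lemma edge_comb_bounded c x : (`|edge_comb c x| <= \sum_(k < m) `|c k|)%R.
Proof.
apply: (le_trans (ler_norm_sum _ _ _)); apply: ler_sum => k _.
rewrite normrM ler_piMr// indicE; case: (_ \in _); by rewrite ?normr1 ?normr0.
Qed.

Lemma H1_active_edge (A : set (borelR3 R)) k : measurable A -> (k < m)%N ->
  H1 ((A `&` Omega `&` active_edge k) : set (hauR3 R)) =
  if th k == 0%R then 0 else
  (enorm (edge_dir k))%:E * lebesgue_measure (inner_par Omega (P k) (P k.+1) `&` seg (P k) (P k.+1) @^-1` A).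
Proof.
move=> mA km; case: eqP => [thk|/eqP thk].
  have -> : active_edge k = set0 by apply/seteqP; split => // x [/eqP].
  by rewrite setI0 measure0.
have mAE : measurable (A `&` Omega `&` active_edge k : set (borelR3 R)).
  by apply: measurableI; [apply: measurableI => //; exact: sub_sigma_algebra|exact: borel_active_edge].
have := @H1_line R (P k) (edge_dir k) (edge_dir_neq0 km) _ mAE.
have -> : A `&` Omega `&` active_edge k `&` range (line (P k) (edge_dir k)) = A `&` Omega `&` active_edge k.
  apply/seteqP; split => [x []//|x h]; split => //.
  by have [_ /active_edge_pt[s _ ->]] := h; exists s.
move=> ->; congr (_ * lebesgue_measure _).
apply/seteqP; split => s /=.
  move=> [[As Os] [_ [t t01]]]; rewrite -[RHS]/(line (P k) (edge_dir k) s).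
  move=> /(congr1 (lproj (P k) (edge_dir k))).
  rewrite -[X in lproj _ _ X]/(line (P k) (edge_dir k) t) !lproj_line ?edge_dir_neq0// => ts.
  by subst t; split; [split|].
by move=> [[s01 Os] As]; split => //; split => //; exists s.
Qed.

Lemma H1_poly_set_fin : H1 (poly_set : set (hauR3 R)) < +oo.
Proof.
have mE k : measurable (active_edge k : set (hauR3 R)) := borel_caratheodory (borel_active_edge k).
apply: (@le_lt_trans _ _ (\sum_(k < m) H1 (Omega `&` active_edge k : set (hauR3 R)))).
  have mU k : measurable (Omega `&` active_edge k : set (hauR3 R)).
    by apply: measurableI => //; apply: borel_caratheodory; exact: sub_sigma_algebra.
  apply: (@le_trans _ _ (H1 (\big[setU/set0]_(k < m) (Omega `&` active_edge k) : set (hauR3 R)))).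
    apply: le_outer_measure => x [Ox [k /= km Ex]].
    by rewrite -(bigcup_mkord m (fun k => Omega `&` active_edge k)); exists k.
  exact: (@Boole_inequality _ _ _ (@H1 R) (fun k => Omega `&` active_edge k)).
apply: lte_sum_pinfty => k _.
have := H1_active_edge measurableT (ltn_ord k); rewrite setTI => ->.
case: ifP => // _; rewrite lte_mul_pinfty// ?lee_fin ?enorm_ge0//.
rewrite preimage_setT setIT.
apply: (@le_lt_trans _ _ (lebesgue_measure (`[0%R, 1%R]%classic : set R))).
  apply: le_measure; rewrite ?inE//; first exact: measurable_inner_par.
  by move=> t [].
by rewrite lebesgue_measure_itv /= lte01 oppr0 adde0 ltry.
Qed.

Lemma integral_edge_comb (A : set (borelR3 R)) c : measurable A ->
  \int[H1]_(x in (A `&` poly_set : set (hauR3 R))) (edge_comb c x)%:E =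
  \sum_(k < m) (c k)%:E * H1 ((A `&` Omega `&` active_edge k) : set (hauR3 R)).
Proof.
move=> mA.
have mE k : measurable (active_edge k : set (hauR3 R)) := borel_caratheodory (borel_active_edge k).
have mAg : measurable (A `&` poly_set : set (hauR3 R)).
  by apply: borel_caratheodory; apply: measurableI => //; exact: borel_poly_set.
have fin : H1 (A `&` poly_set : set (hauR3 R)) < +oo.
  by apply: le_lt_trans H1_poly_set_fin; apply: le_outer_measure => x [].
rewrite /edge_comb; under eq_integral do rewrite -sumEFin.
have ii (k : 'I_m) : (@H1 R).-integrable (A `&` poly_set : set (hauR3 R)) (fun x => (\1_(active_edge k) x)%:E).
  have mi : measurable_fun (A `&` poly_set : set (hauR3 R)) (\1_(active_edge k) : hauR3 R -> R).
    exact: measurable_indic.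
  apply: (measurable_bounded_integrable mAg fin mi).
  exists 1%R; split; first exact: num_real.
  move=> M M1 x _ /=; rewrite indicE; case: (_ \in _); rewrite ?normr1 ?normr0 ltW//.
  exact: lt_trans M1.
rewrite integral_sum//; last first.
  by move=> k; under eq_fun do rewrite EFinM; exact: integrableZl.
apply: eq_bigr => k _; under eq_integral do rewrite EFinM.
rewrite integralZl//; congr (_ * _); rewrite integral_indic//; congr (@H1 R _).
apply/seteqP; split => x; first by move=> [Ek [Ax [Ox _]]].
by move=> [[Ax Ox] Ek]; split => //; split => //; split => //; exists k => //=.
Qed.

End polyline.

(** * The measure carried by a polyline *)

Section polyline_measure.
Context {R : realType} {N : nat}.
Local Notation V := 'rV[R]_3.
Context (Omega : set V) (Omega_open : open Omega).
Context (m : nat) (P : nat -> V) (th : nat -> 'rV[R]_N).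
Hypothesis gen : forall i j k, (i < m.+3)%N -> (j < m.+3)%N -> (k < m.+3)%N ->
  i != j -> i != k -> j != k -> det2 (P i) (P j) (P k) != 0.
Hypothesis thQ : forall k, (k < m)%N -> calQ (th k).

Local Notation edge_dir := (edge_dir P).
Local Notation edge_line := (edge_line P).
Local Notation active_edge := (active_edge P th).
Local Notation poly_set := (poly_set Omega m P th).
Local Notation edge_comb := (edge_comb m P th).
Local Notation generic_pt := (generic_pt m P).

Definition edge_tan k : V := (enorm (edge_dir k))^-1 *: edge_dir k.
Definition tau (x : V) : V := \row_j edge_comb (fun k => edge_tan k 0 j) x.
Definition theta (x : V) : 'rV[R]_N := \row_i edge_comb (fun k => th k 0 i) x.

Let en_gt0 k : (k < m)%N -> 0 < enorm (edge_dir k).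
Proof. by move=> km; apply: enorm_gt0; exact: (edge_dir_neq0 gen). Qed.

Lemma enorm_edge_tan k : (k < m)%N -> enorm (edge_tan k) = 1.
Proof.
move=> km; rewrite /edge_tan enormZ ger0_norm ?invr_ge0 ?enorm_ge0//.
by rewrite mulVf// gt_eqF ?en_gt0.
Qed.

(** A generic point of an edge has positive distance from the other edges, from the ends of its own
edge and from the complement of Omega. *)
Lemma local_line k x : (k < m)%N -> active_edge k x -> generic_pt x -> Omega x ->
  exists2 e : R, 0 < e & forall y, `|y - x| < e -> poly_set y <-> range (edge_line k) y.
Proof.
move=> km Ex [gP gX] Ox.
have [s /andP[s0 s1] xs] := active_edge_pt Ex.
have {}s0 : 0 < s.
  rewrite lt_neqAle s0 andbT; apply/eqP => h; apply: (gP k (ltnW km)).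
  by rewrite xs -h /edge_line /line scale0r addr0.
have {}s1 : s < 1.
  rewrite lt_neqAle s1 andbT; apply/eqP => h; apply: (gP k.+1 km).
  by rewrite xs h /edge_line /line scale1r edge_dirE.
have [e1 e10 He1] : exists2 e : R, 0 < e & forall y, `|y - x| < e -> Omega y.
  have /nbhs_ballP[e /= e0 He] := open_nbhs_nbhs (conj Omega_open Ox).
  by exists e => // y yx; apply: He; rewrite -ball_normE /= distrC.
have [e2 e20 He2] : exists2 e : R, 0 < e & forall l : 'I_m, l != k :> nat ->
    forall y, `|y - x| < e -> ~ active_edge l y.
  apply: (@fin_pos_min R _ (fun (l : 'I_m) e => l != k :> nat ->
    forall y, `|y - x| < e -> ~ active_edge l y)).
    by move=> l a b ba H lk y yx; apply: H => //; exact: lt_le_trans ba.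
  move=> l; have [lk|lk] := eqVneq (l : nat) k; first by exists 1.
  have nEl : (~` active_edge l) x.
    move=> El; have [t _ xt] := active_edge_pt El.
    apply: (gX k l km (ltn_ord l)); first by rewrite eq_sym.
      by exists s.
    by exists t.
  have oE : open (~` active_edge l) by apply: closed_openC; exact: closed_active_edge.
  have /nbhs_ballP[e /= e0 He] := open_nbhs_nbhs (conj oE nEl).
  by exists e => // _ y yx; apply: He; rewrite -ball_normE /= distrC.
have d0 : edge_dir k != 0 by exact: (edge_dir_neq0 gen).
(* A Lipschitz constant of the projection to the parameter of the line. *)
pose c := 2 / enorm (edge_dir k).
have c0 : 0 < c by rewrite divr_gt0// en_gt0.
exists (Num.min (Num.min e1 e2) (Num.min s (1 - s) / c)).
  by rewrite !lt_min e10 e20 divr_gt0// lt_min s0 subr_gt0.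
move=> y; rewrite !lt_min => /andP[/andP[y1 y2]]; rewrite ltr_pdivlMr// mulrC lt_min => /andP[y3 y4].
split => [[Oy [l /= lm Ey]]|[t _ ty]].
  have [lk|lk] := eqVneq l k; first by have [t _ ->] := active_edge_pt Ey; exists t; rewrite // lk.
  by have := He2 (Ordinal lm) lk y y2.
split; first exact: He1.
exists k => //; split; first by case: Ex.
exists t => //=; rewrite in_itv /=.
have := @lproj_sup_lip R (P k) (edge_dir k) d0 y x.
rewrite xs -ty !lproj_line// => ts.
have {ts} : `|t - s| <= c * `|y - x| by rewrite xs -ty.
rewrite ler_norml => /andP[h1 h2].
by apply/andP; split; lra.
Qed.

(** For small rho the support of the rescaled test function meets the polyline only where it is a
line, so the rescaled integral does not depend on rho any more. *)
Lemma tangent_at k x : (k < m)%N -> active_edge k x -> generic_pt x -> Omega x -> approx_tangent poly_set x (edge_tan k).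
Proof.
move=> km Ex gx Ox; split; first exact: enorm_edge_tan.
move=> phi cphi sphi.
have [e e0 He] := local_line km Ex gx Ox.
have [C C0 HC] : exists2 C : R, 0 < C & forall y, phi y != 0 -> `|y| <= C.
  have [M [_ H]] := compact_bounded sphi.
  exists (`|M| + 1) => [|y py]; first by rewrite ltr_wpDl.
  by apply: (H (`|M| + 1)); [rewrite ltr_pwDr// ler_norm|exact: subset_fsupport].
have [s _ xs] := active_edge_pt Ex.
set F := (X in X @ _ --> _).
suff H : \forall rho \near 0^'+, \int[lebesgue_measure]_s phi (s *: edge_tan k) = F rho.
  apply: cvg_trans (near_eq_cvg H) _; exact: cvg_cst.
rewrite /F; near=> rho.
have r0 : 0 < rho by near: rho; exact: nbhs_right_gt.
have re : rho * C < e.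
  by rewrite -ltr_pdivlMr//; near: rho; apply: nbhs_right_lt; rewrite divr_gt0.
pose d := rho *: edge_tan k.
have d0 : d != 0.
  rewrite /d scaler_eq0 negb_or gt_eqF//= /edge_tan scaler_eq0 negb_or invr_eq0 gt_eqF ?en_gt0//=.
  exact: (edge_dir_neq0 gen).
(* Parametrising the line from x with speed rho turns the blow-up into a change of variables. *)
have rng : range (line x d) = range (edge_line k).
  pose c := rho / enorm (edge_dir k).
  have c0 : c != 0 by rewrite mulf_neq0 ?invr_eq0 ?gt_eqF ?en_gt0.
  have lE t : line x d t = edge_line k (s + t * c).
    by rewrite xs /edge_line /line /d /edge_tan; apply/rowP => i; rewrite !mxE /c; ring.
  apply/seteqP; split => [_ [t _ <-]|_ [t _ <-]]; first by rewrite lE; exists (s + t * c).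
  by exists ((t - s) / c) => //; rewrite lE divfK// addrC subrK.
pose g (y : V) : \bar R := (phi (rho^-1 *: (y - x)))%:E.
have cg : continuous (fun y : V => phi (rho^-1 *: (y - x))).
  move=> y; apply: (@continuous_comp _ _ _ (fun y : V => rho^-1 *: (y - x)) phi); last exact: cphi.
  move=> U /nbhs_ballP[r /= rr0 Hr]; apply/nbhs_ballP.
  exists (rho * r) => /=; first by rewrite mulr_gt0.
  move=> z; rewrite -ball_normE /= => yz; apply: Hr; rewrite -ball_normE /=.
  rewrite -scalerBr opprB addrA subrK normrZ gtr0_norm ?invr_gt0//.
  by rewrite mulrC ltr_pdivrMr// mulrC.
have mg : measurable_fun [set: borelR3 R] g by apply/measurable_EFinP; exact: continuous_borel.
have I1 : (\int[H1]_(y in (poly_set : set (hauR3 R))) g y =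
    \int[H1]_(y in (setT `&` range (line x d) : set (hauR3 R))) g y)%E.
  rewrite integral_mkcond [RHS]integral_mkcond; apply: eq_integral => y _.
  rewrite /patch setTI rng.
  have [yx|yx] := ltP `|y - x| e.
    have := He y yx => H.
    by case: ifPn => [/set_mem/H h|/negP h]; [rewrite mem_set|rewrite memNset// => /H gy; apply: h; rewrite inE].
  have -> : g y = 0%E; last by case: ifP; case: ifP.
  congr (_%:E); apply/eqP; apply: contraTT yx => /HC.
  rewrite normrZ gtr0_norm ?invr_gt0// mulrC ler_pdivrMr// mulrC => h.
  by rewrite -ltNge; exact: le_lt_trans re.
rewrite /Rintegral -/g [in RHS]I1 (integral_line x d0 measurableT mg).
have -> : enorm d = rho by rewrite /d enormZ enorm_edge_tan// mulr1 gtr0_norm.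
rewrite preimage_setT.
have -> : (\int[lebesgue_measure]_s0 g (line x d s0) = \int[lebesgue_measure]_s0 (phi (s0 *: edge_tan k))%:E)%E.
  apply: eq_integral => t _; congr (phi _)%:E.
  rewrite /line /d; move: (edge_tan k) => v; apply/rowP => i; rewrite !mxE.
  by field; rewrite gt_eqF.
case: (\int[lebesgue_measure]_s0 _)%E => [r| |] /=.
- by rewrite mulrA mulVf ?gt_eqF// mul1r.
- by rewrite gt0_muley ?lte_fin//= mulr0.
- by rewrite gt0_muleNy ?lte_fin//= mulr0.
Unshelve. all: by end_near.
Qed.

Lemma tau_generic_pt k x : (k < m)%N -> active_edge k x -> generic_pt x -> tau x = edge_tan k.
Proof. by move=> km Ex gx; apply/rowP => j; rewrite mxE (edge_comb_generic_pt _ gx km Ex). Qed.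

Lemma theta_generic_pt k x : (k < m)%N -> active_edge k x -> generic_pt x -> theta x = th k.
Proof. by move=> km Ex gx; apply/rowP => j; rewrite mxE (edge_comb_generic_pt _ gx km Ex). Qed.

Lemma ae_generic_ptS (Q : V -> Prop) : (forall x, generic_pt x -> Q x) ->
  {ae (@H1 R), forall x : hauR3 R, Q x}.
Proof.
move=> H; have := ae_generic_pt gen.
by apply: negligibleS => x nQ gx; apply: nQ; exact: H.
Qed.

Lemma poly_set_rectifiable : rectifiable1 poly_set.
Proof.
split.
- by apply: borel_caratheodory; exact: borel_poly_set.
- exact: (H1_poly_set_fin Omega_open _ gen).
exists (fun n => edge_line n); split.
  move=> n; exists `|edge_dir n|; split; first exact: num_real.
  move=> M MM [s t] _ /=.
  rewrite /edge_line /line opprD addrACA subrr add0r -scalerBl normrZ mulrC ler_wpM2r//.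
  exact: ltW.
rewrite (_ : _ `\` _ = set0) ?measure0//.
apply/seteqP; split => // x [[_ [k /= km Ex]]]; apply.
by have [s _ ->] := active_edge_pt Ex; exists k => //; exists s.
Qed.

(** The sum of the edge measures, weighted by th k and by the directions of the edges. Almost every
point of the polyline is generic, so that there the density is th k and the tangent is the
direction of the unique edge. The support is exactly the union of the active edges: a
neighbourhood of a point of an edge meets this edge in positive length and all the others in
finitely many of its points, so no cancellation can occur. *)
Lemma polyline_measure : exists mu : mxcharge R N,
  [/\ M1 Omega calQ mu, polyhedral Omega mu &
    forall f, bounded_borel f -> (forall x, ~ Omega x -> f x = 0) -> forall i j,
      charge_integral (mu i j) f = \sum_(k < m) th k 0 i * edge_int f j (P k) (P k.+1)].
Proof.
have /choice[es Hes] k := edge_measure Omega_open (P k) (P k.+1).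
have /choice[mu1 Hmu1] (ij : 'I_N * 'I_3) :=
  lin_charge (index_enum 'I_m) (fun k : 'I_m => th k 0 ij.1 * edge_dir k 0 ij.2) (fun k : 'I_m => es k).
pose mu : mxcharge R N := fun i j => mu1 (i, j).
have muE i j (A : set (borelR3 R)) : measurable A ->
    (mu i j A = \sum_(k < m) (th k 0 i * edge_dir k 0 j)%:E * es k A)%E.
  by move=> mA; have [H _] := Hmu1 (i, j); rewrite H.
have esE k A : es k A = lebesgue_measure (inner_par Omega (P k) (P k.+1) `&` seg (P k) (P k.+1) @^-1` A).
  by have [H _] := Hes k; rewrite H.
exists mu; split.
- split.
    move=> i j A mA AO; rewrite muE// big1// => k _; rewrite esE.
    rewrite (_ : _ `&` _ = set0) ?measure0 ?mule0//.
    apply/seteqP; split => // t [[_ Ot] At].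
    by have : (A `&` Omega) (seg (P k) (P k.+1) t) by []; rewrite AO.
  exists poly_set, tau, theta; split.
  + by split; [move=> x []|exact: poly_set_rectifiable].
  + split=> [j|].
      rewrite (_ : (fun x => _) = edge_comb (fun k => edge_tan k 0 j)); first exact: measurable_edge_comb.
      by apply/funext => x; rewrite mxE.
    apply: ae_generic_ptS => x gx [Ox [k km Ex]].
    by rewrite (tau_generic_pt km Ex gx); exact: tangent_at.
  + move=> i; rewrite (_ : (fun x => _) = EFin \o edge_comb (fun k => th k 0 i)); last first.
      by apply/funext => x; rewrite /= mxE.
    apply: measurable_bounded_integrable.
    * by apply: borel_caratheodory; exact: borel_poly_set.
    * exact: (H1_poly_set_fin Omega_open _ gen).
    * exact: measurable_edge_comb.
    exists (\sum_(k < m) `|th k 0 i|); split; first exact: num_real.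
    by move=> M sM x _ /=; apply: le_trans (edge_comb_bounded _ _ _ _ _) (ltW sM).
  + apply: ae_generic_ptS => x gx [Ox [k km Ex]].
    by rewrite (theta_generic_pt km Ex gx); exact: thQ.
  move=> i j A mA; rewrite muE//.
  pose c k := th k 0 i * edge_tan k 0 j.
  transitivity (\int[H1]_(x in (A `&` poly_set : set (hauR3 R))) (edge_comb c x)%:E)%E; last first.
    apply: ae_eq_integral.
    * by apply: borel_caratheodory; apply: measurableI => //; exact: borel_poly_set.
    * by apply/measurable_EFinP; exact: measurable_edge_comb.
    * apply/measurable_EFinP; apply: measurable_funM.
        rewrite (_ : (fun x => _) = edge_comb (fun k => th k 0 i)); first exact: measurable_edge_comb.
        by apply/funext => x; rewrite mxE.
      rewrite (_ : (fun x => _) = edge_comb (fun k => edge_tan k 0 j)); first exact: measurable_edge_comb.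
      by apply/funext => x; rewrite mxE.
    apply: ae_generic_ptS => x gx [_ [Ox [k km Ex]]].
    by rewrite (edge_comb_generic_pt _ gx km Ex) (theta_generic_pt km Ex gx) (tau_generic_pt km Ex gx).
  rewrite (integral_edge_comb Omega_open _ gen)//; apply: eq_bigr => k _.
  rewrite (H1_active_edge Omega_open _ gen)//; case: eqP => [thk|_].
    by rewrite /c thk mxE !mul0r !mul0e.
  rewrite esE muleA -EFinM; congr ((_)%:E * _)%E.
  rewrite /c; have -> : edge_tan k 0 j = (enorm (edge_dir k))^-1 * edge_dir k 0 j by rewrite /edge_tan mxE.
  by field; rewrite gt_eqF// en_gt0.
- pose s := [seq (P k, P k.+1) | k <- iota 0 m & th k != 0].
  exists s; split.
    apply/allP => q /mapP[k]; rewrite mem_filter mem_iota add0n /= => /andP[_ km] ->.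
    by have := edge_dir_neq0 gen km; rewrite /= subr_eq0 eq_sym.
  apply/seteqP; split => x.
    move=> [Ox H]; split => //; apply: contrapT => nx.
    have nE k : (k < m)%N -> ~ active_edge k x.
      move=> km [thk sx]; apply: nx; exists (P k, P k.+1) => //=.
      by apply/mapP; exists k => //; rewrite mem_filter thk mem_iota.
    pose W := ~` \bigcup_(k in `I_m) active_edge k.
    have oW : open W.
      apply: closed_openC; apply: closed_bigcup => //.
      by move=> k _; exact: closed_active_edge.
    have Wx : W x by move=> [k /= km Ek]; exact: (nE k km Ek).
    have [i [j [A [mA AW]]]] := H W oW Wx.
    apply/negP; rewrite negbK muE// big1// => k _.
    have [thk|thk] := eqVneq (th k) 0; first by rewrite thk mxE mul0r mul0e.
    rewrite esE (_ : _ `&` _ = set0) ?measure0 ?mule0//.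
    apply/seteqP; split => // t [[t01 Ot] At]; apply: (AW _ At).
    by exists k; [exact: ltn_ord|split => //; exists t].
  move=> [Ox [q /= /mapP[k]]]; rewrite mem_filter mem_iota add0n => /andP[thk /= km] -> /= sx.
  split => // W oW Wx.
  have [i thi] : exists i, th k 0 i != 0.
    apply: contrapT => /forallNP h; move/eqP: thk; apply; apply/rowP => i.
    by rewrite mxE; apply/eqP/negPn/negP; exact: h.
  have [j dj] : exists j, edge_dir k 0 j != 0.
    apply: contrapT => /forallNP h; have := edge_dir_neq0 gen km; move/eqP; apply; apply/rowP => j.
    by rewrite [RHS]mxE; apply/eqP/negPn/negP; exact: h.
  (* Restricting the neighbourhood to the edge k isolates its contribution. *)
  pose A : set (borelR3 R) := W `&` Omega `&` active_edge k.
  have mA : measurable A.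
    by apply: measurableI; [apply: measurableI; exact: sub_sigma_algebra|exact: borel_active_edge].
  exists i, j, A; split => //; first by move=> y [[]].
  rewrite muE// (bigD1 (Ordinal km))//= big1 ?adde0 => [|l lk]; last first.
    rewrite esE lebesgue_sub1 ?mule0// => t t' [_ [_ Et]] [_ [_ Et']].
    have [r _ er] := active_edge_pt Et; have [r' _ er'] := active_edge_pt Et'.
    by apply: (lines_meet gen (ltn_ord l) km _ er er').
  have es0 : (0 < es k A)%E.
    rewrite esE; have [s0 + xs] := sx; rewrite /= in_itv /= => s01.
    have oWO : open (seg (P k) (P k.+1) @^-1` (W `&` Omega)).
      have oI : open (W `&` Omega) by exact: openI.
      by move/continuousP : (@seg_continuous R (P k) (P k.+1)); exact.
    have /nbhs_ballP[r /= r0 Hr] : nbhs s0 (seg (P k) (P k.+1) @^-1` (W `&` Omega)).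
      by apply: open_nbhs_nbhs; split => //; rewrite /= /seg xs.
    (* s0 may be an end of [0, 1]: one of the two sides of it is used below. *)
    have sub a b : 0 <= a -> b <= 1 -> s0 - r <= a -> b <= s0 + r -> a < b ->
        (0 < lebesgue_measure (inner_par Omega (P k) (P k.+1) `&` seg (P k) (P k.+1) @^-1` A))%E.
      move=> a0 b1 ar br ab; apply: (@lt_le_trans _ _ (lebesgue_measure (`]a, b[%classic : set R))).
        by rewrite lebesgue_measure_itv /= lte_fin ab -EFinB lte_fin subr_gt0.
      apply: le_measure; rewrite ?inE//.
        apply: measurableI; first exact: measurable_inner_par.
        by rewrite -[X in measurable X]setTI; exact: (@line_measurable R (P k) (P k.+1 - P k)).
      move=> t /=; rewrite in_itv /= => /andP[at' tb].
      have t01 : 0 <= t <= 1 by apply/andP; split; lra.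
      have [Wt Ot] : (W `&` Omega) (seg (P k) (P k.+1) t).
        apply: Hr; rewrite /ball /= ltr_norml; apply/andP; split; lra.
      split; first by split => //=; rewrite in_itv.
      by split => //; split => //; exists t => //=; rewrite in_itv.
    move: s01 => /andP[s00 s11]; have [h|h] := ltP s0 1.
      apply: (@sub s0 (Num.min 1 (s0 + r))); rewrite ?ge_min ?lexx ?orbT//; first by lra.
      by rewrite lt_min h ltrDl.
    apply: (@sub (Num.max 0 (s0 - r)) s0); rewrite ?le_max ?lexx ?orbT//; first by lra.
    by rewrite gt_max; apply/andP; split; lra.
  by rewrite mule_neq0// ?eqe ?mulf_neq0// gt_eqF.
move=> f bf fO i j; have [_ H] := Hmu1 (i, j); rewrite H//.
apply: eq_bigr => k _; have [_ Hk] := Hes k.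
by rewrite Hk// /edge_int mulrA.
Qed.

End polyline_measure.

(** * Integral of a gradient along a segment *)

Section edge_gradient.
Context {R : realType}.
Local Notation V := 'rV[R]_3.
Implicit Types (phi : V -> R) (a b x y v : V).

Lemma coord_mvt phi j x (s : R) : (forall y, derivable phi y (unitv j)) ->
  exists2 c : R, `|c| <= `|s| & phi (x + s *: unitv j) - phi x = s * partial j phi (x + c *: unitv j).
Proof.
move=> dphi.
pose g t : R := phi (x + t *: unitv j).
have dg (t : R) : is_derive t (1 : R) g (partial j phi (x + t *: unitv j)).
  have H : is_derive (x + t *: unitv j) (unitv j) phi (partial j phi (x + t *: unitv j)).
    exact/derivableP.
  have := line_is_derive H; rewrite /g => -[h1 h2].
  have E : (fun h : R => h^-1 *: ((g \o shift t) (h *: (1 : R)) - g t)) =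
     (fun h : R => h^-1 *: (((fun h : R => phi (h *: unitv j + (x + t *: unitv j))) \o shift 0) (h *: (1 : R))
        - phi (0 *: unitv j + (x + t *: unitv j)))).
    apply/funext => h; rewrite /g /= scale0r add0r; congr (_ *: (phi _ - phi _)).
    by apply/rowP => i; rewrite !mxE /GRing.scale /=; ring.
  by split; [rewrite /derivable E|rewrite -h2 /derive E].
have [s0|s0|->] := ltgtP s 0.
- have [c /andP[c1 c2] E] := der_mvt dg s0.
  exists c; first by rewrite !ltr0_norm// lerN2 ltW.
  by move: E; rewrite /g scale0r addr0 sub0r mulrN => E; rewrite -[LHS]opprB E opprK mulrC.
- have [c /andP[c1 c2] E] := der_mvt dg s0.
  exists c; first by rewrite !gtr0_norm// ltW.
  by move: E; rewrite /g scale0r addr0 subr0 mulrC.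
by exists 0 => //; rewrite scale0r addr0 mul0r subrr.
Qed.

(** Three steps parallel to the axes, with the mean value theorem for each: continuity of the partial
derivatives gives differentiability. *)
Lemma total_increment phi x h (e : R) : (forall y j, derivable phi y (unitv j)) ->
  (forall j y, `|y - x| <= `|h| -> `|partial j phi y - partial j phi x| <= e) ->
  `|phi (x + h) - phi x - \sum_j h 0 j * partial j phi x| <= 3 * (`|h| * e).
Proof.
move=> dphi He.
pose p1 := x + h 0 0 *: unitv 0; pose p2 := p1 + h 0 1 *: unitv 1.
have [c0 c0h E0] := coord_mvt x (h 0 0) (fun y => dphi y 0).
have [c1 c1h E1] := coord_mvt p1 (h 0 1) (fun y => dphi y 1).
have [c2 c2h E2] := coord_mvt p2 (h 0 2%:R) (fun y => dphi y 2%:R).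
have p3 : p2 + h 0 2%:R *: unitv 2%:R = x + h.
  apply/rowP => i; rewrite /p2 /p1 !mxE.
  case: i => -[|[|[|//]]] ilt /=; rewrite ?mulr0 ?mulr1 ?addr0; congr (_ + h _ _);
    by apply/val_inj.
rewrite p3 in E2.
have sum3 (F : 'I_3 -> R) : \sum_j F j = F 0 + F 1 + F 2%:R.
  by rewrite !big_ord_recr big_ord0 /= add0r; congr (F _ + F _ + F _); exact/val_inj.
have step j c q : `|c| <= `|h 0 j| -> (forall i, i != j -> `|(q - x) 0 i| <= `|h 0 i|) ->
   q 0 j = x 0 j -> `|h 0 j * partial j phi (q + c *: unitv j) - h 0 j * partial j phi x| <= `|h| * e.
  move=> ch qx qj; rewrite -mulrBr normrM; apply: ler_pM => //; first exact: coord_le_norm.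
  apply: He; apply: norm_le_coord => // i.
  rewrite !mxE; have [->|ij] := eqVneq i j.
    by rewrite qj eqxx mulr1 addrAC subrr add0r (le_trans ch)// coord_le_norm.
  rewrite mulr0 addr0; have := qx i ij; rewrite !mxE => /le_trans; apply; exact: coord_le_norm.
have S0 := @step 0 c0 x c0h.
have S1 := @step 1 c1 p1 c1h.
have S2 := @step 2%:R c2 p2 c2h.
rewrite sum3.
have -> : phi (x + h) - phi x - (h 0 0 * partial 0 phi x + h 0 1 * partial 1 phi x + h 0 2%:R * partial 2%:R phi x)
  = (h 0 0 * partial 0 phi (x + c0 *: unitv 0) - h 0 0 * partial 0 phi x) +
    (h 0 1 * partial 1 phi (p1 + c1 *: unitv 1) - h 0 1 * partial 1 phi x) +
    (h 0 2%:R * partial 2%:R phi (p2 + c2 *: unitv 2%:R) - h 0 2%:R * partial 2%:R phi x).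
  rewrite -E0 -E1 -E2; rewrite -/p1 -/p2; ring.
have -> : 3 * (`|h| * e) = `|h| * e + `|h| * e + `|h| * e by ring.
apply: le_trans (ler_normD _ _) _; apply: lerD.
  apply: le_trans (ler_normD _ _) _; apply: lerD.
    by apply: S0 => // i _; rewrite subrr mxE normr0.
  apply: S1; last by rewrite /p1 !mxE mulr0 addr0.
  move=> i i1; rewrite /p1 !mxE /=.
  have [->|i0] := eqVneq i 0; first by rewrite mulr1 addrAC subrr add0r.
  by rewrite mulr0 addr0 subrr normr0.
apply: S2; last by rewrite /p2 /p1 !mxE !mulr0 !addr0.
move=> i i2; rewrite /p2 /p1 !mxE /=.
have [->|i0] := eqVneq i 0; first by rewrite mulr1 mulr0 addr0 addrAC subrr add0r.
have [->|i1] := eqVneq i 1; first by rewrite mulr1 mulr0 addr0 addrAC subrr add0r.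
by rewrite !mulr0 !addr0 subrr normr0.
Qed.

(** The chain rule along the segment and the fundamental theorem of calculus. *)
Lemma edge_gradient phi a b :
  (forall j, continuous (partial j phi)) -> (forall y j, derivable phi y (unitv j)) ->
  \sum_j edge_int (partial j phi) j a b = phi b - phi a.
Proof.
move=> cp dphi.
pose v := b - a; pose g (t : R) := phi (seg a b t).
pose g' (t : R) := \sum_j v 0 j * partial j phi (seg a b t).
have dg (t : R) : is_derive t (1 : R) g (g' t).
  have cvg : (fun h : R => h^-1 *: ((g \o shift t) (h *: (1 : R)) - g t)) @ 0^' --> g' t.
    apply/cvgrPdist_le => e e0.
    pose e1 := e / (3 * (`|v| + 1)).
    have e10 : 0 < e1 by rewrite divr_gt0// mulr_gt0// ltr_wpDl.
    have [r r0 Hr] : exists2 r : R, 0 < r & forall j y, `|y - seg a b t| < r ->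
        `|partial j phi y - partial j phi (seg a b t)| <= e1.
      apply: (@fin_pos_min R _ (fun (j : 'I_3) (r : R) => forall y, `|y - seg a b t| < r ->
        `|partial j phi y - partial j phi (seg a b t)| <= e1)).
        by move=> j r1 r2 r21 H y yr; exact: H (lt_le_trans yr r21).
      move=> j; have := cp j (seg a b t) => /cvgrPdist_le /(_ _ e10) /nbhs_ballP[r /= r0 H].
      by exists r => // y yr; rewrite distrC; apply: H; rewrite -ball_normE /= distrC.
    have hv : \forall h \near 0^', `|h *: v| < r.
      have : (h *: v) @[h --> (0 : R)^'] --> (0 : V).
        rewrite -(scale0r v); apply: cvgZr_tmp; exact: nbhs_dnbhs.
      move/cvgrPdist_lt => /(_ _ r0); apply: filterS => h /=.
      by rewrite sub0r normrN.
    near=> h.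
    have h0 : h != 0 by near: h; exact: nbhs_dnbhs_neq.
    have hvr : `|h *: v| < r by near: h.
    have T := @total_increment phi (seg a b t) (h *: v) e1 dphi
      (fun j y yh => Hr j y (le_lt_trans yh hvr)).
    have -> : g' t - h^-1 *: ((g \o shift t) (h *: (1 : R)) - g t) =
      - (h^-1 * (phi (seg a b t + h *: v) - phi (seg a b t) -
           \sum_j (h *: v) 0 j * partial j phi (seg a b t))).
      rewrite (_ : \sum_j (h *: v) 0 j * _ = h * g' t); last first.
        by rewrite mulr_sumr; apply: eq_bigr => j _; rewrite mxE mulrA.
      rewrite mulrBr mulKf// opprB /g /=; congr (_ - _ * (phi _ - _)).
      by rewrite /seg /v -[h *: (1 : R)]/(h * 1); apply/rowP => i; rewrite !mxE; ring.
    rewrite normrN normrM normfV.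
    apply: (@le_trans _ _ (`|h|^-1 * (3 * (`|h *: v| * e1)))).
      by rewrite ler_wpM2l// invr_ge0.
    have -> : `|h|^-1 * (3 * (`|h *: v| * e1)) = 3 * `|v| * e1.
      by rewrite normrZ; field; rewrite normr_eq0.
    rewrite /e1 mulrA ler_pdivrMr ?mulr_gt0// ?ltr_wpDl//.
    by rewrite [leRHS]mulrC ler_pM2r// ler_pM2l// lerDl.
  split; last by exact/cvg_lim.
  by apply/cvg_ex; exists (g' t).
have cg' : continuous g'.
  move=> t; apply: (@continuous_comp _ _ _ (seg a b) (fun x => \sum_j v 0 j * partial j phi x)).
    exact: seg_continuous.
  exact: (@sum_continuous R _ (index_enum 'I_3) (fun j => v 0 j) (fun j => partial j phi)).
have cg : continuous g by exact: (@der_continuous R g g' dg).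
have F := @continuous_FTC2 R g' g 0 1 ltr01.
transitivity (seg_mean (fun x => \sum_j v 0 j * partial j phi x) a b).
  by rewrite (@seg_mean_sum R _ (index_enum 'I_3)).
rewrite /seg_mean /Rintegral F.
- by rewrite /= /g /seg scale0r addr0 scale1r [a + _]addrC subrK.
- exact: continuous_subspaceT.
- split => [t _||]; first by have [] := dg t.
    by apply: cvg_at_right_filter; exact: cg.
  by apply: cvg_at_left_filter; exact: cg.
by move=> t _; rewrite derive1E; have [_ ->] := dg t.
Unshelve. all: end_near. Qed.

End edge_gradient.

(** * Chains as indexed families; superposition of rows *)

Section chain_tools.
Context {R : realType}.
Local Notation V := 'rV[R]_3.
Implicit Types (ch : seq (V * R)) (ext : set V) (F : V -> V -> R).

(** The weight that enters vertex k, where w0 enters the first one. *)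
Definition prev (w0 : R) (w : nat -> R) k := if k is k'.+1 then w k' else w0.

Lemma balanced_nth ext w0 ch : balanced ext w0 ch ->
  (forall k, (k < size ch)%N -> ext (nth (0, 0) ch k).1 \/
     (nth (0, 0) ch k).2 = prev w0 (fun l => (nth (0, 0) ch l).2) k) /\
  prev w0 (fun l => (nth (0, 0) ch l).2) (size ch) = 0.
Proof.
elim: ch w0 => [|e ch IH] w0 /=; first by [].
move=> [h /IH[H1 H2]]; split.
  case=> [_|k]; first by case: h => h; [left|right].
  by rewrite /= ltnS => /H1; case: k => [|k].
by case: ch H2 {IH H1} => [|e' ch].
Qed.

Lemma chain_sum_nth ext w0 F ch : balanced ext w0 ch ->
  chain_sum F ch = \sum_(k < size ch)
    (nth (0, 0) ch k).2 * F (nth (0, 0) ch k).1 (nth (0, 0) ch k.+1).1.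
Proof.
elim: ch w0 => [|e ch IH] w0 /=; first by rewrite big_ord0.
move=> [_ H]; rewrite big_ord_recl /= (IH _ H); congr (_ + _).
by case: ch H {IH} => [/= ->|//]; rewrite mul0r.
Qed.

Lemma chain_len_nth ext w0 ch : balanced ext w0 ch ->
  chain_len ch = \sum_(k < size ch)
    `|(nth (0, 0) ch k).2| * `|(nth (0, 0) ch k.+1).1 - (nth (0, 0) ch k).1|.
Proof.
elim: ch w0 => [|e ch IH] w0 /=; first by rewrite big_ord0.
move=> [_ H]; rewrite big_ord_recl /= -(IH _ H) /chain_len /=; congr (_ + _).
by case: ch H {IH} => [/= ->|//]; rewrite normr0 mul0r.
Qed.

(** Summation by parts: phi (P k) is multiplied by the jump of the weight at P k, and one of the two
is zero. *)
Lemma abel_sum ext (phi : V -> R) (P : nat -> V) (w : nat -> R) m :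
  (forall x, ext x -> phi x = 0) ->
  (forall k, (k < m)%N -> ext (P k) \/ w k = prev 0 w k) ->
  \sum_(k < m) w k * (phi (P k.+1) - phi (P k)) = prev 0 w m * phi (P m).
Proof.
move=> phi0; elim: m => [|m IH] H; first by rewrite big_ord0 mul0r.
rewrite big_ord_recr /= IH => [|k km]; last by apply: H; exact: ltnW.
case: (H m (ltnSn m)) => [/phi0->|->]; last by ring.
by rewrite mulr0 subr0 add0r.
Qed.

Lemma sum_perturb (F : V -> V -> R) (P : nat -> V) (w : nat -> R) m (e : R) :
  (forall p q (e : R), 0 < e -> exists2 r : R, 0 < r & forall p' q',
     `|p' - p| < r -> `|q' - q| < r -> `|F p' q' - F p q| <= e) ->
  0 < e -> exists2 r : R, 0 < r & forall Q : nat -> V,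
    (forall k, (k <= m)%N -> `|Q k - P k| < r) ->
    `|\sum_(k < m) w k * F (Q k) (Q k.+1) - \sum_(k < m) w k * F (P k) (P k.+1)| <= e.
Proof.
move=> cF e0.
pose W := \sum_(k < m) `|w k| + 1.
have W0 : 0 < W by rewrite ltr_wpDl// sumr_ge0.
have [r r0 Hr] : exists2 r : R, 0 < r & forall (k : 'I_m) p' q',
     `|p' - P k| < r -> `|q' - P k.+1| < r -> `|F p' q' - F (P k) (P k.+1)| <= e / W.
  apply: (@fin_pos_min R _ (fun (k : 'I_m) r => forall p' q',
     `|p' - P k| < r -> `|q' - P k.+1| < r -> `|F p' q' - F (P k) (P k.+1)| <= e / W)).
    by move=> k r r' rr' H p' q' hp hq; apply: H; exact: lt_le_trans rr'.
  by move=> k; apply: cF; rewrite divr_gt0.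
exists r => // Q HQ; rewrite -sumrB; apply: le_trans (ler_norm_sum _ _ _) _.
apply: (@le_trans _ _ (\sum_(k < m) `|w k| * (e / W))).
  apply: ler_sum => k _; rewrite -mulrBr normrM; apply: ler_wpM2l => //.
  by apply: Hr; apply: HQ => //; exact: ltnW.
by rewrite -mulr_suml mulrCA ler_piMr// ?(ltW e0)// ler_pdivrMr// mul1r /W lerDl.
Qed.

Lemma edge_int_near f j p q (e : R) : continuous f ->
  (forall e, 0 < e -> compact [set x | e <= `|f x|]) -> 0 < e ->
  exists2 r : R, 0 < r & forall p' q', `|p' - p| < r -> `|q' - q| < r ->
    `|edge_int f j p' q' - edge_int f j p q| <= e.
Proof.
move=> cf fc e0.
have [C C0 fC] := vanishing_bounded cf fc.
pose L := `|q - p| + 1.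
have L0 : 0 < L by rewrite ltr_wpDl.
have [w w0 Hw] := vanishing_unif cf fc (divr_gt0 (divr_gt0 e0 (@ltr0n _ 2)) L0).
exists (Num.min w (e / (4 * C))); first by rewrite lt_min w0 divr_gt0// mulr_gt0.
move=> p' q'; rewrite !lt_min => /andP[pw pe] /andP[qw qe].
have -> : edge_int f j p' q' - edge_int f j p q =
    ((q' - q) 0 j - (p' - p) 0 j) * seg_mean f p' q' + (q - p) 0 j * (seg_mean f p' q' - seg_mean f p q).
  by rewrite /edge_int !mxE; ring.
apply: le_trans (ler_normD _ _) _.
have -> : e = e / (4 * C) * 2 * C + L * (e / 2 / L).
  by field; rewrite !gt_eqF.
apply: lerD; rewrite normrM; apply: ler_pM => //.
- apply: le_trans (ler_normB _ _) _; rewrite mulr_natr mulr2n; apply: lerD.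
    by apply: le_trans (coord_le_norm _ _) _; exact: ltW.
  by apply: le_trans (coord_le_norm _ _) _; exact: ltW.
- exact: seg_mean_le.
- by apply: le_trans (coord_le_norm _ _) _; rewrite lerDl.
apply: seg_mean_dist => // t /andP[t0 t1]; apply: Hw.
have -> : seg p' q' t - seg p q t = (1 - t) *: (p' - p) + t *: (q' - q).
  by rewrite /seg; apply/rowP => i; rewrite !mxE; ring.
apply: (@le_lt_trans _ _ ((1 - t) * `|p' - p| + t * `|q' - q|)).
  apply: le_trans (ler_normD _ _) _.
  by rewrite !normrZ (ger0_norm t0) ger0_norm// subr_ge0.
have [t0'|t0'] := eqVneq t 0; first by rewrite t0' subr0 mul1r mul0r addr0.
have -> : w = (1 - t) * w + t * w by ring.
apply: ler_ltD; first by apply: ler_wpM2l; [rewrite subr_ge0|exact: ltW].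
by rewrite ltr_pM2l// lt_neqAle eq_sym t0'.
Qed.

Lemma length_near (p q : V) (e : R) : 0 < e ->
  exists2 r : R, 0 < r & forall p' q', `|p' - p| < r -> `|q' - q| < r ->
    `| `|q' - p'| - `|q - p| | <= e.
Proof.
move=> e0; exists (e / 2); first by rewrite divr_gt0.
move=> p' q' hp hq; apply: le_trans (ler_dist_dist _ _) _.
have -> : q' - p' - (q - p) = (q' - q) - (p' - p).
  by rewrite !opprD !opprK addrACA.
by apply: le_trans (ler_normB _ _) _; rewrite [e]splitr; apply: lerD; exact: ltW.
Qed.

Definition lift_chain {N} (i : 'I_N) ch : seq (V * 'rV[R]_N) :=
  [seq (e.1, e.2 *: delta_mx 0 i) | e <- ch].

Definition comp_chain {N} (i : 'I_N) (L : seq (V * 'rV[R]_N)) : seq (V * R) :=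
  [seq (e.1, e.2 0 i) | e : V * 'rV[R]_N <- L].

(** Q contains all real multiples of the coordinate vectors: the scalar is absorbed, up to its sign,
in the positive factor. Each row of the matrix measure can thus be approximated on its
own. *)
Lemma calQ_lift {N} (i : 'I_N) (w : R) : calQ (w *: delta_mx 0 i : 'rV[R]_N).
Proof.
have [w0|w0|->] := ltgtP w 0.
- exists (- w); first by rewrite /= oppr_gt0.
  exists (- delta_mx 0 i) => //; apply/rowP => k; rewrite !mxE eqxx /= intrN rmorph_nat.
  by rewrite mulrNN.
- by exists w => //; exists (delta_mx 0 i) => //; apply/rowP => k; rewrite !mxE rmorph_nat.
by exists 1; [exact: ltr01|exists 0 => //; apply/rowP => k; rewrite !mxE mulr0 mul0r].
Qed.

Lemma comp_lift {N} (i k : 'I_N) ch :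
  comp_chain k (lift_chain i ch) = scale_chain (i == k)%:R ch.
Proof.
rewrite /comp_chain /lift_chain /scale_chain -map_comp; apply: eq_map => e /=.
by rewrite !mxE eqxx /= eq_sym mulrC.
Qed.

(** Concatenation of one chain for each row, with weights in different coordinate directions. As every
chain starts and ends with weight 0, no row sees the chains of the others. *)
Lemma combine_chains N ext (ch : 'I_N -> seq (V * R)) : (forall i, balanced ext 0 (ch i)) ->
  exists L : seq (V * 'rV[R]_N), (forall k, calQ (nth (0, 0) L k).2) /\
    forall i, [/\ balanced ext 0 (comp_chain i L), chain_len (comp_chain i L) = chain_len (ch i) &
      forall F, chain_sum F (comp_chain i L) = chain_sum F (ch i)].
Proof.
move=> chk.
pose L (s : seq 'I_N) := flatten [seq lift_chain i (ch i) | i <- s].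
have LS i s : L (i :: s) = lift_chain i (ch i) ++ L s by [].
have compcat i (l1 l2 : seq (V * 'rV[R]_N)) : comp_chain i (l1 ++ l2) = comp_chain i l1 ++ comp_chain i l2.
  by rewrite /comp_chain map_cat.
have cok i k : balanced ext 0 (scale_chain (k == i)%:R (ch k)).
  by have := balanced_scale (k == i)%:R (chk k); rewrite mulr0.
have H s : uniq s -> forall i, [/\ balanced ext 0 (comp_chain i (L s)),
    chain_len (comp_chain i (L s)) = (i \in s)%:R * chain_len (ch i) &
    forall F, chain_sum F (comp_chain i (L s)) = (i \in s)%:R * chain_sum F (ch i)].
  elim: s => [_ i|k s IH /= /andP[ks us] i]; first by split => [//||F]; rewrite mul0r.
  have [H1 H2 H3] := IH us i.
  rewrite LS compcat comp_lift; split.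
  - by apply: balanced_cat.
  - rewrite (chain_len_cat _ (cok i k)) H2 chain_len_scale in_cons.
    have [ki|ik] := eqVneq k i; first by rewrite -ki normr1 (negbTE ks) !mul1r mul0r addr0.
    by rewrite normr0 mul0r add0r.
  move=> F; rewrite (chain_sum_cat _ _ (cok i k)) H3 chain_sum_scale in_cons.
  have [ki|ik] := eqVneq k i; first by rewrite -ki (negbTE ks) !mul1r mul0r addr0.
  by rewrite mul0r add0r.
exists (L (index_enum 'I_N)); split.
  have Q s k : calQ (nth (0, 0) (L s) k).2.
    have [kL|kL] := ltnP k (size (L s)); last first.
      rewrite nth_default//=; exists 1; first exact: ltr01.
      by exists 0 => //; rewrite map_mx0 scaler0.
    have /flattenP[l /mapP[i _ ->] /mapP[e _ ->]] := mem_nth (0, 0) kL.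
    exact: calQ_lift.
  exact: Q.
move=> i; have [H1 H2 H3] := H _ (index_enum_uniq _) i.
by rewrite mem_index_enum mul1r in H2; split => // F; rewrite H3 mem_index_enum mul1r.
Qed.

End chain_tools.

(** * One polyhedral approximation *)

Lemma partial_test {R : realType} (Omega : set 'rV[R]_3) phi j : test_function Omega phi ->
  [/\ continuous (partial j phi), bounded_borel (partial j phi) & forall x, ~ Omega x -> partial j phi x = 0].
Proof.
move=> [sphi cphi supO].
have p0 x : ~ fsupport phi x -> partial j phi x = 0.
  move=> nx; rewrite /partial -(derive_cst (0 : R) x (unitv j)); apply: near_eq_derive.
  have : nbhs x (~` fsupport phi).
    by apply: open_nbhs_nbhs; split => //; apply: closed_openC; exact: closed_closure.
  apply: filterS => y ny; apply/eqP/negPn/negP => h; apply: ny; exact: subset_fsupport.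
have cp : continuous (partial j phi) by have [] := sphi [:: j].
split => //; last by move=> x Ox; apply: p0 => /supO.
apply: bounded_borel_vanishing => //; apply: compact_support_vanishing => //.
apply: (subclosed_compact _ cphi); first exact: closed_closure.
have -> := (closure_id (fsupport phi)).1 (@closed_closure _ _).
apply: closureS => x /= px; apply: contrapT => /p0 h; by rewrite h eqxx in px.
Qed.

Section stage.
Context {R : realType} {N : nat}.
Local Notation V := 'rV[R]_3.
Context (Omega : set V) (Omega_open : open Omega) (Omega_bounded : bounded_set Omega).
Hypothesis ext_dense : forall x, ~ Omega x -> forall e : R, 0 < e ->
  exists2 y, ~ closure Omega y & `|x - y| < e.
Context (mu : mxcharge R N) (mu_df : divergence_free Omega mu).

Lemma nth_comp_chain (i : 'I_N) (L : seq (V * 'rV[R]_N)) k :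
  nth (0, 0) (comp_chain i L) k = ((nth (0, 0) L k).1, (nth (0, 0) L k).2 0 i).
Proof.
have [kL|kL] := ltnP k (size L); first by rewrite (nth_map (0, 0)).
by rewrite !nth_default ?size_map//= mxE.
Qed.

(** [scalar_approx] for every row, superposed, and moved to general position. The move is small enough
to keep exterior vertices in the exterior, to add at most 1 to the lengths, which therefore
stay bounded by a constant M independent of the family f, and to change the integrals of the
f n by at most eta / 2. Balanced weights and [edge_gradient] make the measure divergence
free. *)
Lemma polyhedral_stage : exists2 M : R, 0 <= M &
  forall (I : finType) (f : I -> V -> R),
    (forall n, continuous (f n)) -> (forall n, compact (fsupport (f n))) ->
    (forall n, fsupport (f n) `<=` Omega) ->
  forall eta, 0 < eta -> exists mu' : mxcharge R N,
    [/\ M1df Omega calQ mu', polyhedral Omega mu',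
        forall i j phi C, continuous phi -> bounded_borel phi -> (forall x, ~ Omega x -> phi x = 0) ->
          (forall x, `|phi x| <= C) -> `|charge_integral (mu' i j) phi| <= C * M &
        forall i j n, `|charge_integral (mu' i j) (f n) - charge_integral (mu i j) (f n)| <= eta].
Proof.
have /choice[M HM] (i : 'I_N) : exists M : R, 0 <= M /\
  forall m (f : 'I_m -> V -> R) (jn : 'I_m -> 'I_3),
    (forall n, continuous (f n)) -> (forall n, compact (fsupport (f n))) ->
    (forall n, fsupport (f n) `<=` Omega) ->
  forall eta, 0 < eta -> exists ch, [/\ balanced [set x | ~ closure Omega x] 0 ch, chain_len ch <= M &
    forall n, `|chain_sum (edge_int (f n) (jn n)) ch - charge_integral (mu i (jn n)) (f n)| <= eta].
  have [M M0 H] := @scalar_approx R Omega Omega_open Omega_bounded ext_dense (mu i)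
    (fun phi t => mu_df t i).
  by exists M; split; [exact: M0|exact: H].
exists (\sum_i M i + 1).
  by rewrite addr_ge0// sumr_ge0// => i _; have [] := HM i.
move=> I f cf kf sf eta eta0.
have eta20 : 0 < eta / 2 by rewrite divr_gt0.
pose ext := [set x | ~ closure Omega x].
have /choice[ch Hch] (i : 'I_N) : exists ch, [/\ balanced ext 0 ch, chain_len ch <= M i &
    forall n j, `|chain_sum (edge_int (f n) j) ch - charge_integral (mu i j) (f n)| <= eta / 2].
  have [_ H] := HM i.
  have [ch [H1 H2 H3]] := H _ (fun k : 'I_#|{: I * 'I_3}| => f (enum_val k).1)
    (fun k => (enum_val k).2) (fun k => cf _) (fun k => kf _) (fun k => sf _) _ eta20.
  exists ch; split => // n j.
  by have := H3 (enum_rank (n, j)); rewrite enum_rankK.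
have [L [LQ HL]] := @combine_chains R N ext ch (fun i => let: And3 h _ _ := Hch i in h).
pose m := size L; pose P k := (nth (0, 0) L k).1; pose th k := (nth (0, 0) L k).2.
have PE i F : \sum_(k < m) th k 0 i * F (P k) (P k.+1) = chain_sum F (ch i).
  have [H1 _ H3] := HL i; rewrite -H3 (chain_sum_nth _ H1) size_map.
  by apply: eq_bigr => k _; rewrite !nth_comp_chain.
have PL i : \sum_(k < m) `|th k 0 i| * `|P k.+1 - P k| = chain_len (ch i).
  have [H1 H2 _] := HL i; rewrite -H2 (chain_len_nth H1) size_map.
  by apply: eq_bigr => k _; rewrite !nth_comp_chain.
have Pok i : (forall k, (k < m)%N -> ext (P k) \/ th k 0 i = prev 0 (fun l => th l 0 i) k) /\
    prev 0 (fun l => th l 0 i) m = 0.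
  have [H1 _ _] := HL i; have := balanced_nth H1; rewrite size_map.
  have -> : (fun l => (nth (0, 0) (comp_chain i L) l).2) = (fun l => th l 0 i).
    by apply/funext => l; rewrite nth_comp_chain.
  by move=> [h1 h2]; split => // k /h1; rewrite !nth_comp_chain.
have vf n : forall e, 0 < e -> compact [set x | e <= `|f n x|].
  exact: compact_support_vanishing.
pose close r (Q : nat -> V) := forall k, (k <= m)%N -> `|Q k - P k| < r.
have closeW r r' Q : r' <= r -> close r' Q -> close r Q.
  by move=> rr' HQ k km; exact: lt_le_trans (HQ k km) rr'.
pose near_int (ijn : 'I_N * 'I_3 * I) r := forall Q, close r Q ->
  `|\sum_(k < m) th k 0 ijn.1.1 * edge_int (f ijn.2) ijn.1.2 (Q k) (Q k.+1) -
    \sum_(k < m) th k 0 ijn.1.1 * edge_int (f ijn.2) ijn.1.2 (P k) (P k.+1)| <= eta / 2.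
have [r1 r10 Hr1] : exists2 r : R, 0 < r & forall ijn, near_int ijn r.
  apply: fin_pos_min => [ijn r r' rr' H Q /(closeW _ _ _ rr')/H//|[[i j] n]].
  apply: (@sum_perturb R (edge_int (f n) j) P (fun k => th k 0 i)) => //.
  by move=> p q e e0; exact: (edge_int_near j p q (cf n) (vf n) e0).
pose near_len (i : 'I_N) r := forall Q, close r Q ->
  `| \sum_(k < m) `|th k 0 i| * `|Q k.+1 - Q k| -
    \sum_(k < m) `|th k 0 i| * `|P k.+1 - P k| | <= 1.
have [r2 r20 Hr2] : exists2 r : R, 0 < r & forall i, near_len i r.
  apply: fin_pos_min => [i r r' rr' H Q /(closeW _ _ _ rr')/H//|i].
  apply: (@sum_perturb R (fun p q => `|q - p|) P (fun k => `|th k 0 i|)) => //.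
  by move=> p q e e0; exact: length_near.
have [r3 r30 Hr3] : exists2 r : R, 0 < r & forall k : 'I_m,
    ext (P k) -> forall y, `|y - P k| < r -> ext y.
  apply: (@fin_pos_min R _ (fun (k : 'I_m) r => ext (P k) -> forall y, `|y - P k| < r -> ext y)).
    by move=> k r r' rr' H e y yr; apply: H => //; exact: lt_le_trans rr'.
  move=> k; have [e|ne] := pselect (ext (P k)); last by exists 1.
  have oe : open ext by apply: closed_openC; exact: closed_closure.
  have /nbhs_ballP[r /= r0 Hr] := open_nbhs_nbhs (conj oe e).
  by exists r => // _ y yr; apply: Hr; rewrite -ball_normE /= distrC.
pose r := Num.min r1 (Num.min r2 r3).
have r0 : 0 < r by rewrite !lt_min r10 r20.
have [Q QP gen] := general_position m.+3 P r0.
have rQ : close r Q by move=> k km; apply: QP; lia.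
have Q1 : close r1 Q by apply: closeW rQ; rewrite /r !ge_min lexx.
have Q2 : close r2 Q by apply: closeW rQ; rewrite /r !ge_min lexx !orbT.
have Q3 : close r3 Q by apply: closeW rQ; rewrite /r !ge_min lexx !orbT.
have [mu' [M1mu' polmu' muE]] :=
  @polyline_measure R N Omega Omega_open m Q th gen (fun k _ => LQ k).
exists mu'; split => //.
- split => // phi tphi i.
  transitivity (\sum_(j < 3) \sum_(k < m) th k 0 i * edge_int (partial j phi) j (Q k) (Q k.+1)).
    by apply: eq_bigr => j _; have [_ bp p0] := partial_test j tphi; rewrite muE.
  rewrite exchange_big /=.
  transitivity (\sum_(k < m) th k 0 i * (phi (Q k.+1) - phi (Q k))).
    apply: eq_bigr => k _; rewrite -mulr_sumr edge_gradient//.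
      by move=> j; have [] := partial_test j tphi.
    by move=> y j; have [sphi _ _] := tphi; have [_] := sphi [::]; exact.
  have [H1 H2] := Pok i.
  apply: etrans (@abel_sum R ext phi Q (fun k => th k 0 i) m _ _) _; last by rewrite H2 mul0r.
    move=> x ex; apply/eqP/negPn/negP => h; apply: ex; apply: subset_closure.
    by have [_ _ sO] := tphi; apply: sO; exact: subset_fsupport.
  move=> k km; have [h|h] := H1 k km; last by right.
  by left; apply: (Hr3 (Ordinal km) h); apply: Q3; exact: ltnW.
- move=> i j phi C cphi bphi phi0 phiC; rewrite muE//.
  have C0 : 0 <= C by exact: le_trans (phiC 0).
  apply: (@le_trans _ _ (C * \sum_(k < m) `|th k 0 i| * `|Q k.+1 - Q k|)).
    rewrite mulr_sumr; apply: le_trans (ler_norm_sum _ _ _) _; apply: ler_sum => k _.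
    by rewrite normrM mulrCA; apply: ler_wpM2l => //; exact: edge_int_le.
  apply: ler_wpM2l => //.
  have [_ Hlen _] := Hch i; rewrite -PL in Hlen.
  have MM : M i <= \sum_i M i.
    by rewrite (bigD1 i)//= lerDl sumr_ge0// => k _; have [] := HM k.
  have := Hr2 i Q Q2; rewrite ler_norml => /andP[_]; rewrite lerBlDr addrC => /le_trans; apply.
  by rewrite lerD2r; exact: le_trans MM.
move=> i j n.
have bf : bounded_borel (f n) by exact: (bounded_borel_vanishing (cf n) (vf n)).
rewrite muE//; last first.
  by move=> x Ox; apply/eqP/negPn/negP => h; apply: Ox; apply: (sf n); exact: subset_fsupport.
have [_ _ H3] := Hch i.
have := Hr1 (i, j, n) Q Q1; rewrite /= PE => h.
apply: le_trans (ler_distD (chain_sum (edge_int (f n) j) (ch i)) _ _) _.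
by rewrite [eta]splitr; apply: lerD.
Qed.

End stage.

(** * Test functions on a grid; conclusion *)

Section grid_stage.
Context {R : realType}.
Local Notation V := 'rV[R]_3.
Context (Omega : set V) (Omega_bounded : bounded_set Omega).

(** The f z are the grid bumps whose support is well inside Omega, the others being replaced by 0. If
a bump centred within 2 d of x is dropped, there is a point outside Omega within 3 d of its
centre, hence within 5 d of x, and phi x is small. *)
Lemma grid_functions (d : R) : 0 < d -> exists (I : finType) (f : I -> V -> R) (c : I -> V),
  [/\ forall z, continuous (f z), forall z, compact (fsupport (f z)),
      forall z, fsupport (f z) `<=` Omega &
      forall (phi : V -> R) (e : R), 0 <= e -> (forall x, ~ Omega x -> phi x = 0) ->
        (forall x y, `|x - y| <= 5 * d -> `|phi x - phi y| <= e) ->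
        forall x, `|\sum_z phi (c z) * f z x - phi x| <= e].
Proof.
move=> d0.
have [B] := @bumps R.
have [rho rho0 Hrho] := bounded_setP Omega_bounded.
have [n nrho] : exists n : nat, rho < (n%:R - 1) * d.
  exists (Num.bound (rho / d)).+1.
  rewrite -ltr_pdivrMr// -natr1 addrK.
  by apply: archi_boundP; rewrite divr_ge0// ltW.
pose I := {ffun 'I_3 -> 'I_(2 * n).+1}.
pose good (z : I) := `[< forall y, `|y - grid_pt d z| <= 3 * d -> Omega y >].
pose f (z : I) x := if good z then grid_bump B d z x else 0.
have fE z x : f z x != 0 -> good z /\ `|x - grid_pt d z| <= 2 * d.
  rewrite /f; case: ifP => gz; last by rewrite eqxx.
  by move=> /(grid_bump_supp d0).
have fsup z x : fsupport (f z) x -> good z /\ `|x - grid_pt d z| <= 2 * d.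
  move=> fx; have gz : good z.
    have [y [/fE[]]] := fx setT filterT; by [].
  split => //; pose D := [set y : V | `|y - grid_pt d z| <= 2 * d].
  suff : D x by [].
  have : closed D.
    rewrite (_ : D = (fun x => `|x - grid_pt d z|) @^-1` [set t | t <= 2 * d])//.
    apply: closed_comp; last exact: closed_le.
    move=> y _; apply: (@continuous_comp _ _ _ (fun y : V => y - grid_pt d z) (fun w : V => `|w|)).
      by apply: (@cvgB _ _ _ (nbhs y) _ id (cst (grid_pt d z))); [exact: cvg_id|exact: cvg_cst].
    exact: norm_continuous.
  move/(closure_id D).1 => ->.
  by apply: closureS fx => y /= /fE[].
exists I, f, (@grid_pt R d n); split.
- move=> z; rewrite /f; case: (good z); last exact: cst_continuous.
  have := tens_class_continuous (grid_bump_comb B d [:: z] (fun=> 1)).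
  by under eq_fun do rewrite big_seq1 mul1r.
- move=> z; apply: bounded_closed_compact; last exact: closed_closure.
  exists (`|grid_pt d z| + 2 * d); split; first exact: num_real.
  move=> M hM x /fsup[_ h]; apply: le_trans (ltW hM).
  by rewrite -[x](subrK (grid_pt d z)) (le_trans (ler_normD _ _))// addrC lerD2l.
- move=> z x /fsup[/asboolP gz h]; apply: gz; apply: le_trans h _.
  by rewrite ler_pM2r// ler_nat.
move=> phi e e0 phi0 phiU x.
have -> : \sum_z phi (grid_pt d z) * f z x = \sum_(z | good z) phi (grid_pt d z) * grid_bump B d z x.
  rewrite [RHS]big_mkcond; apply: eq_bigr => z _; rewrite /f.
  by case: ifP => // _; rewrite mulr0.
apply: grid_bump_approx => //.
  have [Ox|/phi0] := pselect (Omega x); last by right.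
  by left; apply: ltW; apply: le_lt_trans (Hrho x Ox) nrho.
move=> z xz; case: ifP => gz.
  apply: phiU; rewrite distrC; apply: le_trans xz _.
  by rewrite ler_pM2r// ler_nat.
rewrite sub0r normrN.
have /existsNP[y /not_implyP[yz Oy]] : ~ forall y, `|y - grid_pt d z| <= 3 * d -> Omega y.
  by move/asboolP; rewrite -[asbool _]/(good z) gz.
rewrite -[phi x]subr0 -(phi0 y Oy); apply: phiU.
have -> : x - y = (x - grid_pt d z) - (y - grid_pt d z) by rewrite opprB addrA subrK.
apply: le_trans (ler_normB _ _) _; have -> : 5 * d = 2 * d + 3 * d by ring.
exact: lerD.
Qed.

End grid_stage.

Unset Implicit Arguments.

Theorem theorem3p5 (R : realType) (N : nat) (N_ge1 : (1 <= N)%N)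
    (Omega : set 'rV[R]_3) (Omega_open : open Omega)
    (Omega_bounded : bounded_set Omega)
    (Omega_lipschitz : lipschitz_boundary Omega)
    (mu : mxcharge R N) (mu_radon : radon Omega mu)
    (mu_df : divergence_free Omega mu) :
  exists mu_ : nat -> mxcharge R N,
    (forall k, M1df Omega calQ (mu_ k) /\ polyhedral Omega (mu_ k)) /\
    weak_star_cvg Omega mu_ mu.
Proof.
have ext_dense := lipschitz_ext_dense Omega_open Omega_lipschitz.
have [M M0 stage] := polyhedral_stage Omega_open Omega_bounded ext_dense mu_df.
pose d (k : nat) : R := k.+1%:R^-1.
have d0 k : 0 < d k by rewrite invr_gt0.
(* On interpolations psi at scale d k the two measures agree up to C d k: the tolerance for
   each grid function is divided by the number of grid functions. *)
have /choice[mu_ Hmu] (k : nat) : exists mu' : mxcharge R N,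
    [/\ M1df Omega calQ mu', polyhedral Omega mu',
        forall i j phi C, continuous phi -> bounded_borel phi -> (forall x, ~ Omega x -> phi x = 0) ->
          (forall x, `|phi x| <= C) -> `|charge_integral (mu' i j) phi| <= C * M &
        forall i j phi (C e : R), C0 Omega phi -> 0 <= e -> (forall x, `|phi x| <= C) ->
          (forall x y, `|x - y| <= 5 * d k -> `|phi x - phi y| <= e) ->
          exists psi, [/\ continuous psi, bounded_borel psi, forall x, ~ Omega x -> psi x = 0,
            forall x, `|psi x - phi x| <= e &
            `|charge_integral (mu' i j) psi - charge_integral (mu i j) psi| <= C * d k]].
  have [I [f [c [cf kf sf Hf]]]] := grid_functions Omega_bounded (d0 k).
  pose eta := d k / (#|I|%:R + 1).
  have I1 : 0 < #|I|%:R + 1 :> R by rewrite ltr_wpDl.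
  have eta0 : 0 < eta by rewrite divr_gt0.
  have [mu' [m1 m2 m3 m4]] := stage I f cf kf sf eta eta0.
  exists mu'; split => // i j phi C e [cphi phi0 _] e0 phiC phiU.
  have bf z : bounded_borel (f z).
    by apply: bounded_borel_vanishing; [exact: cf|exact: compact_support_vanishing].
  have bcf z : bounded_borel (fun x => phi (c z) * f z x) by exact: bounded_borelZ.
  exists (fun x => \sum_z phi (c z) * f z x); split.
  - exact: (@sum_continuous R _ (index_enum I) (fun z => phi (c z)) f).
  - exact: bounded_borel_sum.
  - move=> x Ox; rewrite big1// => z _.
    have [->|h] := eqVneq (f z x) 0; first by rewrite mulr0.
    by case: Ox; apply: (sf z); exact: subset_fsupport.
  - exact: Hf.
  rewrite !charge_integral_sum// -sumrB.
  have C0 : 0 <= C by exact: le_trans (phiC 0).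
  apply: le_trans (ler_norm_sum _ _ _) _.
  apply: (@le_trans _ _ (\sum_(z : I) C * eta)).
    apply: ler_sum => z _; rewrite !charge_integralZ// -mulrBr normrM.
    exact: ler_pM.
  rewrite sumr_const -mulr_natr -mulrA; apply: ler_wpM2l => //.
  rewrite /eta -mulrA; apply: ler_piMr; first exact: ltW.
  by rewrite mulrC ler_pdivrMr// mul1r lerDl.
exists mu_; split; first by move=> k; have [] := Hmu k.
move=> phi Cphi i j.
have [cphi phi0 kphi] := Cphi.
have bphi : bounded_borel phi by exact: bounded_borel_vanishing.
have [C C0 phiC] := vanishing_bounded cphi kphi.
have [M' M'0 HM'] := charge_mass (mu i j).
apply/cvgrPdist_le => e e0.
pose e1 := e / 2 / (M + M' + 1).
have MM : 0 < M + M' + 1 by rewrite ltr_wpDl// addr_ge0.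
have e10 : 0 < e1 by rewrite !divr_gt0.
have [r r0 phiU] := vanishing_unif cphi kphi e10.
pose s := Num.min (r / 5) (e / 2 / C).
have s0 : 0 < s by rewrite lt_min !divr_gt0.
near=> k.
have dks : d k < s.
  by near: k; exact: near_infty_natSinv_lt (PosNum s0).
have [_ _ bound /(_ i j phi C e1 Cphi (ltW e10) phiC)] := Hmu k.
case=> [x y xy|psi [cpsi bpsi psi0 psiU H]].
  apply: phiU; apply: le_lt_trans xy _.
  by rewrite mulrC -ltr_pdivlMr//; apply: lt_le_trans dks _; rewrite /s ge_min lexx.
(* The error of interpolation is integrated against both measures, of bounded mass. *)
pose g x := psi x + -1 * phi x.
have bg : bounded_borel g by apply: bounded_borelD => //; exact: bounded_borelZ.
have cg : continuous g.
  by rewrite /g => x; have := cvgD (cpsi x) (cvgM (cvg_cst (-1 : R)) (cphi x)); exact.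
have g0 x : ~ Omega x -> g x = 0 by move=> Ox; rewrite /g psi0// phi0// mulr0 addr0.
have gU x : `|g x| <= e1 by rewrite /g mulN1r.
have gE nu : charge_integral nu g = charge_integral nu psi - charge_integral nu phi.
  by rewrite /g charge_integralD// ?charge_integralZ// ?mulN1r//; exact: bounded_borelZ.
have B1 := bound i j g e1 cg bg g0 gU; have B2 := HM' g e1 bg gU.
rewrite gE in B1; rewrite gE in B2.
have B3 : C * d k <= e / 2.
  by rewrite mulrC -ler_pdivlMr//; apply: le_trans (ltW dks) _; rewrite /s ge_min lexx orbT.
have B4 : e1 * M + e1 * M' <= e / 2.
  rewrite -mulrDr /e1 -mulrA; apply: ler_piMr; first by rewrite ltW// divr_gt0.
  by rewrite mulrC ler_pdivrMr// mul1r lerDl.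
move: H B1 B2 B3 B4.
set a := charge_integral (mu_ k i j) psi; set b := charge_integral (mu i j) psi.
set a' := charge_integral (mu_ k i j) phi; set b' := charge_integral (mu i j) phi.
move=> H B1 B2 B3 B4.
have -> : b' - a' = (a - a') - (a - b) - (b - b') by ring.
apply: le_trans (ler_normB _ _) _; apply: le_trans (lerD (ler_normB _ _) (lexx _)) _.
apply: le_trans (lerD (lerD B1 H) B2) _.
rewrite addrAC [e]splitr; apply: lerD => //.
Unshelve. all: end_near. Qed.
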